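(* Let $\alpha,\beta$ be rational numbers with $0\le\alpha<\beta\le1$ and put $I=(\alpha,\beta)$. Then $\chi_I\in\mathcal{C}$ if and only if $I$ is one of the ten intervals $$(0,1),(0,\tfrac12),(\tfrac12,1),(0,\tfrac23),(\tfrac13,\tfrac23),(\tfrac13,1),(\tfrac14,\tfrac34),(\tfrac15,\tfrac35),(\tfrac25,\tfrac45),(\tfrac16,\tfrac56).$$
   Context: $\chi_I$ is the characteristic function of $I$ on $(0,1)$. $L^2=L^2(0,1)$; each $\varphi\in L^2$ is identified with its odd $2$-periodic extension to $\mathbb{R}$. $\mathcal{C}$ is the set of $\varphi\in L^2$ such that the span of $\{\varphi(kx):k\in\mathbb{N}\}$ is dense in $L^2$. *)

(* Defs.v *)
From HB Require Import structures.
From mathcomp Require Import all_boot all_order all_algebra.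
From mathcomp Require Import all_classical all_reals all_analysis.
Set Implicit Arguments. Unset Strict Implicit. Unset Printing Implicit Defensive.
Import Order.TTheory GRing.Theory Num.Theory.
Import numFieldNormedType.Exports.
Local Open Scope classical_set_scope.
Local Open Scope ring_scope.

Section Defs.
Variable R : realType.

Definition I01 : set R := `]0, 1[%classic.

Definition chi (a b : R) : R -> R := fun x => if (a < x < b) then 1 else 0.

(* Odd 2-periodic extension of f, where f is regarded as a function on (0,1).
   With r = y mod 2 in [0,2): value f r on (0,1), -f (2-r) on (1,2), and 0 at
   the (measure-zero) integer points. *)
Definition oddext (f : R -> R) (y : R) : R :=
  let r := y - 2 * (Num.floor (y / 2))%:~R in
  if (0 < r < 1) then f r
  else if (1 < r < 2) then - f (2 - r)
  else 0.

Definition dil (f : R -> R) (k : nat) : R -> R := fun x => oddext f (k%:R * x).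

Definition sqint (h : R -> R) : \bar R :=
  (\int[lebesgue_measure]_(x in I01) ((h x) ^+ 2)%:E)%E.

Definition inL2 (h : R -> R) : Prop :=
  measurable_fun I01 h /\ (sqint h < +oo)%E.

Definition inC (phi : R -> R) : Prop :=
  inL2 phi /\
  forall g : R -> R, inL2 g -> forall eps : R, 0 < eps ->
    exists (n : nat) (c : 'I_n -> R),
      (sqint (fun x => (g x - \sum_(k < n) c k * dil phi k.+1 x)%R) < eps%:E)%E.

End Defs.

(* Main.v *)
(* With c_n = cos (n pi alpha) - cos (n pi beta), the indicator function of
   (alpha, beta) has sine coefficients 2 c_n / (n pi), and c_n is periodic in n, say
   of period N.  Its Bohr lift is F(z) = sum_n (c_n / n) prod_p z_p ^ v_p(n), a
   function of one variable z_p in the open unit disc per prime p.  A zero of F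
   supported on finitely many primes yields a nonzero bounded functional vanishing on
   all dilates, so F is zero-free when the span of the dilates is dense.

   Let h be a class mod N with sum_{p = h mod N} 1 / p = oo.  Spreading one complex
   variable over many primes of that class turns F into a zero-free entire function
   of small growth, and a Borel-Caratheodory estimate applied to its truncations
   shows that its logarithm is linear.  With the periodicity of c and a variation of
   z_2 this gives c_h = s c_1 and c_{2h} = s c_2 with s = 1 or s = -1: multiplication
   by h permutes {cos (pi alpha), cos (pi beta)}.  The units h with this property
   form a group, and the primes outside it have a convergent sum of reciprocals,
   which forces the group to contain every unit mod N.  Hence cos (pi alpha) and
   cos (pi beta) have at most two conjugates, 60 alpha and 60 beta are integers, and
   a finite check leaves fourteen intervals, for four of which F has an explicit zero
   supported on the primes 2 and 3.

   For the ten remaining ones c_n = kappa (lambda_n + sigma q lambda_{n/q}) with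
   lambda completely multiplicative and sigma in {0, 1, -1}.  Sieving by the small
   primes inverts the first factor up to a small square sum and Fejer weights invert
   1 + sigma T_q, so every sin (j pi x) is a limit of combinations of dilates; and
   the sines are dense in L^2(0,1). *)
Require Import Defs.
From HB Require Import structures.
From mathcomp Require Import all_boot all_order all_algebra all_solvable all_field.
From mathcomp Require Import all_classical all_reals all_analysis.
From mathcomp Require Import measurable_realfun complex.
From mathcomp Require Import ring lra zify.
Set Implicit Arguments. Unset Strict Implicit. Unset Printing Implicit Defensive.
Import Order.TTheory GRing.Theory Num.Theory.
Import numFieldNormedType.Exports.
Local Open Scope classical_set_scope.
Local Open Scope ring_scope.
Local Notation Re := (@complex.Re _).
Local Notation Im := (@complex.Im _).

(** * The modulus on R[i] and a Borel-Caratheodory estimate *)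

(** The truncations are the polynomials [had f (geomPs P)] in one variable shared by all primes of
    [P]. With W the sum of 1 / p over [P], their modulus on the disc is at most B exp (2 W), while
    the quadratic coefficient of their logarithm contains W^2 times f(h)^2 / f(1)^2 - f(h^2) / f(1),
    up to a constant factor. Zero-freeness bounds that coefficient linearly in W, so unbounded W
    kills the factor of W^2. A Taylor expansion in one more prime of the class gives f(h^k) = q^k
    f(1), and Euler's theorem with the reality of f forces q = 1 or q = -1. The relation for c_h
    alone fixes only the difference of two cosines. Since cos 2x is quadratic in cos x, the relation
    for c_{2h} with the same sign fixes their sum. In the weak Dirichlet theorem, sieving out primes
    with convergent sum of reciprocals changes harmonic sums by bounded factors only, and these
    cannot offset a divergent harmonic sum. For the ten intervals sigma may have modulus 1, where
    the Neumann series of 1 + sigma T_q does not converge in norm; hence the averaged weights. *)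

Section ComplexModulus.
Variable R : rcfType.
Local Notation C := R[i].
Implicit Types x y z : C.

Definition nc (z : C) : R := Normc.normc z.
Definition RC (x : R) : C := x%:C%C.

Lemma nc_ge0 z : 0 <= nc z.
Proof. by case: z => a b; exact: sqrtr_ge0. Qed.

Lemma nc0 : nc 0 = 0. Proof. exact: Normc.normc0. Qed.
Lemma nc1 : nc 1 = 1. Proof. exact: Normc.normc1. Qed.
Lemma ncM x y : nc (x * y) = nc x * nc y. Proof. exact: Normc.normcM. Qed.
Lemma ncV x : nc x^-1 = (nc x)^-1. Proof. exact: Normc.normcV. Qed.
Lemma ncD x y : nc (x + y) <= nc x + nc y. Proof. exact: le_normcD. Qed.
Lemma ncN x : nc (- x) = nc x. Proof. exact: normcN. Qed.
Lemma ncB x y : nc (x - y) <= nc x + nc y. Proof. by rewrite -(ncN y) ncD. Qed.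

Lemma nc_eq0 z : (nc z == 0) = (z == 0).
Proof. by apply/eqP/eqP => [/Normc.eq0_normc //|->]; rewrite nc0. Qed.

Lemma nc_gt0 z : (0 < nc z) = (z != 0).
Proof. by rewrite lt_def nc_ge0 andbT nc_eq0. Qed.

Lemma ncX z n : nc (z ^+ n) = nc z ^+ n.
Proof. by elim: n => [|n IH]; rewrite ?expr0 ?nc1 // !exprS ncM IH. Qed.

Lemma nc_prod (I : Type) (s : seq I) (P : pred I) (F : I -> C) :
  nc (\prod_(i <- s | P i) F i) = \prod_(i <- s | P i) nc (F i).
Proof. exact: (big_morph nc ncM nc1). Qed.

Lemma nc_sum (I : Type) (s : seq I) (P : pred I) (F : I -> C) :
  nc (\sum_(i <- s | P i) F i) <= \sum_(i <- s | P i) nc (F i).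
Proof.
elim/big_rec2: _ => [|i y x _ le]; first by rewrite nc0.
by rewrite (le_trans (ncD _ _))// lerD2l.
Qed.

Lemma nc_sqr z : nc z ^+ 2 = Re z ^+ 2 + Im z ^+ 2.
Proof. by case: z => a b; rewrite /nc/= sqr_sqrtr// addr_ge0 ?sqr_ge0. Qed.

Lemma Re_le_nc z : `|Re z| <= nc z.
Proof.
rewrite -ler_sqr ?nnegrE ?nc_ge0// nc_sqr real_normK ?num_real//.
by rewrite lerDl sqr_ge0.
Qed.

Lemma ncRC (a : R) : nc (RC a) = `|a|.
Proof. by rewrite /nc/= expr0n/= addr0 sqrtr_sqr. Qed.

Lemma ReD x y : Re (x + y) = Re x + Re y. Proof. by case: x; case: y. Qed.
Lemma ReN x : Re (- x) = - Re x. Proof. by case: x. Qed.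
Lemma Re_sum (I : Type) (s : seq I) (P : pred I) (F : I -> C) :
  Re (\sum_(i <- s | P i) F i) = \sum_(i <- s | P i) Re (F i).
Proof. by elim/big_rec2: _ => [//|i y x _ <-]; rewrite ReD. Qed.
Lemma ReZ (a : R) z : Re (RC a * z) = a * Re z.
Proof. by case: z => x y /=; rewrite mul0r subr0. Qed.

Lemma RC0 : RC 0 = 0. Proof. by []. Qed.
Lemma RC1 : RC 1 = 1. Proof. by []. Qed.
Lemma RCM : {morph RC : x y / x * y}. Proof. exact: rmorphM. Qed.
Lemma RCX n : {morph RC : x / x ^+ n}. Proof. exact: rmorphXn. Qed.
Lemma RCN : {morph RC : x / - x}. Proof. exact: rmorphN. Qed.
Lemma RCB : {morph RC : x y / x - y}. Proof. exact: rmorphB. Qed.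
Lemma RCV : {morph RC : x / x^-1}. Proof. exact: (fmorphV (real_complex R)). Qed.
Lemma RC_nat n : RC n%:R = n%:R. Proof. exact: (rmorph_nat (real_complex R)). Qed.
Lemma RC_sum (I : Type) (s : seq I) (P : pred I) (F : I -> R) :
  RC (\sum_(i <- s | P i) F i) = \sum_(i <- s | P i) RC (F i).
Proof. exact: (rmorph_sum (real_complex R)). Qed.

End ComplexModulus.

Section BorelCaratheodory.
Variable R : realType.
Local Notation C := R[i].
Implicit Types x y z : C.

Lemma exists_prim_root n : (0 < n)%N -> exists z : C, n.-primitive_root z.
Proof.
move=> n_gt0; have [r] := closed_field_poly_normal ('X^n - 1 : {poly C}).
rewrite (monicP _) ?monicXnsubC // scale1r => Dp.
have rn1 : all n.-unity_root r by apply/allP=> z; rewrite -root_prod_XsubC -Dp.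
have sz_r : (n < (size r).+1)%N.
  by rewrite -(size_prod_XsubC r id) -Dp size_XnsubC.
have [|z] := hasP (has_prim_root n_gt0 rn1 _ sz_r); last by exists z.
by rewrite -separable_prod_XsubC -Dp separable_Xn_sub_1 // pnatr_eq0 -lt0n.
Qed.

Lemma sum_prim_root n k (w : C) : n.-primitive_root w -> ~~ (n %| k)%N ->
  \sum_(j < n) w ^+ (j * k) = 0.
Proof.
move=> pw nk; have wk : w ^+ k - 1 != 0 by rewrite subr_eq0 -(prim_order_dvd pw).
apply: (mulfI wk); rewrite mulr0.
under eq_bigr => j _ do rewrite mulnC exprM.
by rewrite -subrX1 -exprM mulnC exprM (prim_expr_order pw) expr1n subrr.
Qed.

Lemma nc_prim_root n (w : C) k : n.-primitive_root w -> nc (w ^+ k) = 1.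
Proof.
move=> pw; have n0 := prim_order_gt0 pw.
have: nc w ^+ n == 1 by rewrite -ncX (prim_expr_order pw) nc1.
by rewrite pexpr_eq1 ?nc_ge0// ncX => /eqP ->; rewrite expr1n.
Qed.

(* The derivative of [ln |1 - s z|] in [s] is [- Re (z / (1 - s z))], whose
   Taylor remainder is [- Re (s^m z^(m+1) / (1 - s z))]. *)
Lemma ln_nc_taylor (z : C) m : nc z <= 2^-1 ->
  `|ln (nc (1 - z)) + \sum_(k < m) Re (z ^+ k.+1) / k.+1%:R| <= 2 * nc z ^+ m.+1.
Proof.
move=> z2.
have sz (s : R) : s \in `[0, 1] -> 2^-1 <= nc (1 - RC s * z).
  rewrite in_itv/= => /andP[s0 s1].
  have : 1 <= nc (1 - RC s * z) + nc (RC s * z).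
    by rewrite -[X in X <= _](nc1 R) (le_trans _ (ncD _ _))// subrK.
  rewrite ncM ncRC ger0_norm// => h.
  have : s * nc z <= 1 * 2^-1 by apply: ler_pM; rewrite ?nc_ge0.
  lra.
(* [q.[s]] is the squared modulus of [1 - s z] and [t] the Taylor polynomial. As polynomials in the
   real variable [s], both are differentiated formally. *)
pose q : {poly R} := (1 - Re z *: 'X) ^+ 2 + (Im z *: 'X) ^+ 2.
pose t : {poly R} := \sum_(k < m) (Re (z ^+ k.+1) / k.+1%:R) *: 'X^(k.+1).
have qE s : q.[s] = nc (1 - RC s * z) ^+ 2.
  by rewrite nc_sqr /q !hornerE /=; case: (z) => a b /=; ring.
have tE s : t.[s] = \sum_(k < m) Re (z ^+ k.+1) / k.+1%:R * s ^+ k.+1.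
  by rewrite /t horner_sum; apply: eq_bigr => k _; rewrite !hornerE.
pose f s := 2^-1 * ln q.[s] + t.[s].
have q_gt0 (s : R) : s \in `[0, 1] -> 0 < q.[s].
  by move=> /sz h; rewrite qE exprn_gt0// (lt_le_trans _ h)// invr_gt0.
have f1 : f 1 = ln (nc (1 - z)) + \sum_(k < m) Re (z ^+ k.+1) / k.+1%:R.
  have h1 : (1 : R) \in `[0, 1] by rewrite in_itv/= ler01 lexx.
  rewrite /f qE lnXn; last by rewrite (lt_le_trans _ (sz _ h1))// invr_gt0.
  have -> : RC 1 * z = z by rewrite mul1r.
  rewrite tE mulr2n; congr (_ + _); first by field.
  by apply: eq_bigr => k _; rewrite expr1n mulr1.
have f0 : f 0 = 0.
  have e0 : RC 0 * z = 0 by rewrite RC0 mul0r.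
  rewrite /f qE e0 subr0 nc1 expr1n ln1 mulr0 add0r tE big1// => k _.
  by rewrite expr0n mulr0.
pose df s := 2^-1 * (q^`().[s] / q.[s]) + t^`().[s].
have fD (s : R) : s \in `[0, 1] -> is_derive s 1 f (df s).
  move=> /q_gt0 qs; rewrite /df.
  have -> : f = (2^-1 \*: ((@ln R) \o (horner q))) \+ horner t by [].
  apply: is_deriveD; apply: is_deriveZ.
  by rewrite mulrC; apply: is_derive1_comp; exact: is_derive1_ln.
have dfE (s : R) : s \in `[0, 1] -> df s = - Re (RC s ^+ m * z ^+ m.+1 / (1 - RC s * z)).
  move=> h; have qs := q_gt0 _ h.
  have d0 : 1 - RC s * z != 0 by rewrite -nc_gt0 (lt_le_trans _ (sz _ h))// invr_gt0.
  have tD : t^`().[s] = Re (\sum_(k < m) RC s ^+ k * z ^+ k.+1).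
    rewrite /t raddf_sum horner_sum Re_sum; apply: eq_bigr => k _.
    rewrite /= derivZ derivXn !hornerE hornerMn hornerXn -RCX ReZ /=.
    by rewrite -(mulr_natl (s ^+ k)) mulrA divfK ?pnatr_eq0// mulrC.
  have qD : 2^-1 * (q^`().[s] / q.[s]) = Re (- z / (1 - RC s * z)).
    have -> : q^`().[s] = 2 * (1 - s * Re z) * - Re z + 2 * (s * Im z) * Im z.
      rewrite /q !expr2 !poly.derivE !hornerE /=; ring.
    rewrite qE nc_sqr.
    have : Re (1 - RC s * z) ^+ 2 + Im (1 - RC s * z) ^+ 2 != 0.
      by rewrite -nc_sqr -qE gt_eqF.
    case: (z) => a b /=; rewrite !mul0r !subr0 !addr0 !sub0r.
    rewrite sqrrN => d; move: d; move: (_ + _ ^+ 2) => d d_neq0; field.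
    by [].
  rewrite /df qD tD -ReD -ReN; congr (complex.Re _).
  have -> : \sum_(k < m) RC s ^+ k * z ^+ k.+1 =
      z * (1 - RC s ^+ m * z ^+ m) / (1 - RC s * z).
    apply: (mulIf d0); rewrite divfK//.
    under eq_bigr => k _ do rewrite exprSr mulrA -exprMn.
    rewrite -mulr_suml mulrAC -[RHS]mulrC -exprMn; congr (_ * _).
    by rewrite mulrC -opprB mulNr -subrX1 opprB.
  by rewrite exprS; field.
have fc : {within `[0, 1], continuous f}.
  apply: derivable_within_continuous => s s01.
  by have [] := fD s s01.
have fDo (s : R) : s \in `]0, 1[ -> is_derive s 1 f (df s).
  by move=> s01; apply: fD; exact: subset_itv_oo_cc s01.
have le01 : (0 : R) <= 1 by exact: ler01.
have [c c01] := MVT_segment le01 fDo fc.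
rewrite f1 f0 !subr0 mulr1 => ->; rewrite dfE// normrN.
rewrite (le_trans (Re_le_nc _))// !ncM ncV !ncX ncRC.
have c1 : `|c| ^+ m <= 1.
  by move: c01; rewrite in_itv/= => /andP[c0 c1]; rewrite ger0_norm// exprn_ile1.
rewrite mulrC; apply: ler_pM => //.
- by rewrite invr_ge0 nc_ge0.
- by rewrite mulr_ge0// exprn_ge0// nc_ge0.
- by rewrite -[2]invrK lef_pV2 ?posrE ?invr_gt0// ?sz// (lt_le_trans _ (sz _ c01))// invr_gt0.
- by rewrite ler_piMl// exprn_ge0// nc_ge0.
Qed.

(** Product-to-sum formula: on the unit circle [A^-1] is the conjugate of [A]. *)
Lemma ReM_unit (A B : C) : nc A = 1 -> 2 * Re A * Re B = Re (A * B) + Re (A^-1 * B).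
Proof.
move=> A1; have := nc_sqr A; rewrite A1 expr1n; case: A {A1} => a b /= ab.
case: B => c d /=; rewrite -ab !divr1; ring.
Qed.

(** The weight has frequencies 0, 2 and -2, so the sum involves the frequencies k+1, k+3 and k-1
    modulo m+3, the last one written m+k+2. With m+3 points none of them is 0 for k < m, except k-1
    at k = 1. The 8 is 4 from the radius 1/2 squared, times 2 from the product formula. *)
Lemma sum_weight_powers m k (w l : C) (e : R) : m.+3.-primitive_root w -> (k < m)%N ->
  \sum_(j < m.+3) (1 + e * Re (w ^+ (j * 2))) * Re ((l * (RC 2^-1 * w ^+ j)) ^+ k.+1) =
  (k == 1%N)%:R * (m.+3%:R * e * Re (l ^+ 2) / 8).
Proof.
move=> pw km; set L := l * RC 2^-1.
have sum1 n B : ~~ (m.+3 %| n)%N -> \sum_(j < m.+3) Re (B * w ^+ (j * n)) = 0.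
  by move=> nK; rewrite -Re_sum -mulr_sumr (sum_prim_root pw nK) mulr0.
have dvd_small n : (0 < n)%N -> (n < m.+3)%N -> ~~ (m.+3 %| n)%N.
  by move=> n0 nm; apply/negP => /(dvdn_leq n0); rewrite leqNgt nm.
have E j : (1 + e * Re (w ^+ (j * 2))) * Re ((l * (RC 2^-1 * w ^+ j)) ^+ k.+1) =
   Re (L ^+ k.+1 * w ^+ (j * k.+1)) + e / 2 *
   (Re (L ^+ k.+1 * w ^+ (j * k.+3)) + Re (L ^+ k.+1 * w ^+ (j * (m + k).+2))).
  have := ReM_unit (L ^+ k.+1 * w ^+ (j * k.+1)) (nc_prim_root (j * 2) pw).
  have -> : (w ^+ (j * 2))^-1 = w ^+ (j * m.+1).
    apply: (mulfI (x := w ^+ (j * 2))).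
      by rewrite -nc_gt0 (nc_prim_root _ pw).
    rewrite mulfV; last by rewrite -nc_gt0 (nc_prim_root _ pw).
    by rewrite -exprD -mulnDr add2n mulnC exprM (prim_expr_order pw) expr1n.
  have -> : w ^+ (j * 2) * (L ^+ k.+1 * w ^+ (j * k.+1)) = L ^+ k.+1 * w ^+ (j * k.+3).
    by rewrite mulrCA -exprD -mulnDr; congr (_ * _ ^+ (_ * _)); lia.
  have -> : w ^+ (j * m.+1) * (L ^+ k.+1 * w ^+ (j * k.+1)) = L ^+ k.+1 * w ^+ (j * (m + k).+2).
    by rewrite mulrCA -exprD -mulnDr; congr (_ * _ ^+ (_ * _)); lia.
  by move=> <-; rewrite (mulrA l) -/L exprMn -exprM; field.
under eq_bigr => j _ do rewrite E.
rewrite big_split/= -mulr_sumr big_split/=.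
rewrite (sum1 k.+1); last by apply: dvd_small => //; lia.
rewrite (sum1 k.+3); last by apply: dvd_small => //; lia.
rewrite !add0r; have [->|k1] := eqVneq k 1%N.
  under eq_bigr => j _ do
    rewrite addn1 mulnC exprM (prim_expr_order pw) expr1n mulr1 exprMn -RCX mulrC ReZ.
  by rewrite sumr_const card_ord -mulr_natl mul1r; field.
rewrite mul0r sum1 ?mulr0//.
case: k {E} km k1 => [|[//|k]] km _; first by rewrite addn0 dvd_small.
have -> : (m + k.+2).+2 = (m.+3 + k.+1)%N by lia.
by rewrite dvdn_addr//; apply: dvd_small => //; lia.
Qed.

Lemma sum_weights m (w : C) (e : R) : m.+3.-primitive_root w ->
  \sum_(j < m.+3) (1 + e * Re (w ^+ (j * 2))) = m.+3%:R.
Proof.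
move=> pw; rewrite big_split/= sumr_const card_ord -mulr_sumr -Re_sum.
by rewrite (sum_prim_root pw) ?mulr0 ?addr0.
Qed.

Lemma ln_prod (I : eqType) (s : seq I) (F : I -> R) :
  (forall i, i \in s -> 0 < F i) -> ln (\prod_(i <- s) F i) = \sum_(i <- s) ln (F i).
Proof.
elim: s => [|i s IH] F0; first by rewrite !big_nil ln1.
have Fs j : j \in s -> 0 < F j by move=> js; rewrite F0// inE js orbT.
rewrite !big_cons lnM ?IH// posrE; first by rewrite F0// inE eqxx.
by rewrite big_seq prodr_gt0.
Qed.

(* [ln |prod (1 - l t)|] is averaged over the points [t = w^j / 2] of a circle
   with the nonnegative weights [1 + e cos (2 arg t)]. *)
Lemma sum_sqr_le_ln_aux (lam : seq C) (M e : R) (m : nat) : (1 < m)%N -> `|e| <= 1 ->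
  (forall l, l \in lam -> nc l <= 1) ->
  (forall t, nc t <= 1 -> nc (\prod_(l <- lam) (1 - l * t)) <= M) ->
  - e * Re (\sum_(l <- lam) l ^+ 2) <= 16 * ln M + 16 * (size lam)%:R * 2^-1 ^+ m.
Proof.
move=> m1 e1 lam1 bd.
have [w pw] := @exists_prim_root m.+3 isT.
pose t j : C := RC 2^-1 * w ^+ j.
have nct j : nc (t j) = 2^-1.
  by rewrite /t ncM ncRC (nc_prim_root _ pw) mulr1 ger0_norm.
pose W j := 1 + e * Re (w ^+ (j * 2)).
have W0 j : 0 <= W j.
  rewrite /W -lerBlDl sub0r; have : `|e * Re (w ^+ (j * 2))| <= 1.
    rewrite normrM -[1]mulr1; apply: ler_pM => //.
    by rewrite (le_trans (Re_le_nc _))// (nc_prim_root _ pw).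
  by rewrite ler_norml => /andP[].
have lt2 l j : l \in lam -> nc (l * t j) <= 2^-1.
  by move=> /lam1 l1; rewrite ncM nct ler_piMl.
have f0 l j : l \in lam -> 0 < nc (1 - l * t j).
  move=> /lt2 => /(_ j) h.
  have := ncD (1 - l * t j) (l * t j); rewrite subrK nc1; lra.
have S1 : \sum_(j < m.+3) W j * \sum_(l <- lam) ln (nc (1 - l * t j)) <= m.+3%:R * ln M.
  rewrite -(sum_weights e pw) mulr_suml; apply: ler_sum => j _.
  apply: ler_wpM2l => //.
  have : 0 < \prod_(l <- lam) nc (1 - l * t j) by rewrite big_seq prodr_gt0// => l /f0.
  have -> : \sum_(l <- lam) ln (nc (1 - l * t j)) = ln (\prod_(l <- lam) nc (1 - l * t j)).
    by rewrite ln_prod// => l /f0.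
  rewrite -nc_prod => p0; rewrite ler_ln ?posrE//.
    by apply: bd; rewrite nct invf_le1// ler1n.
  by rewrite (lt_le_trans p0)// bd// nct invf_le1// ler1n.
(* Under the weights only the quadratic Taylor term survives. Its coefficient 1/2 turns 1/8 into
   1/16, and the weights have total m+3. *)
have S2 l : l \in lam -> - (m.+3%:R * e * Re (l ^+ 2) / 16 + m.+3%:R * 2^-1 ^+ m) <=
   \sum_(j < m.+3) W j * ln (nc (1 - l * t j)).
  move=> ll.
  have : \sum_(j < m.+3) W j * (- (\sum_(k < m) Re ((l * t j) ^+ k.+1) / k.+1%:R) - 2 * 2^-1 ^+ m.+1)
    <= \sum_(j < m.+3) W j * ln (nc (1 - l * t j)).
    apply: ler_sum => j _; apply: ler_wpM2l => //.
    have := ln_nc_taylor m (lt2 _ j ll); rewrite ler_norml => /andP[h _].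
    have : nc (l * t j) ^+ m.+1 <= 2^-1 ^+ m.+1 by rewrite lerXn2r ?nnegrE ?nc_ge0 ?lt2.
    by move: h; lra.
  apply: le_trans; rewrite le_eqVlt; apply/orP; left; apply/eqP.
  under [RHS]eq_bigr => j _ do rewrite mulrBr mulrN.
  have -> : 2 * 2^-1 ^+ m.+1 = 2^-1 ^+ m :> R by rewrite exprS mulrA mulfV ?mul1r.
  rewrite sumrB sumrN -mulr_suml (sum_weights e pw).
  rewrite opprD; congr (- _ - _).
  under [RHS]eq_bigr => j _ do rewrite mulr_sumr.
  rewrite exchange_big/=.
  under [RHS]eq_bigr => k _.
    under eq_bigr => j _ do rewrite mulrA.
    rewrite -mulr_suml (sum_weight_powers _ _ pw)//.
    over.
  rewrite (bigD1 (Ordinal m1))//= big1 ?addr0.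
    by rewrite mul1r; field.
  by move=> k; rewrite -val_eqE /= => /negbTE ->; rewrite !mul0r.
have S3 : \sum_(l <- lam) - (m.+3%:R * e * Re (l ^+ 2) / 16 + m.+3%:R * 2^-1 ^+ m)
    <= m.+3%:R * ln M.
  apply: le_trans S1; under [leRHS]eq_bigr => j _ do rewrite mulr_sumr.
  rewrite exchange_big/= big_seq [leRHS]big_seq; apply: ler_sum => l ll; exact: S2.
rewrite Re_sum; move: S3; rewrite sumrN big_split/= -mulr_suml -mulr_sumr.
rewrite big_const_seq count_predT iter_addr_0 -[_ *+ size lam]mulr_natr.
have K0 : 0 < (m.+3%:R : R) / 16 by rewrite divr_gt0// ltr0n.
move=> h; rewrite -(ler_pM2l K0); move: h {K0}.
move: (m.+3%:R) (ln M) (size lam)%:R (2^-1 ^+ m) (\sum_(_ <- _) _) => K L n P S h.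
have -> : K / 16 * (16 * L + 16 * n * P) = K * L + K * P * n by field.
have -> : K / 16 * (- e * S) = - (K * e * S / 16) by field.
lra.
Qed.

Lemma exprz_half_lt (eps : R) : 0 < eps -> exists m, (1 < m)%N /\ 2^-1 ^+ m < eps.
Proof.
move=> e0; pose m := (Num.truncn eps^-1).+2; exists m; split => //.
have h : eps^-1 < m%:R.
  by rewrite (lt_le_trans (truncnS_gt _))// ler_nat.
rewrite -[eps]invrK exprVn ltf_pV2 ?posrE ?invr_gt0 ?exprn_gt0//.
by rewrite (lt_trans h)// -natrX ltr_nat ltn_expl.
Qed.

(** The error in [m] is removed by letting [m] grow; [e = 1] and [e = -1] give the two signs. *)
Lemma sum_sqr_le_ln (lam : seq C) (M : R) :
  (forall l, l \in lam -> nc l <= 1) ->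
  (forall t, nc t <= 1 -> nc (\prod_(l <- lam) (1 - l * t)) <= M) ->
  `|Re (\sum_(l <- lam) l ^+ 2)| <= 16 * ln M.
Proof.
move=> lam1 bd.
have key e : `|e| <= 1 -> - e * Re (\sum_(l <- lam) l ^+ 2) <= 16 * ln M.
  move=> e1; apply/ler_addgt0Pr => eps eps0.
  have d0 : 0 < 16 * (size lam).+1%:R :> R by rewrite mulr_gt0// ltr0n.
  have [m [m1 hm]] := exprz_half_lt (divr_gt0 eps0 d0).
  rewrite (le_trans (sum_sqr_le_ln_aux m1 e1 lam1 bd))// lerD2l.
  move: hm; rewrite ltr_pdivlMr// mulrC => /ltW; apply: le_trans.
  by rewrite ler_wpM2r ?exprn_ge0// ler_wpM2l// ler_nat.
rewrite ler_norml; apply/andP; split.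
  by have := key 1; rewrite normr1 lexx => /(_ isT); lra.
by have := key (-1); rewrite normrN1 lexx => /(_ isT); lra.
Qed.

(** Newton's identity for the second power sum, which is -2 times the quadratic coefficient of log
    p. *)
Lemma coef12_prod_linear (lam : seq C) :
  let p := \prod_(l <- lam) (1 - l *: 'X) : {poly C} in
  p`_0 = 1 /\ p`_1 ^+ 2 - 2 * p`_2 = \sum_(l <- lam) l ^+ 2.
Proof.
elim: lam => [|l s [IH0 IH]] /=.
  by rewrite !big_nil !coefC /= expr0n mulr0 subr0.
rewrite !big_cons mulrBl mul1r -scalerAl !coefB !coefZ !coefXM /= -IH IH0.
by split; ring.
Qed.

Lemma Re_coef_le_ln (q : {poly C}) (M : R) : q`_0 != 0 ->
  (forall t, nc t < 1 -> q.[t] != 0) -> (forall t, nc t <= 1 -> nc q.[t] <= M) ->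
  `|Re ((q`_1 / q`_0) ^+ 2 - 2 * (q`_2 / q`_0))| <= 16 * ln (M / nc q`_0).
Proof.
move=> q0 nz bd; have [r qE] := closed_field_poly_normal q.
have rt x : x \in r -> q.[x] = 0.
  move=> xr; rewrite qE hornerZ.
  by rewrite (rootP (_ : root _ x)) ?mulr0 ?eqxx// root_prod_XsubC.
have r0 x : x \in r -> x != 0.
  by move=> xr; apply/eqP => x0; have := rt _ xr; rewrite x0 horner_coef0 => e; rewrite e eqxx in q0.
have r1 x : x \in r -> 1 <= nc x.
  by move=> xr; rewrite leNgt; apply/negP => /nz; rewrite rt// eqxx.
pose lam := [seq x^-1 | x <- r].
have [c0 c12] := coef12_prod_linear lam.
have qlam : q = q`_0 *: \prod_(l <- lam) (1 - l *: 'X).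
  have E : q = (lead_coef q * \prod_(x <- r) - x) *: \prod_(l <- lam) (1 - l *: 'X).
    rewrite {1}qE -scalerA big_map -scaler_prod; congr (_ *: _).
    rewrite big_seq [RHS]big_seq; apply: eq_bigr => x xr.
    rewrite scalerBr scalerA mulNr divff ?r0// scaleN1r opprK addrC.
    by rewrite alg_polyC polyCN.
  by rewrite {1}E; congr (_ *: _); rewrite [in RHS]E coefZ c0 mulr1.
have -> : (q`_1 / q`_0) ^+ 2 - 2 * (q`_2 / q`_0) = \sum_(l <- lam) l ^+ 2.
  rewrite -c12; move: qlam; move: (\prod_(_ <- _) _) => p qp.
  have -> : q`_1 = q`_0 * p`_1 by rewrite {1}qp coefZ.
  have -> : q`_2 = q`_0 * p`_2 by rewrite {1}qp coefZ.
  by field.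
apply: sum_sqr_le_ln => [l /mapP[x xr ->]|t t1].
  by rewrite ncV invf_le1 ?r1// nc_gt0 r0.
rewrite ler_pdivlMr ?nc_gt0// mulrC -ncM.
have := bd _ t1; rewrite {1}qlam hornerZ horner_prod.
congr (nc (_ * _) <= _); apply: eq_bigr => l _; by rewrite !hornerE.
Qed.
End BorelCaratheodory.

(** * A weak form of Dirichlet's theorem *)

Lemma sum_multiples (V : zmodType) (F : nat -> V) p x : (0 < p)%N ->
  \sum_(1 <= n < x.+1 | (p %| n)%N) F n = \sum_(1 <= m < (x %/ p).+1) F (p * m)%N.
Proof.
move=> p0; elim: x => [|x IH]; first by rewrite div0n !big_geq.
rewrite big_mkcond/= big_nat_recr//= -big_mkcond/= IH divnS//.
have [px|_] := boolP (p %| x.+1)%N; last by rewrite addr0.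
have -> : x.+1 = (p * (x %/ p).+1)%N.
  have <- : (x.+1 %/ p = (x %/ p).+1)%N by rewrite divnS// px.
  by rewrite mulnC divnK.
by rewrite -[(true + _)%N]/(x %/ p).+1 [RHS]big_nat_recr.
Qed.

Section WeakDirichlet.
Variable R : realType.

Definition avoid (ps : seq nat) n := all (fun p => ~~ (p %| n)%N) ps.

Definition hsum (ps : seq nat) (e : nat -> R) x : R :=
  \sum_(1 <= n < x.+1 | avoid ps n) e n / n%:R.

(** One step of the sieve: the terms removed are those at p m with m avoiding [ps]. *)
Lemma hsum_cons p ps e x : prime p -> p \notin ps -> all prime ps ->
  hsum (p :: ps) e x = hsum ps e x - p%:R^-1 * hsum ps (fun n => e (p * n)%N) (x %/ p).
Proof.
move=> pp pps aps; apply/eqP; rewrite eq_sym subr_eq; apply/eqP; symmetry.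
have p0 := prime_gt0 pp.
have -> : p%:R^-1 * hsum ps (fun n => e (p * n)%N) (x %/ p) =
    \sum_(1 <= n < x.+1 | (p %| n)%N) if avoid ps n then e n / n%:R else 0.
  rewrite sum_multiples// mulr_sumr big_mkcond/=; apply: eq_bigr => m _.
  have -> : avoid ps (p * m) = avoid ps m.
    apply: eq_in_all => q qps; rewrite Euclid_dvdM; last by move/allP: aps; apply.
    rewrite (dvdn_prime2 _ pp); last by move/allP: aps; apply.
    by case: eqVneq => // qp; rewrite qp (negbTE pps) in qps.
  by case: ifP => // _; rewrite natrM invfM mulrCA mulrA mulrC !mulrA.
rewrite /hsum big_mkcond [RHS]big_mkcond [X in _ + X]big_mkcond -big_split/=.
apply: eq_bigr => n _; rewrite /avoid /=; case: (p %| n)%N => /=; rewrite ?add0r ?addr0//.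
Qed.

Lemma abel_bound (e : nat -> R) (B : R) x :
  (forall n, `|\sum_(1 <= k < n.+1) e k| <= B) -> `|hsum [::] e x| <= B.
Proof.
move=> bd; pose E n := \sum_(1 <= k < n.+1) e k.
have B0 : 0 <= B by exact: le_trans (bd 0%N).
have abel : hsum [::] e x = \sum_(1 <= n < x.+1) E n * (n%:R^-1 - n.+1%:R^-1) + E x / x.+1%:R.
  elim: x => [|x IH]; first by rewrite /hsum /E !big_geq// mul0r addr0.
  rewrite /hsum big_nat_recr//= -[\sum_(1 <= i < _ | _) _]/(hsum [::] e x) IH.
  have ES : E x.+1 = E x + e x.+1 by rewrite /E big_nat_recr.
  by rewrite [in RHS]big_nat_recr//= ES; ring.
rewrite abel (le_trans (ler_normD _ _))//.
have tele : \sum_(1 <= n < x.+1) (n%:R^-1 - n.+1%:R^-1) = 1 - x.+1%:R^-1 :> R.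
  elim: x {abel} => [|x IH]; first by rewrite big_geq// invr1 subrr.
  by rewrite big_nat_recr//= IH; ring.
have -> : B = B * (1 - x.+1%:R^-1) + B * x.+1%:R^-1 by ring.
have h : 0 <= x.+1%:R^-1 :> R by rewrite invr_ge0.
apply: lerD; last by rewrite normrM (ger0_norm h); apply: ler_wpM2r => //; exact: bd.
rewrite -tele mulr_sumr (le_trans (ler_norm_sum _ _ _))// big_seq [leRHS]big_seq.
apply: ler_sum => n; rewrite mem_index_iota => /andP[n0 _].
have d0 : 0 <= n%:R^-1 - n.+1%:R^-1 :> R.
  by rewrite subr_ge0 lef_pV2 ?posrE ?ltr0n// ler_nat.
by rewrite normrM (ger0_norm d0); apply: ler_wpM2r => //; exact: bd.
Qed.

Lemma sum_periodic0 (e : nat -> R) N n : (0 < N)%N -> (forall n, e (n + N)%N = e n) ->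
  (forall n, `|e n| <= 1) -> \sum_(i < N) e i = 0 ->
  `|\sum_(1 <= k < n.+1) e k| <= N%:R.
Proof.
move=> N0 per e1 s0.
have block m : \sum_(m <= k < m + N) e k = 0.
  elim: m => [|m IH]; first by rewrite add0n big_mkord.
  have : \sum_(m <= k < (m + N).+1) e k = e m by rewrite big_nat_recr ?leq_addr//= IH add0r per.
  by rewrite big_ltn ?ltnS ?leq_addr//= -{2}[e m]addr0 => /addrI.
elim/ltn_ind: n => n IH; have [nN|Nn] := ltnP n N.
  rewrite (le_trans (ler_norm_sum _ _ _))//.
  rewrite (le_trans (ler_sum _ (fun i _ => e1 i)))// sumr_const_nat subn1/= ler_nat.
  exact: ltnW.
rewrite (big_cat_nat (n := (n - N).+1))//=; last by rewrite ltnS leq_subr.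
rewrite -{3}(subnK Nn) -addSn block addr0 IH//.
by rewrite ltn_subrL N0 (leq_trans N0).
Qed.

Lemma harmonic_unbounded (B : R) : exists m, B < \sum_(0 <= k < m) k.+1%:R^-1.
Proof.
have [//|nex] := pselect (exists m, B < \sum_(0 <= k < m) k.+1%:R^-1 :> R).
exfalso; apply: (@dvg_harmonic R).
apply: nondecreasing_is_cvgn.
  apply: nondecreasing_series => n _ _; exact: harmonic_ge0.
exists B => _ [m _ <-]; rewrite leNgt; apply/negP => h; apply: nex; exists m.
by apply: h.
Qed.

(** Each sieving step subtracts 1/p times a sum for a dilate of [e]. The dilate is in the same
    class, so the uniform bound grows by the factor 1 + 1/p only. *)
Lemma hsum_class_bound (cl : (nat -> R) -> Prop) (B : R) ps :
  (forall e, cl e -> forall x, `|hsum [::] e x| <= B) ->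
  (forall e p, p \in ps -> cl e -> cl (fun n => e (p * n)%N)) ->
  uniq ps -> all prime ps ->
  forall e, cl e -> forall x, `|hsum ps e x| <= B * \prod_(p <- ps) (1 + p%:R^-1).
Proof.
move=> bd; elim: ps => [|p ps IH] clp /=.
  by move=> _ _ e cle x; rewrite big_nil mulr1 bd.
move=> /andP[pps ups] /andP[pp aps] e cle x.
have IH' := IH (fun e q qps => clp e q (mem_behead (s := p :: ps) qps)) ups aps.
rewrite hsum_cons// big_cons mulrCA mulrDl mul1r (le_trans (ler_normB _ _))// lerD ?IH'//.
rewrite normrM ger0_norm ?invr_ge0// ler_wpM2l ?invr_ge0//.
by apply: IH'; apply: clp => //; rewrite inE eqxx.
Qed.

Lemma hsum_ge0 ps e x : (forall n, 0 <= e n) -> 0 <= hsum ps e x.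
Proof. by move=> e0; apply: sumr_ge0 => n _; rewrite divr_ge0. Qed.

Lemma hsum_le ps e x y : (forall n, 0 <= e n) -> (x <= y)%N -> hsum ps e x <= hsum ps e y.
Proof.
move=> e0 xy; rewrite /hsum [leRHS](big_cat_nat (n := x.+1))//= ?lerDl.
by apply: sumr_ge0 => n _; rewrite divr_ge0.
Qed.

(** By invariance the sum subtracted at [p] is again one for [e], over a shorter range, so at most
    the fraction 1/p is lost. *)
Lemma hsum_lower ps e x : (forall n, 0 <= e n) ->
  (forall p n, p \in ps -> e (p * n)%N = e n) -> uniq ps -> all prime ps ->
  (\prod_(p <- ps) (1 - p%:R^-1)) * hsum [::] e x <= hsum ps e x.
Proof.
move=> e0; elim: ps => [|p ps IH] ep /=; first by rewrite big_nil mul1r.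
move=> /andP[pps ups] /andP[pp aps].
have {}IH := IH (fun q n qps => ep q n (mem_behead (s := p :: ps) qps)) ups aps.
have -> : hsum (p :: ps) e x = hsum ps e x - p%:R^-1 * hsum ps e (x %/ p).
  rewrite hsum_cons//; congr (_ - _ * _); apply: eq_bigr => n _.
  by rewrite ep// inE eqxx.
have p1 : 0 <= 1 - p%:R^-1 :> R.
  by rewrite subr_ge0 invf_le1 ?ltr0n ?ler1n prime_gt0.
rewrite big_cons -mulrA (le_trans (ler_wpM2l p1 IH))// mulrBl mul1r lerD2l lerN2.
by rewrite ler_wpM2l ?invr_ge0// hsum_le// leq_div.
Qed.

Lemma sum_mul_coprime N g (h : nat -> R) : (0 < N)%N -> coprime g N ->
  (forall n, h (n %% N)%N = h n) -> \sum_(i < N) h (g * i)%N = \sum_(i < N) h i.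
Proof.
case: N => // N _ cgN per; symmetry.
pose f (i : 'I_N.+1) : 'I_N.+1 := inord (g * i %% N.+1).
have fE i : f i = (g * i %% N.+1)%N :> nat by rewrite inordK// ltn_pmod.
have f_inj : injective f.
  move=> i j /(congr1 val); rewrite /= !fE => /eqP.
  wlog ij : i j / (i <= j)%N.
    by move=> h1; case/orP: (leq_total i j) => [/h1//|/h1 h2]; rewrite eq_sym => /h2.
  rewrite eq_sym eqn_mod_dvd ?leq_mul2l ?ij ?orbT// -mulnBr Gauss_dvdr; last by rewrite coprime_sym.
  move=> d; apply/eqP; rewrite eq_sym -val_eqE/= eqn_leq ij andbT -subn_eq0.
  apply/eqP; apply/eqP; rewrite -leqn0 leqNgt; apply/negP => /dvdn_leq/(_ d).
  by rewrite leqNgt (leq_ltn_trans (leq_subr _ _) (ltn_ord j)).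
rewrite (reindex_inj f_inj); apply: eq_bigr => i _.
by rewrite fE per.
Qed.

Section main.
Variables (N : nat) (G0 : pred nat) (C : R).
Hypothesis N0 : (0 < N)%N.
Hypothesis G0per : forall n, G0 (n %% N)%N = G0 n.
Hypothesis G01 : G0 1%N.
Hypothesis G0M : forall a b, coprime a N -> coprime b N -> G0 a -> G0 (a * b)%N = G0 b.
Let bad p := [&& prime p, coprime p N & ~~ G0 p].
Hypothesis sum_bad : forall x, \sum_(0 <= p < x | bad p) p%:R^-1 <= C.

(** After sieving out the bad primes, every prime factor of [n] satisfies [G0], and [G0] is
    multiplicatively closed on units. *)
Lemma good_all x n : (0 < n < x)%N -> coprime n N ->
  avoid [seq p <- index_iota 0 x | bad p] n -> G0 n.
Proof.
elim/ltn_ind: n => n IH /andP[n0 nx] cn av.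
have [n1|n1] := leqP n 1.
  by have -> : n = 1%N by apply/eqP; rewrite eqn_leq n1.
have pp := pdiv_prime n1; have /dvdnP[m nE] := pdiv_dvd n; set p := pdiv n in pp nE *.
have m0 : (0 < m)%N by move: n0; rewrite nE muln_gt0 => /andP[].
move: cn; rewrite nE coprimeMl => /andP[cm cp].
have gp : G0 p.
  apply: contraT => gp; move/allP: av => /(_ p).
  rewrite mem_filter /bad pp cp gp mem_index_iota/=.
  by rewrite (leq_ltn_trans (pdiv_leq n0) nx) pdiv_dvd => /(_ isT).
rewrite mulnC G0M// IH//.
- by rewrite nE ltn_Pmulr// prime_gt1.
- by rewrite m0 (leq_ltn_trans _ nx)// nE leq_pmulr// prime_gt0.
- apply/allP => q /(allP av); rewrite nE; apply: contra; exact: dvdn_mulr.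
Qed.

(** If [G0 g] failed, the difference [e 1] of the indicators of n and g n lying in [G0] would be
    periodic of mean zero, so its harmonic sums are bounded, also after sieving. On integers free of
    bad primes [e 1] equals [cop], the indicator of the units. Thus the sieved harmonic sum over
    units would be bounded, and by [hsum_lower] the full one as well, which diverges. *)
Theorem weak_dirichlet g : coprime g N -> G0 g.
Proof.
move=> cg; apply: contraT => ng.
pose cop n : R := (coprime n N)%:R.
pose h a n : R := cop n * (G0 (n * a)%N)%:R.
pose e a n := h a n - h (g * a)%N n.
pose cl f := exists2 a, coprime a N & f = e a.
have copmod n : cop (n %% N)%N = cop n by rewrite /cop coprime_modl.
have hper a n : h a (n %% N)%N = h a n by rewrite /h copmod -[in LHS]G0per modnMml G0per.
have clbd f : cl f -> forall x, `|hsum [::] f x| <= N%:R.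
  move=> [a ca ->] x; apply: abel_bound => n; apply: sum_periodic0 => //.
  - by move=> k; rewrite /e -hper -(hper (g * a)%N) modnDr !hper.
  - move=> k; rewrite /e /h /cop; case: (coprime k N); case: (G0 _); case: (G0 _);
      by rewrite /= ?(mul0r, mul1r, subr0, subrr, sub0r, normrN, normr0, normr1, ler01, lexx).
  - rewrite sumrB; apply/eqP; rewrite subr_eq0; apply/eqP.
    rewrite -(sum_mul_coprime N0 cg (hper a)); apply: eq_bigr => i _.
    by rewrite /h /cop coprimeMl cg mulnA (mulnC g).
have clp f p : coprime p N -> cl f -> cl (fun n => f (p * n)%N).
  move=> cp [a ca ->]; exists (p * a)%N; first by rewrite coprimeMl cp.
  apply/funext => n; rewrite /e /h /cop coprimeMl cp/= !mulnA (mulnC p n).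
  by rewrite -!mulnA [(p * (g * a))%N]mulnCA.
pose ps x := [seq p <- index_iota 0 x.+1 | bad p].
have ups x : uniq (ps x) by rewrite filter_uniq// iota_uniq.
have aps x : all prime (ps x).
  by apply/allP => p; rewrite mem_filter => /andP[/and3P[]].
have cps x p : p \in ps x -> coprime p N by rewrite mem_filter => /andP[/and3P[]].
have upper x : hsum (ps x) cop x <= N%:R * \prod_(p <- ps x) (1 + p%:R^-1).
  apply: le_trans (hsum_class_bound clbd (fun f p px => clp f p (cps x p px)) (ups x) (aps x) (e := e 1%N) _ x); last first.
    by exists 1%N => //; exact: coprime1n.
  rewrite (le_trans _ (ler_norm _))// le_eqVlt; apply/orP; left; apply/eqP.
  rewrite /hsum big_nat_cond [RHS]big_nat_cond; apply: eq_bigr => n /andP[/andP[n0 nx] av].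
  rewrite /e /h /cop; have [cn|] := boolP (coprime n N); last by rewrite !mul0r subrr mul0r.
  have gn : G0 n by apply: good_all av => //; apply/andP.
  by rewrite !muln1 gn G0M// (negbTE ng) mulr1 mulr0 subr0.
have lower x : (\prod_(p <- ps x) (1 - p%:R^-1)) * hsum [::] cop x <= hsum (ps x) cop x.
  apply: hsum_lower => // p n px.
  by rewrite /cop coprimeMl (cps _ _ px).
pose E x := \prod_(p <- ps x) expR (p%:R^-1 : R).
have EC x : E x <= expR C.
  rewrite /E -expR_sum ler_expR big_filter; exact: sum_bad.
have E1 x : \prod_(p <- ps x) (1 + p%:R^-1) <= E x.
  apply: ler_prod => p _; rewrite expR_ge1Dx andbT addr_ge0 ?invr_ge0//.
(* For 0 < a <= 1/2 one has (1 - a)(1 + a)^2 >= 1, and 1 + a <= exp a. *)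
have E2 x : 1 <= (\prod_(p <- ps x) (1 - p%:R^-1)) * (E x * E x).
  rewrite -!big_split/= big_seq; apply: (big_ind (fun y : R => 1 <= y)) => //.
    by move=> a b a1 b1; rewrite mulr_ege1.
  move=> p /(allP (aps x)) pp.
  have p2 : 0 < (p%:R^-1 : R) <= 2^-1.
    by rewrite invr_gt0 ltr0n prime_gt0//= lef_pV2 ?posrE ?ltr0n ?prime_gt0// ler_nat prime_gt1.
  have : 1 + p%:R^-1 <= expR (p%:R^-1 : R) by exact: expR_ge1Dx.
  move: (p%:R^-1) (expR _) p2 => a b /andP[a0 a2] ab.
  have : (1 + a) * (1 + a) <= b * b by apply: ler_pM => //; lra.
  have : 1 <= (1 - a) * ((1 + a) * (1 + a)) by nra.
  move=> h1 h2; rewrite (le_trans h1)// ler_wpM2l//; lra.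
have E0 x : 0 <= E x by rewrite (le_trans _ (E1 x))// prodr_ge0// => p _; rewrite addr_ge0 ?invr_ge0.
have H0 x : 0 <= hsum [::] cop x by apply: hsum_ge0 => n; rewrite /cop.
have P0 x : 0 <= \prod_(p <- ps x) (1 - p%:R^-1) :> R.
  rewrite big_seq prodr_ge0// => p /(allP (aps x)) pp.
  by rewrite subr_ge0 invf_le1 ?ltr0n ?ler1n prime_gt0.
have bound x : hsum [::] cop x <= N%:R * expR C * (expR C * expR C).
  have EE : E x * E x <= expR C * expR C by apply: ler_pM.
  have : hsum [::] cop x * 1 <= hsum [::] cop x * _ := ler_wpM2l (H0 x) (E2 x).
  rewrite mulr1 mulrCA mulrA; move/le_trans; apply.
  apply: ler_pM => //; last exact: (le_trans (lower x) (le_trans (upper x) (ler_wpM2l (ler0n _ _) (le_trans (E1 x) (EC x))))).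
  - by rewrite mulr_ge0// P0.
  - by rewrite mulr_ge0.
(* Only the units congruent to 1 modulo [N] are counted: 1 / (N m + 1) is at least 1 / (N (m +
   1)). *)
have low m : \sum_(0 <= k < m) k.+1%:R^-1 <= N%:R * hsum [::] cop (N * m)%N.
  elim: m => [|m IH]; first by rewrite big_geq// mulr_ge0.
  rewrite big_nat_recr//= mulnS addnC.
  have : hsum [::] cop (N * m)%N + (N * m).+1%:R^-1 <= hsum [::] cop (N * m + N)%N.
    apply: le_trans (hsum_le (x := (N * m).+1) _ _ _) => //.
    - rewrite {2}/hsum big_nat_recr//= lerD2l /cop.
      have -> : coprime (N * m).+1 N by rewrite coprime_sym -addn1 mulnC /coprime gcdnMDl gcdn1.
      by rewrite mul1r.
    - by rewrite -addn1 leq_add2l.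
  move=> /(ler_wpM2l (ler0n R N)); rewrite mulrDr; apply: le_trans.
  apply: lerD => //; rewrite -[N%:R]invrK -invfM lef_pV2 ?posrE ?ltr0n//.
    rewrite ler_pdivrMl ?ltr0n// -natrM ler_nat mulnS; lia.
  by rewrite mulr_gt0// ?invr_gt0 ltr0n.
have [m] := harmonic_unbounded (N%:R * (N%:R * expR C * (expR C * expR C))).
rewrite ltNge => /negP; case.
by rewrite (le_trans (low m))// ler_wpM2l.
Qed.
End main.
End WeakDirichlet.

(** * Square-integrable functions on (0,1) *)

Section L2.
Variable R : realType.
Local Notation mu := (@lebesgue_measure R).
Local Notation I := (@I01 R).
Implicit Types f g h : R -> R.

Let mI : measurable I. Proof. exact: measurable_itv. Qed.

Lemma lebesgue_I01 : mu I = 1%:E.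
Proof. by rewrite /I01 lebesgue_measure_itv/= lte_fin ltr01 oppr0 adde0. Qed.

Definition bddm f := measurable_fun I f /\ exists B, forall x, I x -> `|f x| <= B.

Lemma bddm_integrable f : bddm f -> mu.-integrable I (EFin \o f).
Proof.
move=> [mf [B fB]]; apply: measurable_bounded_integrable => //.
  by rewrite [X in (X < _)%E]lebesgue_I01 ltry.
exists B; split; rewrite ?num_real// => x Bx y Iy /=.
by rewrite (le_trans (fB _ Iy))// ltW.
Qed.

Lemma inL2_sqr_integrable f : inL2 f -> mu.-integrable I (EFin \o (fun x => f x ^+ 2)).
Proof.
move=> [mf fi]; apply/integrableP; split.
  by apply/measurable_EFinP; exact: measurable_funX.
under eq_integral => x _ do rewrite [X in `|X|%E]/= gee0_abs ?lee_fin ?sqr_ge0//.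
exact: fi.
Qed.

Lemma inL2_mul_integrable f g : inL2 f -> inL2 g ->
  mu.-integrable I (EFin \o (fun x => f x * g x)).
Proof.
move=> f2 g2.
have := @integrableD _ _ R mu I mI _ _ (inL2_sqr_integrable f2) (inL2_sqr_integrable g2).
apply: le_integrable => //.
  by apply/measurable_EFinP; apply: measurable_funM; [case: f2|case: g2].
move=> x _ /=; rewrite lee_fin [leRHS]ger0_norm ?addr_ge0 ?sqr_ge0//.
rewrite ler_norml; apply/andP; split.
  by have := sqr_ge0 (f x + g x); have := sqr_ge0 (f x); have := sqr_ge0 (g x); nra.
by have := sqr_ge0 (f x - g x); have := sqr_ge0 (f x); have := sqr_ge0 (g x); nra.
Qed.

Definition ip f g : R := \int[mu]_(x in I) (f x * g x).

Lemma sqint_ip f : inL2 f -> sqint f = (ip f f)%:E.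
Proof.
move=> f2; rewrite /ip /Rintegral fineK; last first.
  exact: integrable_fin_num (inL2_mul_integrable f2 f2).
by apply: eq_integral => x _; rewrite expr2.
Qed.

Lemma eq_ip f f' g g' : {in I, f =1 f'} -> {in I, g =1 g'} -> ip f g = ip f' g'.
Proof. by move=> ff gg; apply: eq_Rintegral => x xI; rewrite ff// gg. Qed.

Lemma ipC f g : ip f g = ip g f.
Proof. by apply: eq_Rintegral => x _; rewrite mulrC. Qed.

Lemma inL2_bddm f : bddm f -> inL2 f.
Proof.
move=> [mf [B fB]]; split => //.
have : mu.-integrable I (EFin \o (fun x => f x ^+ 2)).
  apply: bddm_integrable; split; first exact: measurable_funX.
  by exists (B ^+ 2) => x Ix; rewrite normrX lerXn2r ?nnegrE ?(le_trans _ (fB x Ix)) ?fB.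
move=> /integrableP[_]; apply: le_lt_trans; rewrite /sqint.
by apply: ge0_le_integral => //= [x _|||x _]; rewrite ?lee_fin ?sqr_ge0// ?ler_norm//;
  apply/measurable_EFinP; do ?apply: measurableT_comp => //; exact: measurable_funX.
Qed.

Lemma inL2D f g : inL2 f -> inL2 g -> inL2 (fun x => f x + g x).
Proof.
move=> f2 g2; split; first by apply: measurable_funD; [case: f2|case: g2].
have : mu.-integrable I (fun x => 2%:E * ((f x ^+ 2)%:E + (g x ^+ 2)%:E))%E.
  apply: integrableZl => //.
  exact: (@integrableD _ _ R mu I mI _ _ (inL2_sqr_integrable f2) (inL2_sqr_integrable g2)).
move=> /integrableP[mfg]; apply: le_lt_trans; apply: ge0_le_integral => //=.
- by move=> x _; rewrite lee_fin sqr_ge0.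
- apply/measurable_EFinP/measurable_funX/measurable_funD; [by case: f2|by case: g2].
- case: f2 => mf _; case: g2 => mg _.
  apply/measurable_EFinP; apply: measurableT_comp => //; apply: measurable_funM => //.
  by apply: measurable_funD; exact: measurable_funX.
- move=> x _; rewrite lee_fin (le_trans _ (ler_norm _))//.
  by have := sqr_ge0 (f x - g x); nra.
Qed.

Lemma inL2Z k f : inL2 f -> inL2 (fun x => k * f x).
Proof.
move=> [mf fi]; split; first exact: measurable_funM.
rewrite /sqint; under eq_integral => x _ do rewrite exprMn EFinM.
rewrite ge0_integralZl//=; last 3 first.
- by apply/measurable_EFinP; exact: measurable_funX.
- by move=> x _; rewrite lee_fin sqr_ge0.
- by rewrite lee_fin sqr_ge0.
by rewrite lte_mul_pinfty// ?lee_fin ?sqr_ge0//.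
Qed.

Lemma inL2B f g : inL2 f -> inL2 g -> inL2 (fun x => f x - g x).
Proof.
move=> f2 g2; have := inL2D f2 (inL2Z (-1) g2).
by congr inL2; apply/funext => x; rewrite mulN1r.
Qed.

Lemma inL20 : inL2 (fun=> 0 : R).
Proof. by apply: inL2_bddm; split => //; exists 0 => x _; rewrite normr0. Qed.

Lemma inL2_sum (T : Type) (s : seq T) (F : T -> R -> R) :
  (forall i, inL2 (F i)) -> inL2 (fun x => \sum_(i <- s) F i x).
Proof.
move=> F2; elim: s => [|i s IH].
  by have := inL20; congr inL2; apply/funext => x; rewrite big_nil.
have := inL2D (F2 i) IH.
by congr inL2; apply/funext => x; rewrite big_cons.
Qed.

Lemma ipDl f g h : inL2 f -> inL2 g -> inL2 h -> ip (fun x => f x + g x) h = ip f h + ip g h.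
Proof.
move=> f2 g2 h2; rewrite /ip -RintegralD//; try exact: inL2_mul_integrable.
by apply: eq_Rintegral => x _; rewrite mulrDl.
Qed.

Lemma ipZl k f h : inL2 f -> inL2 h -> ip (fun x => k * f x) h = k * ip f h.
Proof.
move=> f2 h2; rewrite /ip -RintegralZl//; try exact: inL2_mul_integrable.
by apply: eq_Rintegral => x _; rewrite mulrA.
Qed.

Lemma ipBl f g h : inL2 f -> inL2 g -> inL2 h -> ip (fun x => f x - g x) h = ip f h - ip g h.
Proof.
move=> f2 g2 h2; rewrite /ip -RintegralB//; try exact: inL2_mul_integrable.
by apply: eq_Rintegral => x _; rewrite mulrBl.
Qed.

Lemma ipDr h f g : inL2 f -> inL2 g -> inL2 h -> ip h (fun x => f x + g x) = ip h f + ip h g.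
Proof. by move=> f2 g2 h2; rewrite ipC ipDl// (ipC h f) (ipC h g). Qed.

Lemma ipZr k f h : inL2 f -> inL2 h -> ip h (fun x => k * f x) = k * ip h f.
Proof. by move=> f2 h2; rewrite ipC ipZl// ipC. Qed.

Lemma ipBr h f g : inL2 f -> inL2 g -> inL2 h -> ip h (fun x => f x - g x) = ip h f - ip h g.
Proof. by move=> f2 g2 h2; rewrite ipC ipBl// (ipC h f) (ipC h g). Qed.

Lemma ip0l h : ip (fun=> 0) h = 0.
Proof. by rewrite /ip /Rintegral integral0_eq// => x _; rewrite mul0r. Qed.

Lemma ip_suml (T : Type) (s : seq T) (F : T -> R -> R) h : (forall i, inL2 (F i)) -> inL2 h ->
  ip (fun x => \sum_(i <- s) F i x) h = \sum_(i <- s) ip (F i) h.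
Proof.
move=> F2 h2; elim: s => [|i s IH].
  by rewrite big_nil -[RHS](ip0l h); apply: eq_ip => // x _; rewrite big_nil.
rewrite big_cons -IH -ipDl//; last exact: inL2_sum.
by apply: eq_ip => // x _; rewrite big_cons.
Qed.

Lemma ip_sumr (T : Type) (s : seq T) (F : T -> R -> R) h : (forall i, inL2 (F i)) -> inL2 h ->
  ip h (fun x => \sum_(i <- s) F i x) = \sum_(i <- s) ip h (F i).
Proof. by move=> F2 h2; rewrite ipC ip_suml//; apply: eq_bigr => i _; rewrite ipC. Qed.

Lemma ip_ge0 f : 0 <= ip f f.
Proof. by apply: Rintegral_ge0 => x _; rewrite -expr2 sqr_ge0. Qed.

Lemma ipDD f g : inL2 f -> inL2 g ->
  ip (fun x => f x + g x) (fun x => f x + g x) = ip f f + 2 * ip f g + ip g g.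
Proof.
move=> f2 g2; have fg2 := inL2D f2 g2.
by rewrite (ipDl f2 g2 fg2) !(@ipDr _ f g)// (ipC g f); ring.
Qed.

Lemma ipBB f g : inL2 f -> inL2 g ->
  ip (fun x => f x - g x) (fun x => f x - g x) = ip f f - 2 * ip f g + ip g g.
Proof.
move=> f2 g2; have fg2 := inL2B f2 g2.
by rewrite (ipBl f2 g2 fg2) !(@ipBr _ f g)// (ipC g f); ring.
Qed.

Lemma ip_le_sum f g : inL2 f -> inL2 g ->
  ip (fun x => f x + g x) (fun x => f x + g x) <= 2 * ip f f + 2 * ip g g.
Proof.
move=> f2 g2; rewrite ipDD//.
by have := ip_ge0 (fun x => f x - g x); rewrite ipBB//; lra.
Qed.

Lemma cauchy_schwarz f g : inL2 f -> inL2 g -> ip f g ^+ 2 <= ip f f * ip g g.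
Proof.
move=> f2 g2; set A := ip f f; set B := ip f g; set C := ip g g.
have pos t : 0 <= A - 2 * (t * B) + t ^+ 2 * C.
  have t2 := inL2Z t g2; have := ip_ge0 (fun x => f x - t * g x).
  by rewrite ipBB// (ipZr t g2 f2) (ipZl t g2 t2) (ipZr t g2 g2) expr2 -(mulrA t t).
have A0 : 0 <= A := ip_ge0 f; have C0 : 0 <= C := ip_ge0 g.
have [CE|Cn] := eqVneq C 0.
  rewrite CE mulr0; have [->|Bn] := eqVneq B 0; first by rewrite expr0n.
  (* This argument makes the quadratic, here linear, take the value -1. *)
  have := pos ((A + 1) / (2 * B)); rewrite CE mulr0 addr0.
  have -> : 2 * ((A + 1) / (2 * B) * B) = A + 1 by field.
  lra.
have Cp : 0 < C by rewrite lt_def Cn.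
have := pos (B / C); rewrite -(ler_pM2r Cp) mul0r.
have -> : (A - 2 * (B / C * B) + (B / C) ^+ 2 * C) * C = A * C - B ^+ 2 by field.
lra.
Qed.

Lemma Rintegral_deriv (F f : R -> R) (a b : R) : a < b ->
  (forall x : R, is_derive x 1 F (f x)) -> continuous f ->
  \int[mu]_(x in `]a, b[) f x = F b - F a.
Proof.
move=> ab dF cf.
have cF : continuous F.
  by move=> x; apply: differentiable_continuous; apply/derivable1_diffP; case: (dF x).
have icc : mu.-integrable `[a, b] (EFin \o f).
  apply: continuous_compact_integrable; first exact: segment_compact.
  exact: continuous_subspaceT.
rewrite Rintegral_itv_obnd_cbnd; last by apply: integrableS icc => //; exact: subset_itv_oo_cc.
rewrite Rintegral_itv_bndo_bndc; last by apply: integrableS icc => //; exact: subset_itv_co_cc.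
rewrite /Rintegral (@continuous_FTC2 R f F a b)//.
- exact: continuous_subspaceT.
- split; [by move=> x _; case: (dF x)|apply: cvg_at_right_filter; exact: cF|apply: cvg_at_left_filter; exact: cF].
- by move=> x _; rewrite derive1E; case: (dF x).
Qed.

End L2.

(** * Trigonometric integrals *)

Section Trig.
Variable R : realType.
Implicit Types x y : R.

Lemma sin_natpiD n x : sin (n%:R * pi + x) = (-1) ^+ n * sin x.
Proof.
elim: n => [|n IH]; first by rewrite mul0r add0r expr0 mul1r.
by rewrite -natr1 mulrDl mul1r addrAC sinDpi IH exprS mulN1r mulNr.
Qed.

Lemma cos_natpiD n x : cos (n%:R * pi + x) = (-1) ^+ n * cos x.
Proof.
elim: n => [|n IH]; first by rewrite mul0r add0r expr0 mul1r.
by rewrite -natr1 mulrDl mul1r addrAC cosDpi IH exprS mulN1r mulNr.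
Qed.

Lemma sin_natpi n : sin (n%:R * pi) = 0 :> R.
Proof. by rewrite -[X in sin X]addr0 sin_natpiD sin0 mulr0. Qed.

Lemma sin_cos2 x y : 2 * sin x * cos y = sin (y + x) - sin (y - x).
Proof. by rewrite sinD sinB; ring. Qed.

Lemma sin_sin2 x y : 2 * (sin x * sin y) = cos (x - y) - cos (x + y).
Proof. by rewrite cosB cosD; ring. Qed.

Lemma sin_ratpi_neq0 n k : (0 < k)%N -> ~~ (k %| n)%N -> sin (n%:R * pi / k%:R) != 0 :> R.
Proof.
move=> k0 kn; rewrite (divn_eq n k) natrD natrM.
have -> : ((n %/ k)%:R * k%:R + (n %% k)%:R) * pi / k%:R =
  (n %/ k)%:R * pi + (n %% k)%:R * pi / k%:R :> R by field; rewrite pnatr_eq0 -lt0n.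
rewrite sin_natpiD mulf_neq0 ?signr_eq0// gt_eqF// sin_gt0_pi//.
have r0 : (0 < n %% k)%N by rewrite lt0n.
rewrite divr_gt0 ?mulr_gt0 ?ltr0n ?pi_gt0//= ltr_pdivrMr ?ltr0n// mulrC.
by rewrite ltr_pM2l ?pi_gt0// ltr_nat ltn_pmod.
Qed.

(* The angles [n pi (j + x) / k] for even [j] and [- n pi (j + 1 - x) / k] for odd
   [j < k] form [k] consecutive terms of the progression of step [2 n pi / k]. *)
Definition fold_cos n k x j : R :=
  if odd j then cos (n%:R * pi / k%:R * (j.+1%:R - x)) else cos (n%:R * pi / k%:R * (j%:R + x)).

Lemma sum_fold_cos n k x : (0 < k)%N ->
  \sum_(j < k) fold_cos n k x j =
  if (k %| n)%N then k%:R * cos ((n %/ k)%:R * pi * x) else 0.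
Proof.
move=> k0; have kn0 : k%:R != 0 :> R by rewrite pnatr_eq0 -lt0n.
have [/dvdnP[q ->]|kn] := boolP (k %| n)%N.
  rewrite mulnK//; under eq_bigr => j _.
    have -> : fold_cos (q * k) k x j = cos (q%:R * pi * x).
      rewrite /fold_cos natrM; have [jo|je] := ifPn.
        have -> : q%:R * k%:R * pi / k%:R * (j.+1%:R - x) = (q * j.+1)%:R * pi + - (q%:R * pi * x).
          by rewrite natrM; field.
        by rewrite cos_natpiD cosN -signr_odd oddM/= jo andbF expr0 mul1r.
      have -> : q%:R * k%:R * pi / k%:R * (j%:R + x) = (q * j)%:R * pi + q%:R * pi * x.
        by rewrite natrM; field.
      by rewrite cos_natpiD -signr_odd oddM (negbTE je) andbF expr0 mul1r.
    over.
  by rewrite /= sumr_const card_ord [RHS]mulr_natl.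
pose t : R := n%:R * pi / k%:R.
have st : 2 * sin t != 0 by rewrite mulf_neq0 ?pnatr_eq0// sin_ratpi_neq0.
apply: (mulfI st); rewrite mulr0 mulr_sumr.
(* The angles advance by 2t, so multiplication by 2 sin t telescopes. The parity records which end
   of the progression was extended last; the ends cancel at m = k because t k = n pi. *)
have tele m : \sum_(j < m) 2 * sin t * fold_cos n k x j =
   if odd m then sin (t * (m%:R + x)) + sin (t * (m%:R - x))
   else sin (t * (m%:R - 1 + x)) + sin (t * (m%:R + 1 - x)).
  elim: m => [|m IH].
    rewrite big_ord0 /= (_ : t * (0 + 1 - x) = - (t * (0 - 1 + x))); last by ring.
    by rewrite sinN subrr.
  rewrite big_ord_recr/= IH /fold_cos -/t; case: (odd m) => /=; rewrite sin_cos2.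
    have -> : t * (m.+1%:R - x) + t = t * (m.+1%:R + 1 - x) by ring.
    have -> : t * (m.+1%:R - x) - t = t * (m%:R - x) by rewrite -natr1; ring.
    have -> : t * (m.+1%:R - 1 + x) = t * (m%:R + x) by rewrite -natr1; ring.
    ring.
  have -> : t * (m%:R + x) + t = t * (m.+1%:R + x) by rewrite -natr1; ring.
  have -> : t * (m%:R + x) - t = t * (m%:R - 1 + x) by ring.
  have -> : t * (m%:R + 1 - x) = t * (m.+1%:R - x) by rewrite -natr1.
  ring.
have z (a : R) : sin (n%:R * pi + a) + sin (n%:R * pi - a) = 0.
  by rewrite !sin_natpiD sinN mulrN subrr.
have tk : t * k%:R = n%:R * pi by rewrite divfK.
rewrite tele; case: ifP => _.
  by rewrite mulrDr mulrBr tk z.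
rewrite -[X in _ = X](z (t * (x - 1))) -tk.
by congr (sin _ + sin _); ring.
Qed.
End Trig.

(** * Orthogonality of the sines *)

Section SineCoefficients.
Variable R : realType.
Local Notation mu := (@lebesgue_measure R).
Local Notation I := (@I01 R).
Implicit Types f g h : R -> R.

Definition sn (n : nat) : R -> R := fun x => sin (n%:R * pi * x).

Lemma bddm_continuous f B : continuous f -> (forall x, `|f x| <= B) -> bddm f.
Proof.
move=> cf fB; split; last by exists B => x _.
by apply: measurable_funTS; exact: continuous_measurable_fun.
Qed.

Lemma continuous_sn n : continuous (sn n).
Proof.
move=> x; apply: continuous_comp; last exact: continuous_sin.
by apply: continuousM; [exact: cst_continuous|exact: cvg_id].
Qed.

Lemma bddm_sn n : bddm (sn n).
Proof. by apply: (@bddm_continuous _ 1); [exact: continuous_sn|move=> x; exact: sin_max]. Qed.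

Lemma inL2_sn n : inL2 (sn n). Proof. exact: inL2_bddm (bddm_sn n). Qed.

Lemma is_derive_scale (F : R -> R) (c k x d : R) : is_derive (c * x) 1 F d ->
  is_derive x 1 (fun y => k * F (c * y)) (k * (d * c)).
Proof.
move=> dF; have -> : (fun y => k * F (c * y)) = k \*: (F \o (c \*: id)) by [].
apply: is_deriveZ; apply: is_derive1_comp.
by rewrite -[X in is_derive _ _ _ X]mulr1; exact: is_deriveZ.
Qed.

Lemma natpi_neq0 n : (0 < n)%N -> n%:R * pi != 0 :> R.
Proof. by move=> n0; rewrite mulf_neq0 ?pnatr_eq0 -?lt0n// gt_eqF// pi_gt0. Qed.

Lemma int_sin n (a b : R) : (0 < n)%N -> a < b ->
  \int[mu]_(x in `]a, b[) sn n x = (cos (n%:R * pi * a) - cos (n%:R * pi * b)) / (n%:R * pi).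
Proof.
move=> /natpi_neq0; move En : (n%:R * pi) => c c0 ab.
have dF (x : R) : is_derive x 1 (fun x => - c^-1 * cos (c * x)) (sn n x).
  have h := is_derive_scale (- c^-1) (is_derive_cos (c * x)).
  apply: (@is_derive_eq _ _ _ _ _ _ _ _ h).
  by rewrite /sn En; field.
by rewrite (Rintegral_deriv ab dF (@continuous_sn n)); field.
Qed.

Lemma continuous_cos_scale (c : R) : continuous (fun x => cos (c * x) : R).
Proof.
move=> x; apply: continuous_comp; last exact: continuous_cos.
by apply: continuousM; [exact: cst_continuous|exact: cvg_id].
Qed.

Lemma int_cos n : (0 < n)%N -> \int[mu]_(x in I) cos (n%:R * pi * x) = 0.
Proof.
move=> /natpi_neq0; move En : (n%:R * pi) => c c0.
have dF (x : R) : is_derive x 1 (fun x => c^-1 * sin (c * x)) (cos (c * x)).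
  have h := is_derive_scale c^-1 (is_derive_sin (c * x)).
  apply: (@is_derive_eq _ _ _ _ _ _ _ _ h).
  by field.
rewrite (Rintegral_deriv ltr01 dF (@continuous_cos_scale c)).
by rewrite mulr1 mulr0 sin0 mulr0 subr0 -En sin_natpi mulr0.
Qed.

Lemma ip_sn n m : (0 < n)%N -> (0 < m)%N -> ip (sn n) (sn m) = (n == m)%:R / 2.
Proof.
move=> n0 m0.
have ic k : bddm (fun x => cos (k%:R * pi * x) : R).
  apply: (@bddm_continuous _ 1); last by move=> x; exact: cos_max.
  exact: continuous_cos_scale.
wlog nm : n m n0 m0 / (m <= n)%N.
  move=> h; case/orP: (leq_total m n) => [/h->//|/h]; rewrite ipC eq_sym; exact.
have -> : ip (sn n) (sn m) =
    \int[mu]_(x in I) (2^-1 * (cos ((n - m)%:R * pi * x) - cos ((n + m)%:R * pi * x))).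
  by apply: eq_Rintegral => x _; rewrite natrB// natrD !mulrBl !mulrDl -sin_sin2 /sn; field.
have iB := @integrableB _ _ R mu I (measurable_itv _) _ _ (bddm_integrable (ic (n - m)%N))
  (bddm_integrable (ic (n + m)%N)).
have mI : measurable I by exact: measurable_itv.
rewrite RintegralZl// RintegralB//; try exact: bddm_integrable.
rewrite [X in _ - X]int_cos ?addn_gt0 ?n0// subr0.
have [->|nm'] := eqVneq n m.
  rewrite subnn; under eq_Rintegral => x _ do rewrite !mul0r cos0.
  suff -> : \int[mu]_(x in I) (1 : R) = 1 by rewrite mulr1 mul1r.
  rewrite /Rintegral integral_cst; last exact: measurable_itv.
  by rewrite mul1e [X in fine X]lebesgue_I01.
by rewrite int_cos ?mulr0 ?mul0r// subn_gt0 ltn_neqAle eq_sym nm' nm.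
Qed.

End SineCoefficients.

(** * Sine coefficients of the dilates *)

Section DilateCoefficients.
Variable R : realType.
Local Notation mu := (@lebesgue_measure R).
Local Notation I := (@I01 R).
Implicit Types a b x y : R.

Lemma bddm_chi a b : bddm (chi a b).
Proof.
split; last by exists 1 => x _; rewrite /chi; case: ifP => _; rewrite ?normr1// normr0 ler01.
have -> : chi a b = \1_(`]a, b[%classic).
  apply/funext => x; rewrite /chi indicE; case: ifPn => h.
    by rewrite mem_set//= in_itv.
  by rewrite memNset//= in_itv/=; exact/negP.
exact: measurable_indic.
Qed.

Lemma ip_chi_sn a b n : (0 < n)%N -> 0 <= a -> a < b -> b <= 1 ->
  ip (chi a b) (sn n) = (cos (n%:R * pi * a) - cos (n%:R * pi * b)) / (n%:R * pi).
Proof.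
move=> n0 a0 ab b1; rewrite -int_sin//.
have -> : `]a, b[%classic = I `&` `]a, b[%classic.
  apply/seteqP; split => x /=; rewrite /I01/= !in_itv/=; last by case.
  by move=> /andP[ax xb]; rewrite ax xb (le_lt_trans a0)//= (lt_le_trans xb).
rewrite Rintegral_mkcondr; apply: eq_Rintegral => x _.
rewrite /chi patchE; case: ifPn => h.
  by rewrite mem_set/= ?in_itv// mul1r.
by rewrite memNset/= ?in_itv ?mul0r//=; exact/negP.
Qed.

Lemma floor_half (y : R) (j : nat) : j%:R <= y < j.+1%:R ->
  y - 2 * (Num.floor (y / 2))%:~R = y - j%:R + (odd j)%:R.
Proof.
move=> /andP[jy yj].
have e : j%:R = (odd j)%:R + (j./2%:R + j./2%:R) :> R by rewrite -!natrD addnn odd_double_half.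
have -> : Num.floor (y / 2) = (j./2)%:Z.
  apply: floor_def; rewrite intrD -[(j./2)%:~R]/(j./2%:R : R).
  by move: jy yj; rewrite -natr1 e; case: (odd j) => /= *; apply/andP; split; lra.
rewrite -[(j./2)%:~R]/(j./2%:R : R) e; ring.
Qed.

(** End points of the copy of (a,b) in the j-th cell of length 1/k. Odd extension reflects it in the
    odd cells, which exchanges the roles of [a] and [b]. *)
Definition seg_lo (a b : R) k j : R := if odd j then (j.+1%:R - b) / k%:R else (j%:R + a) / k%:R.
Definition seg_hi (a b : R) k j : R := if odd j then (j.+1%:R - a) / k%:R else (j%:R + b) / k%:R.

Lemma oddext_chi a b (y : R) j : 0 <= a -> b <= 1 -> j%:R < y < j.+1%:R ->
  oddext (chi a b) y =
  (-1) ^+ j * (if odd j then chi (j.+1%:R - b) (j.+1%:R - a) y else chi (j%:R + a) (j%:R + b) y).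
Proof.
move=> a0 b1 /andP[jy yj]; rewrite /oddext (@floor_half y j) ?(ltW jy)// -signr_odd.
move: yj; rewrite -natr1; case: (odd j) => /= yj.
  rewrite expr1 mulN1r ifF; last by apply/negbTE; rewrite negb_and -!leNgt; apply/orP; right; lra.
  rewrite ifT; last by apply/andP; split; lra.
  congr (- _); rewrite /chi; congr (if _ then _ else _).
  by apply/andP/andP => -[? ?]; split; lra.
rewrite expr0 mul1r ifT; last by apply/andP; split; lra.
rewrite /chi; congr (if _ then _ else _).
by apply/andP/andP => -[? ?]; split; lra.
Qed.

Lemma oddext_nat (f : R -> R) n : oddext f n%:R = 0.
Proof.
rewrite /oddext (@floor_half _ n) ?lexx ?ltr_nat//= subrr add0r.
by case: (odd n) => /=; rewrite ?ltxx ?andbF ?ltr10.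
Qed.

Lemma dil_chi a b k : 0 <= a -> b <= 1 -> (0 < k)%N ->
  {in I, dil (chi a b) k =1 fun x => \sum_(j < k) (-1) ^+ j * chi (seg_lo a b k j) (seg_hi a b k j) x}.
Proof.
move=> a0 b1 k0 x; rewrite inE /I01/= in_itv/= => /andP[x0 x1].
have kp : 0 < k%:R :> R by rewrite ltr0n.
pose y := k%:R * x; have y0 : 0 < y by rewrite mulr_gt0.
have yk : y < k%:R by rewrite -[ltRHS]mulr1 ltr_pM2l.
rewrite /dil -/y.
have segE j : chi (seg_lo a b k j) (seg_hi a b k j) x =
  if odd j then chi (j.+1%:R - b) (j.+1%:R - a) y else chi (j%:R + a) (j%:R + b) y.
  by rewrite /seg_lo /seg_hi /chi; case: (odd j);
    rewrite ltr_pdivrMr// ltr_pdivlMr// [x * _]mulrC.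
have zero j : ~~ (j%:R < y < j.+1%:R) -> chi (seg_lo a b k j) (seg_hi a b k j) x = 0.
  move=> h; rewrite segE /chi; move: h; rewrite -natr1 negb_and -!leNgt => h.
  by case: (odd j); rewrite ifF//; apply/negbTE; rewrite negb_and -!leNgt;
   apply/orP; case/orP: h => h; [left|right|left|right]; lra.
pose j0 := Num.truncn y.
have /andP[jy yj] : j0%:R <= y < j0.+1%:R by rewrite truncn_itv// ltW.
have j0k : (j0 < k)%N by rewrite -(ltr_nat R) (le_lt_trans jy).
rewrite (bigD1 (Ordinal j0k))//= big1 ?addr0; last first.
  move=> j; rewrite -val_eqE/= => jj0; rewrite zero ?mulr0//.
  apply: contra jj0 => /andP[h1 h2]; rewrite eqn_leq; apply/andP; split.
    by rewrite -ltnS -(ltr_nat R) (lt_trans h1).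
  by rewrite -ltnS -(ltr_nat R) (le_lt_trans jy).
(* At an integer [y] both sides vanish: [oddext] is 0 there, and all segments are open and contained
   in cells. *)
have [jyE|jy'] := eqVneq j0%:R y.
  by rewrite -jyE oddext_nat zero ?mulr0// -jyE ltxx.
by rewrite (oddext_chi (j := j0))// ?segE// lt_neqAle jy' jy.
Qed.

Lemma bddm_eq (f g : R -> R) : {in I, f =1 g} -> bddm g -> bddm f.
Proof.
move=> fg [mg [B gB]]; split; last by exists B => x Ix; rewrite fg ?gB// inE.
by apply: eq_measurable_fun mg => x xI; rewrite fg.
Qed.

Lemma bddm_dil_chi a b k : 0 <= a -> b <= 1 -> (0 < k)%N -> bddm (dil (chi a b) k).
Proof.
move=> a0 b1 k0; apply: (bddm_eq (dil_chi a0 b1 k0)); split.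
  apply: measurable_sum => j; apply: measurable_funM => //.
  by case: (bddm_chi (seg_lo a b k j) (seg_hi a b k j)).
exists k%:R => x Ix; rewrite (le_trans (ler_norm_sum _ _ _))//.
rewrite -[k in leRHS]card_ord -sumr_const; apply: ler_sum => j _.
by rewrite normrM normr_sign mul1r /chi; case: ifP; rewrite ?normr1// normr0 ler01.
Qed.

Definition cf (a b : R) (n : nat) : R := cos (n%:R * pi * a) - cos (n%:R * pi * b).

(** The cells contribute differences of [fold_cos] at [a] and [b], whose sum vanishes unless k
    divides n. So a dilate carries the coefficients of [chi], moved from n/k to n. *)
Lemma ip_dil_chi a b k n : 0 <= a -> a < b -> b <= 1 -> (0 < k)%N -> (0 < n)%N ->
  ip (dil (chi a b) k) (sn n) =
  if (k %| n)%N then cf a b (n %/ k) / ((n %/ k)%:R * pi) else 0.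
Proof.
move=> a0 ab b1 k0 n0; have kp : 0 < k%:R :> R by rewrite ltr0n.
rewrite (@eq_ip _ _ _ _ _ (dil_chi a0 b1 k0) (fun x _ => erefl)).
rewrite ip_suml; last first.
- exact: inL2_sn.
- by move=> j; apply/inL2Z/inL2_bddm/bddm_chi.
have E (j : 'I_k) : ip (fun x => (-1) ^+ j * chi (seg_lo a b k j) (seg_hi a b k j) x) (sn n) =
    (fold_cos n k a j - fold_cos n k b j) / (n%:R * pi).
  rewrite ipZl; [|exact/inL2_bddm/bddm_chi|exact: inL2_sn].
  have jk : j.+1%:R <= k%:R :> R by rewrite ler_nat.
  rewrite ip_chi_sn//; first last.
  - rewrite /seg_hi; case: (odd j); rewrite ler_pdivrMr// mul1r (le_trans _ jk)// -natr1; lra.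
  - by rewrite /seg_lo /seg_hi; case: (odd j); rewrite ltr_pM2r ?invr_gt0//; lra.
  - rewrite /seg_lo; case: (odd j); rewrite divr_ge0// -?natr1; have := ler0n R j; lra.
  rewrite mulrA; congr (_ / _); rewrite -signr_odd /seg_lo /seg_hi /fold_cos.
  have e c : n%:R * pi * (c / k%:R) = n%:R * pi / k%:R * c :> R by rewrite mulrCA mulrC.
  by case: (odd j) => /=; rewrite !e ?expr1 ?expr0; ring.
rewrite (eq_bigr _ (fun j _ => E j)) -mulr_suml sumrB !sum_fold_cos//.
case: ifPn => kn; last by rewrite subrr mul0r.
rewrite -mulrBr /cf; case/dvdnP: kn n0 => q ->; rewrite muln_gt0 => /andP[q0 _].
have aux (d p c r : R) : c != 0 -> r * p != 0 -> c * d / (r * c * p) = d / (r * p).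
  by rewrite mulf_eq0 negb_or => c1 /andP[r1 p1]; field; rewrite p1 r1 c1.
by rewrite mulnK// natrM; apply: aux; rewrite ?natpi_neq0 ?gt_eqF.
Qed.

End DilateCoefficients.

(** * Zeros of the Bohr lift *)

Section EulerEvaluation.
Variables (R : realType) (N : nat).
Hypothesis N0 : (0 < N)%N.
Local Notation C := R[i].
Implicit Types (ps : seq (nat * C)) (f g : nat -> C) (n m p : nat) (u z : C).

Definition periodicN f := forall n, f (n %% N)%N = f n.

(* The completely multiplicative function with value [z] at each listed prime [p]
   and [0] at the other primes. *)
Fixpoint Zf ps n : C :=
  if ps is (p, z) :: qs then z ^+ logn p n * Zf qs (n`_p^')%N else (n == 1%N)%:R.

Definition admissible ps :=
  [&& uniq (unzip1 ps), all (fun pz => prime pz.1) ps & all (fun pz => nc pz.2 < 1) ps].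

Lemma Zf1 ps : Zf ps 1 = 1.
Proof. by elim: ps => [//|[p z] ps IH] /=; rewrite logn1 expr0 mul1r partn1. Qed.

Lemma Zf_nil n : (1 < n)%N -> Zf [::] n = 0.
Proof. by move=> n1; rewrite /= gtn_eqF. Qed.

Lemma ZfM ps m n : (0 < m)%N -> (0 < n)%N -> Zf ps (m * n) = Zf ps m * Zf ps n.
Proof.
elim: ps m n => [|[p z] ps IH] m n m0 n0 /=.
  by rewrite muln_eq1; case: eqP => _; case: eqP => _; rewrite ?mulr1 ?mulr0 ?mul0r.
rewrite partnM// IH ?part_gt0// lognM// exprD; ring.
Qed.

Lemma Zf_cons_prime p z ps : prime p -> admissible ((p, z) :: ps) -> Zf ((p, z) :: ps) p = z.
Proof.
move=> pp _ /=; rewrite lognE pp dvdnn prime_gt0// divnn prime_gt0// logn1 expr1.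
have -> : (p`_p^')%N = 1%N; last by rewrite Zf1 mulr1.
apply: part_p'nat; rewrite pnatNK; exact: pnat_id.
Qed.

Lemma Zf_coprime p z ps n : prime p -> (0 < n)%N -> ~~ (p %| n)%N -> Zf ((p, z) :: ps) n = Zf ps n.
Proof.
move=> pp n0 pn /=; rewrite lognE pp n0 (negbTE pn) mul1r.
by rewrite part_pnat_id// p'natE.
Qed.

Lemma Zf_eq0 ps p n : prime p -> (0 < n)%N -> (p %| n)%N -> p \notin unzip1 ps ->
  all (fun pz => prime pz.1) ps -> Zf ps n = 0.
Proof.
move=> pp; elim: ps n => [|[q z] ps IH] n n0 pn /=.
  by case: eqP => // n1; move: pn; rewrite n1 dvdn1 => /eqP p1; rewrite p1 in pp.
rewrite inE negb_or => /andP[pq pps] /andP[pq' aps].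
rewrite IH ?mulr0 ?part_gt0//; move: pn; rewrite -{1}(partnC q n0) Euclid_dvdM//.
by rewrite p_part Euclid_dvdX// dvdn_prime2// (negbTE pq).
Qed.

Lemma admissible_cons p z ps : admissible ((p, z) :: ps) ->
  [/\ prime p, p \notin unzip1 ps, nc z < 1 & admissible ps].
Proof.
rewrite /admissible /= => /and3P[/andP[-> ->] /andP[-> ->] /andP[-> ->]].
by split.
Qed.

Lemma sum_cons p z ps m (F : nat -> C) : admissible ((p, z) :: ps) ->
  \sum_(1 <= n < m.+1) Zf ((p, z) :: ps) n * F n =
  \sum_(1 <= n < m.+1) Zf ps n * F n +
  \sum_(1 <= n < m.+1 | (p %| n)%N) Zf ((p, z) :: ps) n * F n.
Proof.
move=> ad; have [pp pps _ /and3P[_ aps _]] := admissible_cons ad.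
rewrite [X in _ + X]big_mkcond -big_split/= big_nat_cond [RHS]big_nat_cond.
apply: eq_bigr => n /andP[/andP[n0 _] _]; have [pn|pn] := boolP (p %| n)%N.
  by rewrite (Zf_eq0 pp n0 pn pps aps) mul0r add0r.
by have := Zf_coprime z ps pp n0 pn => /= ->; rewrite addr0.
Qed.

Definition Zabs ps m : R := \sum_(1 <= n < m.+1) nc (Zf ps n).

(** Splitting off the multiples of [p] gives S' <= S + |z| S', hence the bound S / (1 - |z|). *)
Lemma Zabs_bounded ps : admissible ps -> exists B, forall m, Zabs ps m <= B.
Proof.
elim: ps => [_|[p z] ps IH ad].
  exists 1; case=> [|m]; first by rewrite /Zabs big_geq.
  rewrite /Zabs big_ltn// Zf1 nc1 big_nat_cond big1 ?addr0// => n /andP[/andP[n1 _] _].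
  by rewrite Zf_nil// nc0.
have [pp pps z1 adp] := admissible_cons ad; have [B HB] := IH adp.
exists (B / (1 - nc z)) => m; rewrite ler_pdivlMr ?subr_gt0// mulrBr mulr1 lerBlDr.
have E : Zabs ((p, z) :: ps) m =
    Zabs ps m + \sum_(1 <= n < m.+1 | (p %| n)%N) nc (Zf ((p, z) :: ps) n).
  have /and3P[_ aps _] := adp.
  rewrite /Zabs [X in _ + X]big_mkcond -big_split/= big_nat_cond [RHS]big_nat_cond.
  apply: eq_bigr => n /andP[/andP[n0 _] _]; have [pn|pn] := boolP (p %| n)%N.
    by rewrite (Zf_eq0 pp n0 pn pps aps) nc0 add0r.
  by have := Zf_coprime z ps pp n0 pn => /= ->; rewrite addr0.
rewrite [leLHS]E; apply: lerD => //.
rewrite sum_multiples ?prime_gt0// mulrC /Zabs mulr_sumr.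
rewrite [leRHS](big_cat_nat (n := (m %/ p).+1))//= ?ltnS ?leq_div//.
rewrite -[leLHS]addr0 lerD//; last by apply: sumr_ge0 => n _; rewrite mulr_ge0 ?nc_ge0.
rewrite big_nat_cond [leRHS]big_nat_cond; apply: ler_sum => n /andP[/andP[n0 _] _].
have := ZfM ((p, z) :: ps) (prime_gt0 pp) n0 => /= ->.
by have := Zf_cons_prime pp ad => /= ->; rewrite ncM.
Qed.

Lemma Zf_le1 ps n : (0 < n)%N -> admissible ps -> nc (Zf ps n) <= 1.
Proof.
elim: ps n => [|[p z] ps IH] n n0 ad /=.
  by case: eqP => _; rewrite ?nc1 ?nc0 ?ler01.
have [pp pps z1 adp] := admissible_cons ad.
rewrite ncM ncX mulr_ile1 ?nc_ge0 ?exprn_ge0 ?nc_ge0//; last by apply: IH; rewrite ?part_gt0.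
by rewrite exprn_ile1 ?nc_ge0// ltW.
Qed.

Lemma Zabs_cauchy ps eps : admissible ps -> 0 < eps ->
  exists M, forall m m', (M <= m)%N -> Zabs ps m' - Zabs ps m <= eps.
Proof.
move=> ad e0; have [B HB] := Zabs_bounded ad; apply: contrapT => H.
have step M : exists m', Zabs ps M + eps < Zabs ps m'.
  apply: contrapT => h; apply: H; exists M => m m' Mm.
  rewrite lerBlDr leNgt; apply/negP => h2; apply: h; exists m'.
  rewrite (le_lt_trans _ h2)// addrC lerD2l /Zabs [leRHS](big_cat_nat (n := M.+1))//= lerDl.
  by apply: sumr_ge0 => n _; exact: nc_ge0.
have grow k : exists m, eps *+ k <= Zabs ps m.
  elim: k => [|k [m hm]]; first by exists 0%N; rewrite mulr0n /Zabs big_geq.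
  have [m' hm'] := step m; exists m'; rewrite mulrSr (le_trans _ (ltW hm'))// lerD2r//.
have [m hm] := grow (Num.truncn (B / eps)).+1.
have := le_trans hm (HB m); rewrite -mulr_natr -ler_pdivlMl// leNgt mulrC.
by rewrite truncnS_gt.
Qed.

(** The series of the u^i f(p^i n) in closed form. Modulo [N] the powers of [p] are periodic from
    the exponent [e] on, with period [s], so the tail is geometric of ratio u^s. *)
Definition Veval p u f n : C :=
  let e := logn p N in let s := totient (N`_p^')%N in
  \sum_(i < e) u ^+ i * f (p ^ i * n)%N +
  (1 - u ^+ s)^-1 * \sum_(i < s) u ^+ (e + i) * f (p ^ (e + i) * n)%N.

Lemma Veval_periodic p u f : periodicN f -> periodicN (Veval p u f).
Proof.
move=> pf n; rewrite /Veval; congr (_ + _ * _); apply: eq_bigr => i _;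
  by rewrite -[in LHS]pf modnMmr pf.
Qed.

Lemma telescope_geom u (g : nat -> C) k : \sum_(i < k) u ^+ i * g i -
  u * \sum_(i < k) u ^+ i * g i.+1 = g 0%N - u ^+ k * g k.
Proof.
elim: k => [|k IH]; first by rewrite !big_ord0 mulr0 expr0 mul1r !subrr.
by rewrite !big_ord_recr/= mulrDr opprD addrACA IH exprS; ring.
Qed.

Lemma pow_part_modn p : prime p ->
  p ^ (logn p N + totient (N`_p^')%N) = p ^ logn p N %[mod N].
Proof.
move=> pp; apply/eqP; rewrite eqn_mod_dvd; last by rewrite leq_pexp2l ?prime_gt0// leq_addr.
rewrite expnD -{2}[(p ^ logn p N)%N]muln1 -mulnBr -[X in (X %| _)%N](partnC p N0) p_part.
apply: dvdn_mul => //; rewrite -eqn_mod_dvd ?expn_gt0 ?prime_gt0//.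
apply/eqP; apply: Euler_exp_totient; rewrite coprime_sym.
by rewrite (pnat_coprime (part_pnat p^'%N N))// pnatNK pnat_id.
Qed.

Lemma one_subX_neq0 u s : nc u < 1 -> (0 < s)%N -> 1 - u ^+ s != 0.
Proof.
move=> u1 s0; rewrite subr_eq0; apply/eqP => h; have := ncX u s; rewrite -h nc1 => h2.
have : nc u ^+ s < 1 by rewrite exprn_ilt1 ?nc_ge0// -lt0n.
by rewrite -h2 ltxx.
Qed.

(** The functional equation of the series, through which [Veval] is used from here on; it holds
    because the closed form telescopes. *)
Lemma Veval_rel p u f n : prime p -> nc u < 1 -> periodicN f ->
  Veval p u f n - u * Veval p u f (p * n)%N = f n.
Proof.
move=> pp u1 pf; pose e := logn p N; pose s := totient (N`_p^')%N.
have s0 : (0 < s)%N by rewrite totient_gt0 part_gt0.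
have us := one_subX_neq0 u1 s0.
pose g i := f (p ^ i * n)%N.
have gS i : f (p ^ i * (p * n))%N = g i.+1 by rewrite /g expnSr mulnA.
have gper : g (e + s)%N = g e.
  by rewrite /g -[LHS]pf -[RHS]pf -[in LHS]modnMml -[in RHS]modnMml pow_part_modn.
rewrite /Veval -/e -/s.
under [X in u * (X + _)]eq_bigr => i _ do rewrite gS.
under [X in u * (_ + _ * X)]eq_bigr => i _ do rewrite gS.
have t1 := telescope_geom u g e.
have t2 := telescope_geom u (fun i => u ^+ e * g (e + i)%N) s.
rewrite addn0 gper in t2.
have e1 : \sum_(i < s) u ^+ (e + i) * f (p ^ (e + i) * n)%N =
  \sum_(i < s) u ^+ i * (u ^+ e * g (e + i)%N).
  by apply: eq_bigr => i _; rewrite exprD mulrA [u ^+ i * _]mulrC.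
have e2 : \sum_(i < s) u ^+ (e + i) * g (e + i).+1 =
  \sum_(i < s) u ^+ i * (u ^+ e * g (e + i.+1)%N).
  by apply: eq_bigr => i _; rewrite exprD mulrA [u ^+ i * _]mulrC addnS.
rewrite e1 e2; move: t1 t2; set A := \sum_(i < e) _; set A' := \sum_(i < e) _.
set D := \sum_(i < s) _; set D' := \sum_(i < s) _ => t1 t2.
have -> : A + (1 - u ^+ s)^-1 * D - u * (A' + (1 - u ^+ s)^-1 * D') =
  (A - u * A') + (1 - u ^+ s)^-1 * (D - u * D') by ring.
have -> : f n = g 0%N by rewrite /g expn0 mul1n.
by rewrite t1 t2; field.
Qed.

(** The value of the Bohr lift of f(n)/n at the point [ps], summed out one prime at a time. The
    weight 1/n turns the variable z into z/p. *)
Fixpoint Eeval ps f : C :=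
  if ps is (p, z) :: qs then Eeval qs (Veval p (z / p%:R) f) else f 1%N.

Lemma periodic_bounded f : periodicN f -> exists B, forall n, nc (f n) <= B.
Proof.
move=> pf; exists (\sum_(i < N) nc (f i)) => n; rewrite -pf.
rewrite (bigD1 (Ordinal (ltn_pmod n N0)))//= lerDl.
by apply: sumr_ge0 => i _; exact: nc_ge0.
Qed.

Definition Lsum ps f m : C := \sum_(1 <= n < m.+1) Zf ps n * (f n / n%:R).

Lemma ncn_natr n : nc (n%:R : C) = n%:R.
Proof. by rewrite -[n%:R](rmorph_nat (real_complex R)) [LHS](ncRC n%:R) ger0_norm. Qed.

Lemma nc_div_prime_lt1 z p : prime p -> nc z < 1 -> nc (z / p%:R) < 1.
Proof.
move=> pp z1; rewrite ncM ncV ncn_natr ltr_pdivrMr ?ltr0n ?prime_gt0// mul1r.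
by rewrite (lt_le_trans z1)// ler1n prime_gt0.
Qed.

Lemma Lsum_cvg ps f : admissible ps -> periodicN f -> forall eps, 0 < eps ->
  exists M, forall m, (M <= m)%N -> nc (Lsum ps f m - Eeval ps f) <= eps.
Proof.
elim: ps f => [|[p z] ps IH] f ad pf eps e0.
  exists 1%N => -[//|m] _; rewrite /Lsum big_ltn// Zf1 mul1r divr1 big_nat_cond big1.
    by rewrite addr0 subrr nc0 ltW.
  by move=> n /andP[/andP[n1 _] _]; rewrite Zf_nil// mul0r.
have [pp pps z1 adp] := admissible_cons ad.
have p0 : (p%:R : C) != 0 by rewrite -nc_gt0 ncn_natr ltr0n prime_gt0.
set u := z / p%:R; have u1 : nc u < 1 by exact: nc_div_prime_lt1.
set g := Veval p u f; have pg : periodicN g by exact: Veval_periodic.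
have e20 : 0 < eps / 2 by rewrite divr_gt0.
have [M1 HM1] := IH g adp pg _ e20.
have [B HB] := periodic_bounded pg.
have B0 : 0 <= B by exact: le_trans (nc_ge0 _) (HB 0%N).
have B10 : 0 < B + 1 by rewrite ltr_wpDl.
have [M2 HM2] := Zabs_cauchy ad (divr_gt0 e20 B10).
exists (maxn M1 M2) => m; rewrite geq_max => /andP[/HM1 m1 /HM2 m2].
pose T n := Zf ((p, z) :: ps) n * (g n / n%:R).
(* With f(n) = g(n) - u g(pn), the second part is a sum over the multiples of [p] up to p m. What
   fails to cancel lies in (m, p m] and is a tail of the absolutely convergent [Zabs]. *)
have E : Lsum ((p, z) :: ps) f m = Lsum ps g m - \sum_(m.+1 <= n < (p * m).+1 | (p %| n)%N) T n.
  have -> : Lsum ((p, z) :: ps) f m =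
    \sum_(1 <= n < m.+1) T n - \sum_(1 <= n < m.+1) T (p * n)%N.
    rewrite -sumrB /Lsum big_nat_cond [RHS]big_nat_cond; apply: eq_bigr => n /andP[/andP[n0 _] _].
    rewrite /T -[in LHS](Veval_rel n pp u1 pf) -/g.
    have -> := ZfM ((p, z) :: ps) (prime_gt0 pp) n0; have -> := Zf_cons_prime pp ad.
    have n0' : (n%:R : C) != 0 by rewrite -nc_gt0 ncn_natr ltr0n.
    by rewrite natrM /u; field; rewrite n0' p0.
  rewrite (sum_cons _ _ ad) -/(Lsum ps g m) -addrA; congr (_ + _).
  have -> : \sum_(1 <= n < m.+1) T (p * n)%N = \sum_(1 <= n < (p * m).+1 | (p %| n)%N) T n.
    by rewrite sum_multiples ?prime_gt0// mulKn ?prime_gt0.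
  rewrite [X in _ - X](big_cat_nat (n := m.+1))//= ?opprD ?addrA ?subrr ?add0r//.
  by rewrite ltnS leq_pmull// prime_gt0.
have -> : Lsum ((p, z) :: ps) f m - Eeval ((p, z) :: ps) f =
  (Lsum ps g m - Eeval ps g) - \sum_(m.+1 <= n < (p * m).+1 | (p %| n)%N) T n.
  by rewrite E /= -/u -/g; ring.
rewrite (le_trans (ncB _ _))// [eps](splitr eps) lerD//.
rewrite (le_trans (nc_sum _ _ _))//.
apply: (@le_trans _ _ (\sum_(m.+1 <= n < (p * m).+1) nc (Zf ((p, z) :: ps) n) * B)).
  rewrite big_mkcond big_nat_cond [leRHS]big_nat_cond; apply: ler_sum => n /andP[/andP[n0 _] _].
  have n0' : (0 < n)%N by exact: leq_ltn_trans n0.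
  case: ifP => _; last by rewrite mulr_ge0 ?nc_ge0.
  rewrite /T ncM ler_wpM2l ?nc_ge0// ncM ncV ncn_natr (le_trans _ (HB n))//.
  by rewrite ler_piMr ?nc_ge0// invf_le1 ?ltr0n// ler1n.
rewrite -mulr_suml; have mpm : (m <= p * m)%N by rewrite leq_pmull// prime_gt0.
have -> : \sum_(m.+1 <= n < (p * m).+1) nc (Zf ((p, z) :: ps) n) =
   Zabs ((p, z) :: ps) (p * m) - Zabs ((p, z) :: ps) m.
  by rewrite /Zabs [X in _ = X - _](big_cat_nat (n := m.+1))//= addrAC subrr add0r.
rewrite (le_trans (ler_wpM2r B0 (m2 _)))// mulrAC ler_pdivrMr// ler_wpM2l ?ltW//.
by rewrite ltrDl.
Qed.

(* The functional [f |-> sum_n Re (Z n) <f, sin (n pi x)>] sends the [k]-th dilate of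
   [chi] to [Re (Z k F)], where [F] is the value of the Bohr lift at the point [ps]. *)
Lemma not_inC_of_zero (a b : R) ps : 0 <= a -> a < b -> b <= 1 ->
  periodicN (fun n => RC (cf a b n)) -> admissible ps ->
  Eeval ps (fun n => RC (cf a b n)) = 0 -> ~ inC (chi a b).
Proof.
move=> a0 ab b1 per ad E0 [_ /(_ (sn 1) (inL2_sn R 1))].
have [T0 HT0] := Zabs_bounded ad; pose T := T0 + 1.
have HT m : Zabs ps m <= T by rewrite (le_trans (HT0 m))// lerDl.
have T_gt0 : 0 < T by rewrite /T ltr_wpDl// (le_trans _ (HT0 0%N))// /Zabs big_geq.
(* An approximant of [sn 1] with squared error below 1/(8T), tested against [G m] of squared norm at
   most T/2, gives a pairing of square below 1/16. The pairing is at least 1/2 - 1/4, since the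
   functional nearly vanishes on the dilates. *)
have e0 : 0 < (8 * T)^-1 by rewrite invr_gt0 mulr_gt0.
move=> /(_ _ e0) [K [c]].
set h := fun x => _; have h2 : inL2 h.
  apply: inL2B; first exact: inL2_sn.
  by apply: inL2_sum => k; apply/inL2Z/inL2_bddm/bddm_dil_chi => //; exact: ltW.
rewrite (sqint_ip h2) lte_fin => hsmall.
pose G m x := \sum_(1 <= n < m.+1) Re (Zf ps n) * sn n x.
have G2 m : inL2 (G m) by apply: inL2_sum => n; apply/inL2Z/inL2_sn.
have ipG (f : R -> R) m : inL2 f -> ip f (G m) = \sum_(1 <= n < m.+1) Re (Zf ps n) * ip f (sn n).
  move=> f2; rewrite ip_sumr//; last by move=> n; apply/inL2Z/inL2_sn.
  by apply: eq_bigr => n _; rewrite ipZr//; exact: inL2_sn.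
have ip_sn_G n m : (0 < n <= m)%N -> ip (sn n) (G m) = Re (Zf ps n) / 2.
  move=> /andP[n0 nm]; rewrite ipG; last exact: inL2_sn.
  have nin : n \in index_iota 1 m.+1 by rewrite mem_index_iota n0 ltnS.
  rewrite (bigD1_seq n)//= ?iota_uniq// ip_sn// eqxx mul1r.
  rewrite big_seq_cond big1 ?addr0// => k; rewrite mem_index_iota => /andP[/andP[k0 _] kn].
  by rewrite ip_sn// eq_sym (negbTE kn) mul0r mulr0.
have GG m : ip (G m) (G m) <= T / 2.
  rewrite ipG//; apply: (@le_trans _ _ (Zabs ps m / 2)); last by rewrite ler_wpM2r.
  rewrite /Zabs mulr_suml big_nat_cond [leRHS]big_nat_cond; apply: ler_sum => n /andP[/andP[n0 nm] _].
  rewrite ipC ip_sn_G ?n0// mulrA ler_wpM2r// -expr2 -real_normK ?num_real// expr2.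
  apply: (@le_trans _ _ (nc (Zf ps n) * 1)); last by rewrite mulr1.
  by apply: ler_pM => //; [exact: Re_le_nc|exact: le_trans (Re_le_nc _) (Zf_le1 n0 ad)].
have dilG k m : (0 < k)%N -> ip (dil (chi a b) k) (G m) =
    Re (Zf ps k * Lsum ps (fun n => RC (cf a b n)) (m %/ k)) / pi.
  move=> k0; rewrite ipG; last by apply/inL2_bddm/bddm_dil_chi => //; exact: ltW.
  have -> : \sum_(1 <= n < m.+1) Re (Zf ps n) * ip (dil (chi a b) k) (sn n) =
    \sum_(1 <= n < m.+1 | (k %| n)%N) Re (Zf ps n) * (cf a b (n %/ k) / ((n %/ k)%:R * pi)).
    rewrite [RHS]big_mkcond [LHS]big_nat_cond [RHS]big_nat_cond.
    apply: eq_bigr => n /andP[/andP[n0 _] _]; rewrite ip_dil_chi//.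
    by case: ifP => //; rewrite mulr0.
  rewrite sum_multiples// /Lsum mulr_sumr Re_sum mulr_suml.
  rewrite big_nat_cond [RHS]big_nat_cond; apply: eq_bigr => n /andP[/andP[n0 _] _].
  rewrite mulKn// ZfM//.
  have -> : Zf ps k * (Zf ps n * (RC (cf a b n) / n%:R)) = RC (cf a b n / n%:R) * (Zf ps k * Zf ps n).
    have -> : RC (cf a b n / n%:R) = RC (cf a b n) / n%:R.
      by rewrite RCM; congr (_ * _); rewrite [LHS](fmorphV (real_complex R)) rmorph_nat.
    ring.
  by rewrite ReZ invfM; ring.
pose c1 := \sum_(k < K) `|c k| + 1.
have c1_gt0 : 0 < c1 by rewrite ltr_wpDl// sumr_ge0.
have e1 : 0 < pi / (4 * c1) :> R by rewrite divr_gt0 ?pi_gt0// mulr_gt0.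
have [M HM] := Lsum_cvg ad per e1.
(* Large enough that m %/ k is at least M for every dilate k <= K in the combination. *)
pose m := (M * K + K).+1.
have dsmall (k : 'I_K) : `|ip (dil (chi a b) k.+1) (G m)| <= (4 * c1)^-1.
  rewrite dilG// normrM (ger0_norm (_ : 0 <= pi^-1)) ?invr_ge0 ?pi_ge0//.
  rewrite ler_pdivrMr ?pi_gt0// mulrC (le_trans (Re_le_nc _))// ncM.
  have Mm : (M <= m %/ k.+1)%N.
    rewrite leq_divRL// /m (leq_trans (leq_mul (leqnn M) (ltn_ord k)))//.
    by rewrite -addnS leq_addr.
  have := HM _ Mm; rewrite E0 subr0 => h1.
  rewrite mulrC [leRHS]mulrC -[leRHS]mul1r.
  by apply: ler_pM; rewrite ?nc_ge0//; exact: Zf_le1.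
have hG : ip h (G m) = 2^-1 - \sum_(k < K) c k * ip (dil (chi a b) k.+1) (G m).
  have dil2 (k : 'I_K) : inL2 (dil (chi a b) k.+1) by apply/inL2_bddm/bddm_dil_chi => //; exact: ltW.
  rewrite ipBl//; [|exact: inL2_sn|by apply: inL2_sum => k; exact: inL2Z].
  rewrite ip_sn_G// Zf1 mul1r ip_suml//; last by move=> k; exact: inL2Z.
  by congr (_ - _); apply: eq_bigr => k _; rewrite ipZl.
have big : 4^-1 <= ip h (G m).
  rewrite hG; have : `|\sum_(k < K) c k * ip (dil (chi a b) k.+1) (G m)| <= 4^-1.
    rewrite (le_trans (ler_norm_sum _ _ _))//.
    apply: (@le_trans _ _ (\sum_(k < K) `|c k| * (4 * c1)^-1)).
      by apply: ler_sum => k _; rewrite normrM ler_wpM2l.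
    rewrite -mulr_suml ler_pdivrMr ?mulr_gt0//.
    rewrite mulrA mulVf ?pnatr_eq0// mul1r /c1; lra.
  by rewrite ler_norml => /andP[]; lra.
have := cauchy_schwarz h2 (G2 m); apply/negP; rewrite -ltNge.
apply: (@le_lt_trans _ _ (ip h h * (T / 2))); first by rewrite ler_wpM2l// ip_ge0.
apply: (@lt_le_trans _ _ ((8 * T)^-1 * (T / 2))); first by rewrite ltr_pM2r// divr_gt0.
have -> : (8 * T)^-1 * (T / 2) = 4^-1 ^+ 2 by field; rewrite gt_eqF.
by rewrite lerXn2r ?nnegrE// (le_trans _ big).
Qed.

End EulerEvaluation.

(** * Zero-free Bohr lifts *)

Section ZeroFree.
Variables (R : realType) (N : nat).
Hypothesis N0 : (0 < N)%N.
Local Notation C := R[i].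
Implicit Types (ps : seq (nat * C)) (f g : nat -> C) (n m p k : nat) (u z : C).
Local Notation Veval := (@Veval R N).
Local Notation Eeval := (@Eeval R N).
Local Notation periodicN := (@periodicN R N).

Variable h : nat.
Hypothesis ch : coprime h N.
Let r := totient N.
Hypothesis r3 : (2 < r)%N.

Lemma logn_class p : prime p -> p = h %[mod N] -> logn p N = 0%N.
Proof.
move=> pp ph; apply/eqP; rewrite -leqn0 leqNgt -pfactor_dvdn// expn1.
apply/negP => pN; have : coprime p N by rewrite -coprime_modl ph coprime_modl.
by rewrite prime_coprime// pN.
Qed.

Lemma Veval_class p u f n : prime p -> p = h %[mod N] -> periodicN f ->
  Veval p u f n = (1 - u ^+ r)^-1 * \sum_(i < r) u ^+ i * f (h ^ i * n)%N.
Proof.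
move=> pp ph pf; rewrite /Veval (logn_class pp ph) big_ord0 add0r.
have -> : totient (N`_p^')%N = r.
  rewrite part_pnat_id// p'natE//; apply/negP => pN.
  have : coprime p N by rewrite -coprime_modl ph coprime_modl.
  by rewrite prime_coprime// pN.
congr (_ * _); apply: eq_bigr => i _; rewrite add0n; congr (_ * _).
by rewrite -pf -modnMml -modnXm ph modnXm modnMml pf.
Qed.

Definition geomP p : {poly R} := \poly_(i < r) p%:R^-1 ^+ i.
Definition geomPs (P : seq nat) : {poly R} := \prod_(p <- P) geomP p.

(** Hadamard product of [q] with the sequence of the f(h^k). *)
Definition had f (q : {poly R}) : {poly C} := \poly_(k < size q) (RC q`_k * f (h ^ k)%N).

Lemma coef_had f q k : (had f q)`_k = RC q`_k * f (h ^ k)%N.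
Proof. by rewrite coef_poly; case: ltnP => // qk; rewrite nth_default// RC0 mul0r. Qed.

Lemma had_mulX f q (c : R) i t :
  (had f ((c *: 'X^i) * q)).[t] = RC c * t ^+ i * (had (fun n => f (h ^ i * n)%N) q).[t].
Proof.
have -> : had f (c *: 'X^i * q) = RC c *: ('X^i * had (fun n => f (h ^ i * n)%N) q).
  apply/polyP => k; rewrite coef_had coefZ coefXnM -scalerAl coefZ coefXnM.
  case: ltnP => ik; first by rewrite !mulr0 RC0 mul0r.
  by rewrite coef_had RCM mulrA -expnD subnKC.
by rewrite hornerZ hornerM hornerXn mulrA.
Qed.

Lemma had_sum f (I : Type) (s : seq I) (F : I -> {poly R}) t :
  (had f (\sum_(i <- s) F i)).[t] = \sum_(i <- s) (had f (F i)).[t].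
Proof.
rewrite -horner_sum; congr (_.[t]); apply/polyP => k.
rewrite coef_had !coef_sum RC_sum mulr_suml; apply: eq_bigr => i _.
by rewrite coef_had.
Qed.

(** For primes in the class of h the value f(p^i n) = f(h^i n) has period r in i. Each prime
    therefore contributes a polynomial of degree below r and a factor 1 / (1 - (t/p)^r), which is
    moved to the left side. *)
Lemma Eeval_class (P : seq nat) f t : periodicN f -> nc t < 1 -> all prime P ->
  (forall p, p \in P -> p = h %[mod N]) ->
  Eeval [seq (p, t) | p <- P] f * \prod_(p <- P) (1 - (t / p%:R) ^+ r) = (had f (geomPs P)).[t].
Proof.
move=> + t1; elim: P f => [|p P IH] f pf /= aP Ph.
  rewrite big_nil mulr1 /geomPs big_nil.
  have -> : had f 1 = (f 1%N)%:P.
    apply/polyP => k; rewrite coef_had coef1 coefC; case: eqP => [->|_].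
      by rewrite RC1 mul1r expn0.
    by rewrite RC0 mul0r.
  by rewrite hornerC.
have /andP[pp aP'] := aP; have ph := Ph p (mem_head _ _).
have Ph' q : q \in P -> q = h %[mod N] by move=> qP; apply: Ph; rewrite inE qP orbT.
have pV : periodicN (Veval p (t / p%:R) f) by exact: Veval_periodic.
rewrite big_cons [_ * \prod_(_ <- _) _]mulrC mulrA IH//.
have r0 : (0 < r)%N by exact: ltn_trans r3.
have us := one_subX_neq0 (nc_div_prime_lt1 pp t1) r0.
have -> : geomPs (p :: P) = \sum_(i < r) (p%:R^-1 ^+ i *: 'X^i) * geomPs P.
  by rewrite /geomPs big_cons /geomP poly_def mulr_suml.
rewrite had_sum.
have -> : (had (Veval p (t / p%:R) f) (geomPs P)).[t] = (1 - (t / p%:R) ^+ r)^-1 *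
    \sum_(i < r) (t / p%:R) ^+ i * (had (fun n => f (h ^ i * n)%N) (geomPs P)).[t].
  under eq_bigr => i _ do rewrite horner_poly mulr_sumr.
  rewrite exchange_big/= mulr_sumr horner_poly; apply: eq_bigr => k _.
  rewrite Veval_class// mulrCA -mulrA; congr (_ * _).
  rewrite mulr_sumr mulr_suml; apply: eq_bigr => i _; ring.
rewrite mulrAC mulVf// mul1r; apply: eq_bigr => i _; rewrite had_mulX.
congr (_ * _); rewrite RCX exprMn mulrC; congr (_ ^+ _ * _).
by rewrite [RHS](fmorphV (real_complex R)) rmorph_nat.
Qed.

Lemma coef0_mul (p q : {poly R}) : (p * q)`_0 = p`_0 * q`_0.
Proof. by rewrite coefM big_ord_recl big_ord0 addr0. Qed.

Lemma coef1_mul (p q : {poly R}) : (p * q)`_1 = p`_0 * q`_1 + p`_1 * q`_0.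
Proof. by rewrite coefM !big_ord_recl big_ord0 addr0. Qed.

Lemma coef2_mul (p q : {poly R}) : (p * q)`_2 = p`_0 * q`_2 + p`_1 * q`_1 + p`_2 * q`_0.
Proof. by rewrite coefM !big_ord_recl big_ord0 addr0 addrA. Qed.

Lemma geomPs_coef P : [/\ (geomPs P)`_0 = 1, (geomPs P)`_1 = \sum_(p <- P) p%:R^-1 &
  2 * (geomPs P)`_2 = (\sum_(p <- P) p%:R^-1) ^+ 2 + \sum_(p <- P) p%:R^-1 ^+ 2].
Proof.
have gc p : [/\ (geomP p)`_0 = 1, (geomP p)`_1 = p%:R^-1 & (geomP p)`_2 = p%:R^-1 ^+ 2].
  by rewrite /geomP !coef_poly r3 (ltn_trans _ r3)// (ltn_trans _ r3)// expr0 expr1.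
elim: P => [|p P [IH0 IH1 IH2]].
  by rewrite /geomPs !big_nil !coef1 /= expr0n addr0 mulr0.
have [g0 g1 g2] := gc p.
rewrite /geomPs !big_cons coef0_mul coef1_mul coef2_mul -/(geomPs P) g0 g1 g2 IH0 IH1.
split; [by rewrite mulr1|by rewrite mul1r mulr1 addrC|].
by rewrite !mulrDr mul1r IH2; ring.
Qed.

Lemma geomPs_ge0 P k : 0 <= (geomPs P)`_k.
Proof.
elim: P k => [|p P IH] k; first by rewrite /geomPs big_nil coef1; case: eqP.
rewrite /geomPs big_cons coefM; apply: sumr_ge0 => i _; rewrite mulr_ge0//.
by rewrite coef_poly; case: ifP => // _; rewrite exprn_ge0 ?invr_ge0.
Qed.

(** For a = 1/p <= 1/2 the geometric sum is at most 1 / (1 - a) <= 1 + 2a <= exp (2a). *)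
Lemma geomPs1_le P : all prime P -> (geomPs P).[1] <= expR (2 * \sum_(p <- P) p%:R^-1).
Proof.
elim: P => [|p P IH] /=; first by rewrite /geomPs !big_nil hornerC mulr0 expR0.
move=> /andP[pp /IH {}IH]; rewrite /geomPs !big_cons hornerM mulrDr expRD.
have p2 : 0 < (p%:R^-1 : R) <= 2^-1.
  by rewrite invr_gt0 ltr0n prime_gt0//= lef_pV2 ?posrE ?ltr0n ?prime_gt0// ler_nat prime_gt1.
apply: ler_pM => //.
- rewrite horner_poly; apply: sumr_ge0 => i _; rewrite expr1n mulr1 exprn_ge0//.
- rewrite horner_coef; apply: sumr_ge0 => i _; rewrite expr1n mulr1; exact: geomPs_ge0.
rewrite (le_trans _ (expR_ge1Dx _))// horner_poly.
under eq_bigr => i _ do rewrite expr1n mulr1.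
move: (p%:R^-1) p2 => a /andP[a0 a2].
have a1 : 0 < 1 - a by lra.
rewrite -(ler_pM2l a1); apply: (@le_trans _ _ 1); last by nra.
have -> : (1 - a) * \sum_(i < r) a ^+ i = 1 - a ^+ r.
  by rewrite -opprB mulNr -subrX1 opprB.
by rewrite lerBlDr lerDl exprn_ge0// ltW.
Qed.

Lemma had_bound f P B t : (forall n, nc (f n) <= B) -> nc t <= 1 ->
  nc (had f (geomPs P)).[t] <= B * (geomPs P).[1].
Proof.
move=> fB t1; rewrite horner_poly horner_coef mulr_sumr (le_trans (nc_sum _ _ _))//.
apply: ler_sum => k _; rewrite !ncM ncX ncRC ger0_norm ?geomPs_ge0// expr1n mulr1 mulrC mulrCA.
rewrite [leRHS]mulrC; apply: ler_wpM2l; first exact: geomPs_ge0.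
rewrite -[leRHS]mul1r; apply: ler_pM; rewrite ?exprn_ge0 ?nc_ge0//.
by rewrite exprn_ile1 ?nc_ge0.
Qed.

(** [X] collects primes whose variables are already fixed; zero-freeness and divergence then refer
    to the remaining primes of the class. *)
Definition class_list (X P : seq nat) :=
  [/\ uniq P, all prime P, forall p, p \in P -> p = h %[mod N] & {in P, forall p, p \notin X}].

Definition zero_free (X : seq nat) f := forall ps, admissible ps ->
  class_list X (unzip1 ps) -> Eeval ps f != 0.

Definition class_divergent (X : seq nat) := forall B : R, exists P, class_list X P /\
  B < \sum_(p <- P) p%:R^-1.

Definition real_valued f := forall n, f n \is Num.real.

(* Along the class of [h] the Bohr lift is a zero-free function of exponential type,
   so its logarithm has no quadratic term. *)
Lemma zero_free_sqr X f : periodicN f -> real_valued f -> zero_free X f ->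
  class_divergent X -> f 1%N * f (h ^ 2)%N = f h ^+ 2.
Proof.
move=> pf rf zf div.
have a0 : f 1%N != 0 by apply: (zf [::]).
have /complex_realP[x0 f0E] := rf 1%N.
have /complex_realP[x1 f1E] := rf h.
have /complex_realP[x2 f2E] := rf (h ^ 2)%N.
have x0n : x0 != 0 by move: a0; rewrite f0E; apply: contra => /eqP ->.
have [B fB] := periodic_bounded N0 pf.
have B_gt0 : 0 < B by apply: lt_le_trans (fB 1%N); rewrite nc_gt0.
pose L := ln (B / `|x0|); pose d := (x1 / x0) ^+ 2 - x2 / x0.
(* By [geomPs_coef], q_1 = W x1 and 2 q_2 = (W^2 + V) x2, with V <= W the sum of the 1/p^2. So W^2 d
   is estimated by [Re_coef_le_ln], up to V x2 / x0; the maximum B exp (2W) has a logarithm linear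
   in W. *)
have key P : class_list X P -> let W := \sum_(p <- P) p%:R^-1 in 0 <= W ->
    W ^+ 2 * `|d| <= (32 + `|x2 / x0|) * W + 16 * L.
  move=> [uP aP hP XP] W W0; pose q := had f (geomPs P).
  have [g0 g1 g2] := geomPs_coef P.
  have q0 : q`_0 = RC x0 by rewrite coef_had g0 RC1 mul1r expn0 f0E.
  have q1 : q`_1 = RC (W * x1) by rewrite coef_had g1 expn1 f1E RCM.
  have q2 : q`_2 = RC ((geomPs P)`_2 * x2) by rewrite coef_had f2E RCM.
  pose M := B * expR (2 * W).
  have := @Re_coef_le_ln _ q M.
  rewrite q0 q1 q2 ncRC => /(_ _ _ _).
  have -> : (RC (W * x1) / RC x0) ^+ 2 - 2 * (RC ((geomPs P)`_2 * x2) / RC x0) =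
    RC ((W * x1 / x0) ^+ 2 - 2 * ((geomPs P)`_2 * x2 / x0)).
    by rewrite RCB RCX !RCM !RCV RC_nat.
  have -> : complex.Re (RC ((W * x1 / x0) ^+ 2 - 2 * ((geomPs P)`_2 * x2 / x0))) =
    W ^+ 2 * d - (\sum_(p <- P) p%:R^-1 ^+ 2) * (x2 / x0).
    rewrite /RC/= mulrA [2 * (_ * _)]mulrA g2 -/W /d; by field.
  have -> : 16 * ln (M / `|x0|) = 32 * W + 16 * L.
    rewrite /M /L mulrAC mulrC lnM ?posrE ?expR_gt0 ?divr_gt0 ?normr_gt0// expRK; ring.
  move=> /(_ _ _ _) H.
  have {}H : `|W ^+ 2 * d - (\sum_(p <- P) p%:R^-1 ^+ 2) * (x2 / x0)| <= 32 * W + 16 * L.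
    apply: H.
    - by apply: contra x0n => /eqP[->].
    - move=> t t1; have := Eeval_class pf t1 aP hP; rewrite -/q => <-.
      rewrite mulf_neq0//; last first.
        rewrite prodf_seq_neq0; apply/allP => p pP; apply: one_subX_neq0 (ltn_trans _ r3) => //.
        by apply: nc_div_prime_lt1 => //; exact: (allP aP).
      have uz : unzip1 [seq (p, t) | p <- P] = P by rewrite /unzip1 -map_comp map_id.
      apply: zf; rewrite /admissible uz ?uP ?all_map//=; apply/andP; split; apply/allP => p pP //=.
      exact: (allP aP).
    - move=> t t1; rewrite (le_trans (had_bound _ fB t1))//.
      by apply: ler_wpM2l; [exact: ltW|exact: geomPs1_le].
  have W2 : 0 <= \sum_(p <- P) (p%:R^-1 : R) ^+ 2 <= W.
    rewrite sumr_ge0/=; last by move=> p _; exact: sqr_ge0.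
    rewrite /W big_seq [leRHS]big_seq; apply: ler_sum => p /(allP aP) pp.
    by rewrite expr2 ler_piMr ?invr_ge0// invf_le1 ?ltr0n ?ler1n prime_gt0.
  move: W2; move: (\sum_(p <- P) _ ^+ 2) H => V H /andP[V0 VW].
  have : `|W ^+ 2 * d| <= `|W ^+ 2 * d - V * (x2 / x0)| + `|V * (x2 / x0)|.
    by rewrite -{1}(subrK (V * (x2 / x0)) (W ^+ 2 * d)) ler_normD.
  rewrite [in leLHS]normrM (ger0_norm (sqr_ge0 W)) [X in _ <= _ + X]normrM (ger0_norm V0) => h1.
  have : V * `|x2 / x0| <= W * `|x2 / x0| by rewrite ler_wpM2r.
  rewrite mulrDl; lra.
have d0 : d = 0.
  apply/eqP; rewrite -normr_le0 leNgt; apply/negP => dp.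
  pose K := (32 + `|x2 / x0| + 16 * `|L|) / `|d| + 1.
  have [P [cP WP]] := div K; set W := \sum_(p <- P) _ in WP.
  have K1 : 1 <= K by rewrite /K lerDr divr_ge0 ?addr_ge0 ?mulr_ge0.
  have W1 : 1 < W by exact: le_lt_trans WP.
  have := key P cP (ltW (lt_trans ltr01 W1)); rewrite -/W; apply/negP; rewrite -ltNge.
  have : W * (32 + `|x2 / x0| + 16 * `|L|) < W * (W * `|d|).
    rewrite ltr_pM2l ?(lt_trans ltr01)//.
    rewrite -ltr_pdivrMr// (lt_trans _ WP)// /K ltrDl//.
  rewrite mulrA -expr2; apply: le_lt_trans.
  have := ler_norm L; have := normr_ge0 L; move: (32 + _) => A; nra.
rewrite f0E f1E f2E; rewrite -[RHS]RCX -[LHS]RCM; congr (RC _).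
move/eqP: d0; rewrite /d subr_eq0 => /eqP e.
have -> : x2 = x2 / x0 * x0 by rewrite divfK.
by rewrite -e; field.
Qed.

Lemma periodic_class f p n : periodicN f -> p = h %[mod N] -> f (p * n)%N = f (h * n)%N.
Proof. by move=> pf ph; rewrite -pf -modnMml ph modnMml pf. Qed.

(** [Veval_rel] bounds a value by B plus half of another value; iterating from any crude bound for
    the periodic [Veval] leaves 2B in the limit. *)
Lemma Veval_bound p u f B n : prime p -> nc u <= 2^-1 -> periodicN f ->
  (forall n, nc (f n) <= B) -> nc (Veval p u f n) <= 2 * B.
Proof.
move=> pp u2 pf fB.
have u1 : nc u < 1 by rewrite (le_lt_trans u2)// invf_lt1 ?ltr1n.
have [G gG] := periodic_bounded N0 (Veval_periodic p u pf).
have B0 : 0 <= B := le_trans (nc_ge0 _) (fB n).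
have step j m : nc (Veval p u f m) <= 2 * B + 2^-1 ^+ j * G.
  elim: j m => [|j IH] m; first by rewrite expr0 mul1r (le_trans (gG m))// lerDr mulr_ge0.
  have := Veval_rel N0 m pp u1 pf => /(canRL (subrK _)) ->.
  rewrite (le_trans (ncD _ _))// ncM.
  have : nc u * nc (Veval p u f (p * m)%N) <= 2^-1 * (2 * B + 2^-1 ^+ j * G).
    by apply: ler_pM; rewrite ?nc_ge0.
  rewrite exprS; have := fB m; lra.
apply/ler_addgt0Pr => e e0.
have G0 : 0 <= G := le_trans (nc_ge0 _) (gG n).
have G1 : 0 < G + 1 by rewrite ltr_wpDl.
have [j [_ hj]] := exprz_half_lt (divr_gt0 e0 G1).
rewrite (le_trans (step j n))// lerD2l; move: hj; rewrite ltr_pdivlMr// => /ltW.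
apply: le_trans; rewrite ler_wpM2l ?exprn_ge0 ?invr_ge0// lerDl//.
Qed.

Lemma Veval_real p u f : u \is Num.real -> real_valued f -> real_valued (Veval p u f).
Proof.
move=> ur rf n; rewrite /Veval rpredD ?rpredM ?rpredV ?rpredB ?rpred1 ?rpredX//;
  by apply: rpred_sum => i _; rewrite rpredM ?rpredX.
Qed.

Lemma zero_free_Veval X f p z : prime p -> p = h %[mod N] -> p \notin X -> nc z < 1 ->
  zero_free X f -> zero_free (p :: X) (Veval p (z / p%:R) f).
Proof.
move=> pp ph pX z1 zf ps ad [u aP hP XP].
have pps : p \notin unzip1 ps by apply/negP => /XP; rewrite mem_head.
apply: (zf ((p, z) :: ps)).
  by move: ad; rewrite /admissible /= pps pp z1.
split => /=; [by rewrite pps u|by rewrite pp aP| |].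
- by move=> q; rewrite inE => /orP[/eqP ->//|/hP].
- by move=> q; rewrite inE => /orP[/eqP ->//|/XP]; rewrite inE negb_or => /andP[].
Qed.

Lemma class_divergent_cons X p : class_divergent X -> class_divergent (p :: X).
Proof.
move=> div B; have [P [[uP aP hP XP] BP]] := div (B + p%:R^-1); exists (rem p P); split.
  have sub q : q \in rem p P -> q \in P by exact: mem_rem.
  split; first exact: rem_uniq.
  - by apply/allP => q /sub; exact: (allP aP).
  - by move=> q /sub; exact: hP.
  - by move=> q qr; rewrite inE negb_or (XP q (sub _ qr)) andbT; move: qr; rewrite mem_rem_uniq// inE => /andP[].
have [pP|pP] := boolP (p \in P); last by rewrite rem_id// (le_lt_trans _ BP)// lerDl invr_ge0.
by move: BP; rewrite (perm_big _ (perm_to_rem pP))/= big_cons [ltRHS]addrC ltrD2r.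
Qed.

(** Fix a prime p of the class and let its variable z be real. Applying [zero_free_sqr] to the
    function [g z] of the remaining primes gives [d z 1 = 0] for all z in (0,1). Since d(z,j) = e(j)
    + (z/p) d(z,j+1) with d bounded, letting z tend to 0 extracts the coefficients: e(j) = 0, then
    d(z,j+1) = 0, and so on. *)
Lemma zero_free_geometric X f k : periodicN f -> real_valued f -> zero_free X f ->
  class_divergent X -> f 1%N * f (h ^ k.+1)%N = f h * f (h ^ k)%N.
Proof.
move=> pf rf zf div.
have [P0 [[_ aP0 hP0 XP0] P0gt]] := div 0.
case: P0 aP0 hP0 XP0 P0gt => [|p P0]; first by rewrite big_nil ltxx.
move=> /= /andP[pp _] hP0 XP0 _.
have ph : p = h %[mod N] by exact: hP0 (mem_head _ _).
have pX : p \notin X by exact: XP0 (mem_head _ _).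
have [B fB] := periodic_bounded N0 pf.
have B0 : 0 <= B := le_trans (nc_ge0 _) (fB 0%N).
pose g (z : R) := Veval p (RC z / p%:R) f.
pose d (z : R) j := f 1%N * g z (h ^ j.+1)%N - f h * g z (h ^ j)%N.
pose e j := f 1%N * f (h ^ j.+1)%N - f h * f (h ^ j)%N.
have p0 : (p%:R : C) != 0 by rewrite -nc_gt0 ncn_natr ltr0n prime_gt0.
have RCz (z : R) : 0 < z < 1 -> nc (RC z) < 1 /\ RC z / p%:R != 0.
  move=> /andP[z0 z1]; rewrite ncRC gtr0_norm//; split => //.
  by rewrite mulf_neq0 ?invr_eq0// -nc_gt0 ncRC normr_gt0 gt_eqF.
have grel (z : R) j : 0 < z < 1 -> g z (h ^ j)%N = f (h ^ j)%N + RC z / p%:R * g z (h ^ j.+1)%N.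
  move=> /RCz[z1 _]; have := Veval_rel N0 (h ^ j) pp (nc_div_prime_lt1 pp z1) pf.
  have := periodic_class (h ^ j) (Veval_periodic p (RC z / p%:R) pf) ph.
  by rewrite -expnS => ->; move=> /(canRL (subrK _)).
have de (z : R) j : 0 < z < 1 -> d z j = e j + RC z / p%:R * d z j.+1.
  by move=> z01; rewrite /d (grel z j)// (grel z j.+1)// /e; ring.
have gB (z : R) n : 0 < z < 1 -> nc (g z n) <= 2 * B.
  move=> z01; have [z1 _] := RCz z z01; apply: Veval_bound => //.
  rewrite ncM ncV ncn_natr -[leRHS]mul1r; apply: ler_pM; rewrite ?nc_ge0 ?invr_ge0//; first exact: ltW.
  by rewrite lef_pV2 ?posrE ?ltr0n ?prime_gt0// ler_nat prime_gt1.
have d1 (z : R) : 0 < z < 1 -> d z 1%N = 0.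
  move=> z01; have [z1 z2] := RCz z z01.
  have pg : periodicN (g z) by exact: Veval_periodic.
  have rg : real_valued (g z).
    by apply: Veval_real => //; rewrite rpredM ?rpredV ?rpred_nat//; apply/complex_realP; exists z.
  have := zero_free_sqr pg rg (zero_free_Veval pp ph pX z1 zf) (class_divergent_cons p div).
  have := grel z 0%N z01; have := grel z 1%N z01; rewrite /d expn0 !expn1 => -> ->.
  set w := RC z / p%:R; set a := g z (h ^ 2)%N; set b := f 1%N; set c := f h.
  move=> E; have : (b + w * (c + w * a)) * a - (c + w * a) ^+ 2 = 0 by rewrite E subrr.
  by move=> <-; ring.
have bnd j (z : R) : 0 < z < 1 -> nc (d z j) <= 4 * B ^+ 2.
  move=> z01; rewrite /d (le_trans (ncB _ _))// !ncM.
  have -> : 4 * B ^+ 2 = B * (2 * B) + B * (2 * B) by ring.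
  by apply: lerD; apply: ler_pM; rewrite ?nc_ge0 ?gB.
have dj j : forall z : R, 0 < z < 1 -> d z j.+1 = 0.
  elim: j => [//|j IH] z z01.
  have ej : e j.+1 = 0.
    apply/eqP; rewrite -nc_eq0; apply/eqP/le_anti; rewrite nc_ge0 andbT.
    apply/ler_addgt0Pr => eps eps0; rewrite add0r.
    pose y : R := Num.min 2^-1 (eps / (4 * B ^+ 2 + 1)).
    have D0 : 0 < 4 * B ^+ 2 + 1 by rewrite ltr_wpDl// mulr_ge0// sqr_ge0.
    have y01 : 0 < y < 1.
      by rewrite /y lt_min gt_min invr_gt0 ltr0n divr_gt0//= invf_lt1 ?ltr1n.
    have := de y j.+1 y01; rewrite (IH y y01) => /esym/eqP; rewrite addr_eq0 => /eqP ->.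
    rewrite ncN ncM; have [y1 _] := RCz y y01.
    apply: (@le_trans _ _ (y * (4 * B ^+ 2))).
      apply: ler_pM; rewrite ?nc_ge0 ?bnd//.
      rewrite ncM ncV ncn_natr ncRC gtr0_norm; last by case/andP: y01.
      rewrite ler_piMr//; first by case/andP: y01 => /ltW.
      by rewrite invf_le1 ?ltr0n ?ler1n prime_gt0.
    have : y <= eps / (4 * B ^+ 2 + 1) by rewrite /y ge_min lexx orbT.
    rewrite ler_pdivlMr//; apply: le_trans; rewrite ler_wpM2l//; first by case/andP: y01 => /ltW.
    by rewrite lerDl.
  have := de z j.+1 z01; rewrite (IH z z01) ej add0r => /esym/eqP.
  by rewrite mulf_eq0 (negbTE (RCz z z01).2) => /eqP.
have h01 : 0 < (2^-1 : R) < 1 by rewrite invr_gt0 ltr0n invf_lt1 ?ltr1n.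
case: k => [|k]; first by rewrite expn1 expn0 mulrC.
apply/eqP; rewrite -subr_eq0; apply/eqP; have := de 2^-1 k.+1 h01.
by rewrite !dj// mulr0 addr0.
Qed.

(** The ratio q = f(h) / f(1) is real, and Euler's theorem applied to the geometric sequence f(h^k)
    gives q^r = 1. *)
Lemma zero_free_sign X f : periodicN f -> real_valued f -> zero_free X f ->
  class_divergent X -> f h = f 1%N \/ f h = - f 1%N.
Proof.
move=> pf rf zf div.
have a0 : f 1%N != 0 by apply: (zf [::]).
pose q := f h / f 1%N.
have geo k : f (h ^ k)%N = q ^+ k * f 1%N.
  elim: k => [|k IH]; first by rewrite expn0 expr0 mul1r.
  apply: (mulfI a0); rewrite (zero_free_geometric k pf rf zf div) IH /q exprS; field.
  exact: a0.
have qr : q ^+ r = 1.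
  apply: (mulIf a0); rewrite mul1r -geo -[LHS]pf -[RHS]pf; congr f.
  exact: Euler_exp_totient.
have /complex_realP[x qx] : q \is Num.real by rewrite rpredM ?rpredV.
have x1 : `|x| = 1.
  apply/eqP; rewrite -(@pexpr_eq1 _ _ r) ?(ltn_trans _ r3)//.
  by rewrite -ncRC -ncX -[RC x]qx qr nc1.
have qE : f h = q * f 1%N by rewrite divfK.
rewrite qE qx; move: x1 => /eqP; rewrite eqr_norml ler01 andbT => /orP[] /eqP ->.
  by left; rewrite mul1r.
by right; rewrite [_%:C%C](RCN 1) mulN1r.
Qed.

End ZeroFree.

(** * Sign relations between the values at h and at 2h *)

Section SignCharacter.
Variables (R : realType) (N : nat).
Hypotheses (N0 : (0 < N)%N) (r3 : (2 < totient N)%N).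
Local Notation C := R[i].

(** Fix the variable of 2 at a small y > 0. The sign relation also holds for [V y], and by
    continuity with the sign s of f itself. Subtracting f(h) = s f(1) and dividing by y/2 leaves
    V_y(2h) = s V_y(2); then y tends to 0. *)
Lemma zero_free_sign2 (f : nat -> C) h : coprime h N -> periodicN N f -> real_valued f ->
  (forall ps, admissible ps -> Eeval N ps f != 0) -> class_divergent R N h [::] ->
  exists2 s : C, s = 1 \/ s = -1 & f h = s * f 1%N /\ f (2 * h)%N = s * f 2%N.
Proof.
move=> ch pf rf nz div.
have a0 : f 1%N != 0 by apply: (nz [::]).
have zf0 : zero_free N h [::] f by move=> ps ad _; exact: nz.
have [s sE sf] : exists2 s : C, s = 1 \/ s = -1 & f h = s * f 1%N.
  by case: (zero_free_sign N0 ch r3 pf rf zf0 div) => e; [exists 1|exists (-1)];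
    rewrite ?mul1r ?mulN1r; auto.
exists s => //; split => //.
have [B fB] := periodic_bounded N0 pf.
have B_gt0 : 0 < B by apply: lt_le_trans (fB 1%N); rewrite nc_gt0.
pose V (y : R) := Veval N 2 (RC y / 2%:R) f.
have s1 : nc s = 1 by case: sE => ->; rewrite ?ncN nc1.
have y1 (y : R) : 0 < y < 1 -> nc (RC y) < 1 by move=> /andP[? ?]; rewrite ncRC gtr0_norm.
have Vrel (y : R) n : 0 < y < 1 -> V y n = f n + RC y / 2%:R * V y (2 * n)%N.
  move=> /y1 yl; have := Veval_rel N0 n (isT : prime 2) (nc_div_prime_lt1 (isT : prime 2) yl) pf.
  by move=> /(canRL (subrK _)).
have uy (y : R) : 0 < y < 1 -> nc (RC y / 2%:R) <= y / 2 /\ RC y / 2%:R != 0.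
  move=> /andP[y0 _]; rewrite ncM ncV ncn_natr ncRC gtr0_norm//; split => //.
  by rewrite -nc_gt0 ncM ncV ncn_natr ncRC gtr0_norm// divr_gt0.
have VB (y : R) n : 0 < y < 1 -> nc (V y n) <= 2 * B.
  move=> y01; apply: Veval_bound => //; have [h1 _] := uy y y01.
  by rewrite (le_trans h1)// ler_pdivrMr// mulVf// ltW//; case/andP: y01.
have Vsign (y : R) : 0 < y < 1 -> V y h = V y 1%N \/ V y h = - V y 1%N.
  move=> y01; apply: (@zero_free_sign _ _ N0 _ ch r3 [:: 2%N]).
  - exact: Veval_periodic.
  - by apply: Veval_real => //; rewrite rpredM ?rpredV ?rpred_nat//; apply/complex_realP; exists y.
  - move=> ps ad [u aP hP XP]; apply: (nz ((2%N, RC y) :: ps)).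
    have n2 : 2%N \notin unzip1 ps by apply/negP => h2; have := XP _ h2; rewrite inE eqxx.
    by case/and3P: ad => u1 u2 u3; rewrite /admissible /= n2 u1 u2 u3 (y1 y y01).
  - exact: class_divergent_cons.
(* Below y0 the opposite sign would give 2 |f(1)| <= 2 B y, whereas 2 B y < |f(1)|. *)
pose y0 := Num.min 2^-1 (nc (f 1%N) / (2 * B)).
have a1 : 0 < nc (f 1%N) by rewrite nc_gt0.
have y0_gt0 : 0 < y0 by rewrite /y0 lt_min invr_gt0 ltr0n divr_gt0// mulr_gt0.
have y0_lt1 : y0 < 1 by rewrite /y0 gt_min invf_lt1 ?ltr1n.
have Vs (y : R) : 0 < y < y0 -> V y h = s * V y 1%N.
  move=> /andP[yp yy]; have y01 : 0 < y < 1 by rewrite yp (lt_trans yy).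
  have [u1 _] := uy y y01.
  suff ne : V y h <> - s * V y 1%N.
    by case: (Vsign y y01) => e; case: sE ne => ->; rewrite ?opprK ?mul1r ?mulN1r.
  rewrite (Vrel y h)// (Vrel y 1%N)// sf => e.
  have : 2%:R * (s * f 1%N) = - (RC y / 2%:R * (V y (2 * h)%N + s * V y (2 * 1)%N)).
    have -> : 2%:R * (s * f 1%N) = s * f 1%N + RC y / 2%:R * V y (2 * h)%N + s * f 1%N - RC y / 2%:R * V y (2 * h)%N by ring.
    by rewrite e; ring.
  move=> /(congr1 (@nc R)); rewrite ncN !ncM s1 mul1r ncn_natr -ncM => E.
  have : 2 * nc (f 1%N) <= y / 2 * (4 * B).
    rewrite E; apply: ler_pM; rewrite ?nc_ge0//.
    rewrite (le_trans (ncD _ _))// ncM s1 mul1r.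
    by have := VB y (2 * 1)%N y01; have := VB y (2 * h)%N y01; lra.
  have : y < nc (f 1%N) / (2 * B) by rewrite (lt_le_trans yy)// /y0 ge_min lexx orbT.
  rewrite ltr_pdivlMr ?mulr_gt0//; lra.
have V2 (y : R) : 0 < y < y0 -> V y (2 * h)%N = s * V y 2%N.
  move=> yy; have y01 : 0 < y < 1 by case/andP: yy => -> h1; rewrite (lt_trans h1).
  have := Vs y yy; rewrite (Vrel y h)// (Vrel y 1%N)// sf => e.
  apply: (mulfI (uy y y01).2); apply: (addrI (s * f 1%N)); rewrite e; ring.
apply/eqP; rewrite -subr_eq0 -nc_eq0; apply/eqP/le_anti; rewrite nc_ge0 andbT.
apply/ler_addgt0Pr => eps e0; rewrite add0r.
pose y := Num.min (y0 / 2) (eps / (2 * B)).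
have y_gt0 : 0 < y by rewrite /y lt_min !divr_gt0// mulr_gt0.
have yy : 0 < y < y0 by rewrite y_gt0 /y gt_min ltr_pdivrMr// mulr_natr mulr2n ltrDl y0_gt0.
have y01 : 0 < y < 1 by case/andP: yy => -> h1; rewrite (lt_trans h1).
have := V2 y yy; rewrite (Vrel y (2 * h)%N)// (Vrel y 2%N)// => e.
have -> : f (2 * h)%N - s * f 2%N = RC y / 2%:R * (s * V y (2 * 2)%N - V y (2 * (2 * h))%N).
  have -> : f (2 * h)%N = s * (f 2%N + RC y / 2%:R * V y (2 * 2)%N) - RC y / 2%:R * V y (2 * (2 * h))%N.
    by rewrite -e addrK.
  ring.
rewrite ncM; have [u1 _] := uy y y01.
apply: (@le_trans _ _ (y / 2 * (4 * B))).
  apply: ler_pM; rewrite ?nc_ge0//.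
  rewrite (le_trans (ncB _ _))// ncM s1 mul1r.
  by have := VB y (2 * 2)%N y01; have := VB y (2 * (2 * h))%N y01; lra.
have : y <= eps / (2 * B) by rewrite /y ge_min lexx orbT.
rewrite ler_pdivlMr ?mulr_gt0//; lra.
Qed.

Theorem inC_sign (a b : R) h : 0 <= a -> a < b -> b <= 1 ->
  periodicN N (fun n => RC (cf a b n)) -> inC (chi a b) -> coprime h N ->
  class_divergent R N h [::] ->
  exists2 s : R, s = 1 \/ s = -1 & cf a b h = s * cf a b 1 /\ cf a b (2 * h) = s * cf a b 2.
Proof.
move=> a0 ab b1 pf cyc ch div.
have rf : real_valued (fun n => RC (cf a b n)).
  by move=> n; apply/complex_realP; exists (cf a b n).
have nz ps : admissible ps -> Eeval N ps (fun n => RC (cf a b n)) != 0.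
  move=> ad; apply/eqP => E; exact: (not_inC_of_zero N0 a0 ab b1 pf ad E).
have [s sE [s1 s2]] := zero_free_sign2 ch pf rf nz div.
case: sE s1 s2 => ->; [exists 1; first by left|exists (-1); first by right].
  by move: s1 s2; rewrite !mul1r => /(@complexI R) -> /(@complexI R) ->.
by move: s1 s2; rewrite !mulN1r -!RCN => /(@complexI R) -> /(@complexI R) ->.
Qed.

End SignCharacter.

(** * Galois conjugates and the fourteen intervals *)

Section Classification.
Variable R : realType.
Implicit Types x y : R.

Lemma cos_rec n x : cos (n.+2%:R * x) = 2 * cos x * cos (n.+1%:R * x) - cos (n%:R * x).
Proof.
have -> : n.+2%:R * x = n.+1%:R * x + x by rewrite -[n.+2]addn1 natrD mulrDl mul1r.
have -> : n%:R * x = n.+1%:R * x - x by rewrite -[n.+1]addn1 natrD mulrDl mul1r addrK.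
by rewrite cosB cosD; ring.
Qed.

Lemma cos_mul_eq n x y : cos x = cos y -> cos (n%:R * x) = cos (n%:R * y).
Proof.
move=> xy; elim/ltn_ind: n => -[|[|n]] IH; first by rewrite !mul0r.
  by rewrite !mul1r.
by rewrite !cos_rec xy !IH.
Qed.

Definition same_cos (a b : R) g :=
  (cos (g%:R * pi * a) = cos (pi * a) /\ cos (g%:R * pi * b) = cos (pi * b)) \/
  (cos (g%:R * pi * a) = cos (pi * b) /\ cos (g%:R * pi * b) = cos (pi * a)).

(** Multiplication by m permutes the two cosines, and cos (n x) depends only on n and cos x. This is
    the closure property that [weak_dirichlet] asks for. *)
Lemma same_cosM a b m n : same_cos a b m -> same_cos a b (m * n) <-> same_cos a b n.
Proof.
have E x : (m * n)%:R * pi * x = n%:R * (m%:R * pi * x) by rewrite natrM; ring.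
have E' x : n%:R * (pi * x) = n%:R * pi * x by ring.
rewrite /same_cos !E => -[] [/(@cos_mul_eq n)-> /(@cos_mul_eq n)->]; rewrite !E' //.
by split=> -[] [-> ->]; auto.
Qed.

(** The first relation gives the difference of the two cosines up to s. Dividing the second, a
    difference of squares, by it gives their sum, free of s; then s decides whether they are fixed
    or exchanged. *)
Lemma same_cos_of_sign a b h (s : R) : cf a b 1 != 0 -> s = 1 \/ s = -1 ->
  cf a b h = s * cf a b 1 -> cf a b (2 * h) = s * cf a b 2 -> same_cos a b h.
Proof.
have c2 n x : cos ((2 * n)%:R * pi * x) = 2 * cos (n%:R * pi * x) ^+ 2 - 1 :> R.
  have -> : (2 * n)%:R * pi * x = (n%:R * pi * x) *+ 2 by rewrite natrM mulr2n; ring.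
  by rewrite cos_mulr2n mulr2n; ring.
have c21 x : cos (2 * pi * x) = 2 * cos (1 * pi * x) ^+ 2 - 1 :> R.
  by have := c2 1%N x; rewrite muln1.
rewrite /cf /same_cos !c2 !c21 !mul1r.
move: (cos (h%:R * pi * a)) (cos (h%:R * pi * b)) (cos (pi * a)) (cos (pi * b)) => x1 x2 x3 x4.
move=> d0 sE h1 h2.
have e : (x3 - x4) * (x1 + x2) = (x3 - x4) * (s * s * (x3 + x4)).
  have ss : s * s = 1 by case: sE => ->; rewrite ?mulr1// mulrNN mulr1.
  have h2' : (x1 - x2) * (x1 + x2) = s * ((x3 - x4) * (x3 + x4)) by lra.
  rewrite h1 in h2'; have s0 : s != 0 by case: sE => ->; rewrite ?oppr_eq0 oner_eq0.
  rewrite ss mul1r; apply: (mulfI s0); rewrite -h2'; ring.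
move/(mulfI d0): e; case: sE h1 => -> h1 e; [left|right]; split; lra.
Qed.

Lemma cos_periodic (N A n m : nat) : (0 < N)%N -> n = m %[mod N] ->
  cos (n%:R * pi * (2 * A%:R / N%:R)) = cos (m%:R * pi * (2 * A%:R / N%:R)) :> R.
Proof.
move=> N0; have Nn : N%:R != 0 :> R by rewrite pnatr_eq0 -lt0n.
have aux k : cos (k%:R * pi * (2 * A%:R / N%:R)) = cos ((k %% N)%:R * pi * (2 * A%:R / N%:R)) :> R.
  rewrite {1}(divn_eq k N).
  have -> : (k %/ N * N + k %% N)%:R * pi * (2 * A%:R / N%:R) =
    (k %/ N * A).*2%:R * pi + (k %% N)%:R * pi * (2 * A%:R / N%:R) :> R.
    by rewrite -mul2n !natrD !natrM; field.
  by rewrite cos_natpiD -signr_odd odd_double expr0 mul1r.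
by move=> nm; rewrite aux nm -aux.
Qed.

(** Bad primes are sorted by residue modulo [N]. In a class with divergent sum the sign relations
    would make every prime good, so each of the N classes of bad primes has bounded sum. *)
Lemma all_same_cos (A B N : nat) : (0 < N)%N -> (2 < totient N)%N ->
  let a : R := 2 * A%:R / N%:R in let b : R := 2 * B%:R / N%:R in
  0 <= a -> a < b -> b <= 1 -> inC (chi a b) -> forall g, coprime g N -> same_cos a b g.
Proof.
move=> N0 r3 a b a0 ab b1 cyc g cg.
have b0 : 0 <= b by exact: le_trans (ltW ab).
have pf : periodicN N (fun n => RC (cf a b n)).
  by move=> n; rewrite /cf (@cos_periodic N A (n %% N) n)// ?modn_mod// (@cos_periodic N B (n %% N) n)// modn_mod.
have cf1 : cf a b 1 != 0.
  rewrite /cf !mul1r subr_eq0; apply/eqP => /cos_inj e.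
  have : pi * a = pi * b.
    apply: e; rewrite in_itv/= mulr_ge0 ?pi_ge0//= -[leRHS]mulr1 ler_wpM2l ?pi_ge0//.
    exact: le_trans (ltW ab) b1.
  by move=> /(mulfI (lt0r_neq0 (pi_gt0 R))) e'; rewrite e' ltxx in ab.
pose G0 n := `[< same_cos a b n >].
have div_same h : coprime h N -> class_divergent R N h [::] -> same_cos a b h.
  move=> ch div; have [s sE [s1 s2]] := inC_sign N0 r3 a0 ab b1 pf cyc ch div.
  exact: same_cos_of_sign cf1 sE s1 s2.
have samemod n : same_cos a b (n %% N) <-> same_cos a b n.
  by rewrite /same_cos (@cos_periodic N A (n %% N) n)// ?modn_mod// (@cos_periodic N B (n %% N) n)// modn_mod.
pose bad p := [&& prime p, coprime p N & ~~ G0 p].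
have bound c : exists2 K : R, 0 <= K & forall x : nat, \sum_(0 <= p < x | bad p && (p %% N == c)%N) p%:R^-1 <= K.
  have [[p0 [bp0 pc0]]|nex] := pselect (exists p, bad p /\ (p %% N = c)%N); last first.
    exists 0 => // x; rewrite big1// => p /andP[bp /eqP pc]; exfalso; apply: nex; by exists p.
  case/and3P: bp0 => pp0 cp0 /asboolPn nK.
  have [//|ndiv] := pselect (class_divergent R N p0 [::]); first by move=> /(div_same _ cp0).
  have [K HK] : exists K, forall P, class_list N p0 [::] P -> \sum_(p <- P) (p%:R^-1 : R) <= K.
    apply: contrapT => h; apply: ndiv => K; apply: contrapT => h2; apply: h; exists K => P cP.
    by rewrite leNgt; apply/negP => h3; apply: h2; exists P.
  exists (Num.max 0 K); first by rewrite le_max lexx.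
  move=> x; rewrite -big_filter le_max; apply/orP; right; apply: HK; split.
  - by rewrite filter_uniq// iota_uniq.
  - by apply/allP => p; rewrite mem_filter => /andP[/andP[/and3P[]]].
  - by move=> p; rewrite mem_filter => /andP[/andP[_ /eqP ->]]; rewrite pc0.
  - by [].
pose K c := sval (cid2 (bound c)).
have K0 c : 0 <= K c by rewrite /K; case: cid2.
have KP c (x : nat) : \sum_(0 <= p < x | bad p && (p %% N == c)%N) p%:R^-1 <= K c by rewrite /K; case: cid2.
have := @weak_dirichlet R N G0 (\sum_(c < N) K c) N0 _ _ _ _ g cg.
move=> H; apply/asboolP; apply: H.
- by move=> n; apply/asboolP/asboolP => /samemod.
- by apply/asboolP; left; rewrite !mul1r.
- by move=> m n _ _ /asboolP Km; apply/asboolP/asboolP => /(same_cosM _ Km).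
- move=> x; apply: (@le_trans _ _ (\sum_(c < N) \sum_(0 <= p < x | bad p && (p %% N == c)%N) p%:R^-1)); last exact: ler_sum.
  under [leRHS]eq_bigr => c _ do rewrite big_mkcond.
  rewrite exchange_big/= big_mkcond; apply: ler_sum => p _.
  have t0 (c : 'I_N) : 0 <= (if bad p && (p %% N == c)%N then p%:R^-1 else 0 : R) by case: ifP.
  case: ifPn => [bp|_]; last exact: sumr_ge0.
  rewrite (bigD1 (Ordinal (ltn_pmod p N0)))//= eqxx andbT (_ : bad p)// lerDl.
  by apply: sumr_ge0 => c _; case: ifP.
Qed.

End Classification.

(** Chinese remainders: the class of k at the primes of [M], and 1 at the other primes of [N]. The
    shift by [M] makes the representative positive. *)
Lemma lift_unit (M N k : nat) : (0 < N)%N -> (M %| N)%N -> coprime k M ->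
  exists2 g, coprime g N & g = k %[mod M].
Proof.
move=> N0 MN ck0; have M0 := dvdn_gt0 N0 MN.
pose l := (k + M)%N.
have cl : coprime l M by rewrite -coprime_modl modnDr coprime_modl.
have l0 : (0 < l)%N by rewrite addn_gt0 M0 orbT.
pose P := (N`_(\pi(M)))%N; pose Q := (N`_(\pi(M)^'))%N.
have PQ : coprime P Q by exact: coprime_partC.
have NE : (P * Q)%N = N by exact: partnC.
have MP : (M %| P)%N.
  by rewrite -(part_pnat_id (pnat_pi M0)) /P partn_dvd.
exists (chinese P Q l 1); last first.
  by rewrite -(modn_dvdm _ MP) (chinese_modl PQ) modn_dvdm// modnDr.
rewrite -NE coprimeMr; apply/andP; split.
  rewrite -coprime_modl (chinese_modl PQ) coprime_modl coprime_sym.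
  by rewrite (pnat_coprime (part_pnat _ _))// -coprime_pi'// coprime_sym.
by rewrite -coprime_modl (chinese_modr PQ) coprime_modl coprime1n.
Qed.

Lemma lift_unit_mul (M N u k : nat) : (0 < N)%N -> (M %| N)%N -> coprime u M -> coprime k M ->
  exists2 g, coprime g N & (g * u)%N = k %[mod M].
Proof.
move=> N0 MN cu ck; have M0 := dvdn_gt0 N0 MN.
have tM : (0 < totient M)%N by rewrite totient_gt0.
have cku : coprime (k * u ^ (totient M).-1) M by rewrite coprimeMl ck coprimeXl.
have [g cg gE] := lift_unit N0 MN cku.
exists g => //; rewrite -modnMml gE modnMml -mulnA -expnSr prednK//.
by rewrite -modnMmr Euler_exp_totient// modnMmr muln1.
Qed.

(** * Reduction to the denominator 60 and the finite search *)

Section FiniteCheck.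
Variable R : realType.

(** The representative of n or -n modulo M in [0, M/2], a range on which cos (2 pi n / M) is
    injective. *)
Definition fold (M n : nat) := if (2 * (n %% M) <= M)%N then (n %% M)%N else (M - n %% M)%N.

Lemma fold_le M n : (0 < M)%N -> (2 * fold M n <= M)%N.
Proof. by move=> M0; have := ltn_pmod n M0; rewrite /fold; case: ifPn; lia. Qed.

Definition cosM (M n : nat) : R := cos (n%:R * pi * (2 / M%:R)).

Lemma cosM_mod M n m : (0 < M)%N -> n = m %[mod M] -> cosM M n = cosM M m.
Proof.
by move=> M0 nm; have := @cos_periodic R M 1 n m M0 nm; rewrite mulr1.
Qed.

Lemma cosM_fold M n : (0 < M)%N -> cosM M n = cosM M (fold M n).
Proof.
move=> M0; rewrite (@cosM_mod M n (n %% M))// ?modn_mod// /fold; case: ifP => // _.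
have nM : (n %% M <= M)%N by exact/ltnW/ltn_pmod.
have Mn : M%:R != 0 :> R by rewrite pnatr_eq0 -lt0n.
rewrite /cosM natrB//.
have -> : (M%:R - (n %% M)%:R) * pi * (2 / M%:R) = 2%:R * pi + - ((n %% M)%:R * pi * (2 / M%:R)) :> R by field.
by rewrite cos_natpiD cosN expr2 mulrNN mulr1 mul1r.
Qed.

Lemma cosM_inj M i j : (0 < M)%N -> (2 * i <= M)%N -> (2 * j <= M)%N ->
  cosM M i = cosM M j -> i = j.
Proof.
move=> M0 iM jM /cos_inj; have Mp : 0 < M%:R :> R by rewrite ltr0n.
have itv k : (2 * k <= M)%N -> k%:R * pi * (2 / M%:R) \in `[0, (pi : R)].
  move=> kM; rewrite in_itv/= !mulr_ge0 ?pi_ge0 ?invr_ge0//= mulrAC ler_piMl ?pi_ge0//.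
  by rewrite mulrA ler_pdivrMr// mul1r -natrM mulnC ler_nat.
move=> /(_ (itv _ iM) (itv _ jM)) e; apply/eqP; rewrite -(eqr_nat R).
have c0 : pi * (2 / M%:R) != 0 :> R by rewrite !mulf_neq0 ?invr_eq0 ?pnatr_eq0 -?lt0n// gt_eqF// pi_gt0.
by apply/eqP; apply: (mulIf c0); rewrite !mulrA in e *.
Qed.

Lemma cosM_eq M n i : (0 < M)%N -> (2 * i <= M)%N -> cosM M n = cosM M i -> fold M n = i.
Proof. by move=> M0 iM; rewrite cosM_fold// => /(cosM_inj M0 (fold_le n M0) iM). Qed.

(* If [2 A / N] in lowest terms had a denominator not dividing [60], a suitable multiple
   of it would have three Galois conjugates with distinct cosines. *)
Lemma dvdn_mul120 (A N : nat) (b : R) : (0 < N)%N ->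
  (forall g, coprime g N -> let a := 2 * A%:R / N%:R in
     cos (g%:R * pi * a) = cos (pi * a) \/ cos (g%:R * pi * a) = cos (pi * b)) ->
  (N %| 120 * A)%N.
Proof.
move=> N0 H; have [->|A0] := posnP A; first by rewrite muln0 dvdn0.
suff key p : prime p -> (logn p N <= logn p (120 * A))%N.
  by apply/dvdn_partP => // p /[!mem_primes]/and3P[pp _ _]; rewrite p_part pfactor_dvdn ?key// muln_gt0.
move=> pp; rewrite leqNgt; apply/negP; rewrite lognM// => lt.
(* One more than 120 allows, so [M] is 16, 9, 25, or [p] itself for the other primes. *)
pose e := (logn p 120).+1; pose M := (p ^ e)%N.
have M0 : (0 < M)%N by rewrite expn_gt0 prime_gt0.
(* This multiplier reduces the fraction A / N to u / M with u prime to [p]. *)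
pose t := (N`_p^' * p ^ (logn p N - logn p A - e))%N.
pose u := (A`_p^')%N.
have MN : (M %| N)%N by rewrite pfactor_dvdn//; move: lt; rewrite /e; lia.
have atE : (A * t * M)%N = (u * N)%N.
  have pe : (p ^ logn p A * p ^ (logn p N - logn p A - e) * p ^ e)%N = (p ^ logn p N)%N.
    by rewrite -!expnD; congr (p ^ _)%N; move: lt; rewrite /e; lia.
  have := partnC p N0; have := partnC p A0; rewrite !p_part -/u => AE NE.
  by rewrite -[in LHS]AE /t /M -[in RHS]NE -pe; ring.
have cu : coprime u M.
  rewrite coprimeXr// coprime_sym prime_coprime// -p'natE//; exact: part_pnat.
pose X := cos (t%:R * (pi * (2 * A%:R / N%:R))) : R.
pose Y := cos (t%:R * (pi * b)) : R.
have vals k : coprime k M -> cosM M k = X \/ cosM M k = Y.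
  move=> ck; have [g cg gE] := lift_unit_mul N0 MN cu ck.
  have -> : cosM M k = cos (t%:R * (g%:R * pi * (2 * A%:R / N%:R))).
    rewrite -(cosM_mod M0 gE) /cosM; congr cos.
    have Nn : N%:R != 0 :> R by rewrite pnatr_eq0 -lt0n.
    have Mn : M%:R != 0 :> R by rewrite pnatr_eq0 -lt0n.
    have E : A%:R * t%:R * M%:R = u%:R * N%:R :> R by rewrite -!(natrM R) atE.
    rewrite (natrM R g); move: (g%:R : R) (u%:R : R) (t%:R : R) (A%:R : R) (M%:R : R) (N%:R : R) Nn Mn E.
    move=> x y z v m n n0 m0 E.
    rewrite [RHS](_ : _ = x * pi * 2 * (v * z * m) / (n * m)); last by field; rewrite m0 n0.
    by rewrite E; field; rewrite m0 n0.
  case: (H g cg) => /(@cos_mul_eq _ t) ->; [by left|by right].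
have three i j k : [/\ coprime i M, coprime j M & coprime k M] -> [/\ i != j, i != k & j != k] ->
    [/\ (2 * i <= M), (2 * j <= M) & (2 * k <= M)]%N -> False.
  move=> [/vals ci /vals cj /vals ck] [/eqP ij /eqP ik /eqP jk] [iM jM kM].
  case: ci cj ck => [ci|ci] [cj|cj] [ck|ck];
   do ?[by apply: ij; apply: (cosM_inj M0) => //; rewrite ci cj];
   do ?[by apply: ik; apply: (cosM_inj M0) => //; rewrite ci ck];
   by apply: jk; apply: (cosM_inj M0) => //; rewrite cj ck.
have [p2|p2] := eqVneq p 2%N.
  have ME : M = 16%N by rewrite /M /e p2.
  by apply: (@three 1 3 5)%N; rewrite ?ME.
have [p3|p3] := eqVneq p 3%N.
  have ME : M = 9%N by rewrite /M /e p3.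
  by apply: (@three 1 2 4)%N; rewrite ?ME.
have [p5|p5] := eqVneq p 5%N.
  have ME : M = 25%N by rewrite /M /e p5.
  by apply: (@three 1 2 3)%N; rewrite ?ME.
have p7 : (7 <= p)%N.
  have aux q : prime q -> q != 2 -> q != 3 -> q != 5 -> (7 <= q)%N by do 7?[case: q => [//|q]].
  exact: aux.
have ck k : (0 < k < 7)%N -> coprime k M.
  move=> /andP[k0 k7]; rewrite coprimeXr// coprime_sym prime_coprime//; apply/negP => /(dvdn_leq k0).
  by rewrite leqNgt (leq_trans k7).
have pM : (7 <= M)%N by rewrite (leq_trans p7)// /M /e expnS leq_pmulr// expn_gt0 prime_gt0.
apply: (@three 1 2 3)%N; split; rewrite ?ck//; exact: leq_trans pM.
Qed.

End FiniteCheck.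

Definition listed (a b : nat) := ((a, b) \in [:: (0, 60); (0, 30); (30, 60); (0, 40); (20, 40);
   (20, 60); (15, 45); (12, 36); (24, 48); (10, 50)])%N.

Definition exceptional (a b : nat) := ((a, b) \in [:: (0, 20); (40, 60); (20, 30); (30, 40)])%N.

(** The units 7 and 11 modulo 120 already cut the pairs down to the fourteen candidates. *)
Definition same_fold (a b : nat) := all (fun g =>
  ((fold 120 (g * a) == a) && (fold 120 (g * b) == b) ||
   (fold 120 (g * a) == b) && (fold 120 (g * b) == a))) [:: 7; 11]%N.

Lemma same_fold_list : all (fun a => all (fun b => (a < b)%N && same_fold a b ==>
  listed a b || exceptional a b) (iota 0 61)) (iota 0 61).
Proof. by vm_compute. Qed.

(** * Explicit zeros for the four exceptional intervals *)

Section FourZeros.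
Variable R : realType.
Local Notation C := R[i].

(** Chebyshev recursion for 2 cos (n z) with t = 2 cos z; integer values keep the coefficients
    computable. *)
Fixpoint twocos (t : int) (n : nat) : int :=
  if n is (n'.+1 as m).+1 then t * twocos t m - twocos t n' else if n is 1%N then t else 2.

Lemma cos_twocos (z : R) t n : cos z = t%:~R / 2 -> cos (n%:R * z) = (twocos t n)%:~R / 2.
Proof.
move=> zE; elim/ltn_ind: n => -[|[|n]] IH; first by rewrite mul0r cos0 divff// pnatr_eq0.
  by rewrite mul1r.
by rewrite cos_rec !IH// zE [twocos _ _.+2]/(_ - _) intrB intrM; field.
Qed.

(** The equation is [Eeval 12] at the primes 2 and 3 written out. Powers of 2 modulo 12 have
    preperiod 2 and period 2, those of 3 have preperiod 1 and period 2. *)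
Lemma not_inC_exceptional (a b : nat) (s t : int) (z2 z3 : C) : (a < b)%N -> (b <= 6)%N ->
  cos (pi * (a%:R / 6)) = s%:~R / 2 :> R -> cos (pi * (b%:R / 6)) = t%:~R / 2 :> R ->
  nc z2 < 1 -> nc z3 < 1 ->
  (forall v : nat -> C, (forall n, v n = (twocos s (n %% 12) - twocos t (n %% 12))%:~R / 2) ->
    let u := z2 / 2 in let w := z3 / 3 in let g n := v n + u * v (2 * n)%N +
      (1 - u ^+ 2)^-1 * (u ^+ 2 * v (4 * n)%N + u ^+ 3 * v (8 * n)%N) in
    g 1%N + (1 - w ^+ 2)^-1 * (w * g 3%N + w ^+ 2 * g 9%N) = 0) ->
  ~ inC (chi (a%:R / 6 : R) (b%:R / 6)).
Proof.
move=> ab b6 sE tE z2n z3n E0.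
have six : 0 < 6 :> R by [].
have dbl c : c%:R / 6 = 2 * c%:R / 12%:R :> R by field.
have cE n : cf (a%:R / 6) (b%:R / 6) n = (twocos s (n %% 12) - twocos t (n %% 12))%:~R / 2 :> R.
  rewrite /cf !dbl (@cos_periodic R 12 a n (n %% 12))// ?modn_mod//.
  rewrite (@cos_periodic R 12 b n (n %% 12))// ?modn_mod// -!dbl -!mulrA.
  by rewrite !(cos_twocos _ sE) !(cos_twocos _ tE) intrB mulrBl.
apply: (@not_inC_of_zero R 12 isT _ _ [:: (2%N, z2); (3%N, z3)]).
- by rewrite divr_ge0.
- by rewrite ltr_pM2r ?invr_gt0// ltr_nat.
- by rewrite ler_pdivrMr// mul1r ler_nat.
- by move=> n; rewrite !cE modn_mod.
- by rewrite /admissible /= z2n z3n.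
pose v n := RC (cf (a%:R / 6) (b%:R / 6) n : R).
have vE n : v n = (twocos s (n %% 12) - twocos t (n %% 12))%:~R / 2.
  by rewrite /v cE RCM RCV RC_nat; congr (_ / _); exact: (rmorph_int (real_complex R)).
rewrite -[LHS]/(Eeval 12 _ v) /= /Veval.
have l2 : logn 2 12 = 2%N by []; have l3 : logn 3 12 = 1%N by [].

have p2 : (12`_2^')%N = 3%N.
  by have := @partnC 2%N 12%N isT; rewrite p_part l2; move: (12`_2^')%N => x; lia.
have p3 : (12`_3^')%N = 4%N.
  by have := @partnC 3%N 12%N isT; rewrite p_part l3; move: (12`_3^')%N => x; lia.
rewrite l2 l3 p2 p3 -[totient 3]/2%N -[totient 4]/2%N !big_ord_recl !big_ord0 /= /bump /= !addr0 ?add0n ?addn0 ?addn1.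
rewrite !expr0 !mul1r !expr1 -[RHS](E0 v vE) /=.
by rewrite !expnE /= !(muln1, mul1n).
Qed.

Lemma cos_double (z : R) : cos (2%:R * z) = 2 * cos z ^+ 2 - 1.
Proof. by rewrite (cos_rec 0) mul1r mul0r cos0; ring. Qed.

Lemma cos_triple (z : R) : cos (3%:R * z) = 4 * cos z ^+ 3 - 3 * cos z.
Proof. by rewrite (cos_rec 1) cos_double mul1r; ring. Qed.

Lemma cos_pi_third : cos (pi * (2%:R / 6)) = 2^-1 :> R.
Proof.
set z := pi * _; 
have c3 : cos (3%:R * z) = -1.
  have -> : 3%:R * z = pi by rewrite /z; field.
  exact: cospi.
have cp : 0 < cos z.
  by apply: cos_gt0_pihalf; have := pi_gt0 R; rewrite /z => ?; apply/andP; split; lra.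
have : (cos z + 1) * (2 * cos z - 1) ^+ 2 = 0.
  have cE : cos (3%:R * z) = 4 * cos z ^+ 3 - 3 * cos z by exact: cos_triple.
  have -> : (cos z + 1) * (2 * cos z - 1) ^+ 2 = 4 * cos z ^+ 3 - 3 * cos z + 1 by ring.
  by rewrite -cE c3 addNr.
move/eqP; rewrite mulf_eq0 sqrf_eq0 => /orP[/eqP h|/eqP h]; lra.
Qed.

Lemma cos_pi_sixths (k : nat) (t : int) : (k, t) \in [:: (0%N, 2 : int); (2%N, 1); (3%N, 0); (4%N, -1); (6%N, -2)] ->
  cos (pi * (k%:R / 6)) = t%:~R / 2 :> R.
Proof.
rewrite !inE => /or4P[|||/orP[]] /eqP[-> ->].
- by rewrite mul0r mulr0 cos0 divff// pnatr_eq0.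
- by rewrite cos_pi_third; field.
- have -> : pi * (3%:R / 6) = pi / 2 :> R by field.
  by rewrite cos_pihalf mul0r.
- have -> : pi * (4%:R / 6) = (pi * (2%:R / 6)) *+ 2 :> R by rewrite mulr2n; field.
  by rewrite cos_mulr2n cos_pi_third; field.
- by rewrite divff ?pnatr_eq0// mulr1 cospi; field.
Qed.

Lemma nc_lt1 (x : R) : `|x| < 1 -> nc (RC x) < 1. Proof. by rewrite ncRC. Qed.

(** For (2/3,1) the variable of 2 alone gives a zero in the open disc. In the other three cases the
    zeros with z3 = 0 lie on |z2| = 1, so a nonzero z3 is used to move inside. *)
Lemma not_inC_four (a b : nat) : (a, b) \in [:: (0, 2); (4, 6); (2, 3); (3, 4)]%N ->
  ~ inC (chi (a%:R / 6 : R) (b%:R / 6)).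
Proof.
rewrite !inE => /or4P[] /eqP[-> ->].
- apply: (@not_inC_exceptional _ _ 2 1 (RC (- 2^-1)) (RC (- 3^-1))) => //; try exact: cos_pi_sixths;
   try (by apply: nc_lt1; rewrite ltr_norml; apply/andP; split; lra).
  move=> v vE u w g; rewrite /g !vE /u /w => {u w g vE v}.
  by rewrite ?RCN ?RCM ?RCV ?RC0 ?RC_nat /=; field.
- apply: (@not_inC_exceptional _ _ (-1) (-2) (RC (2^-1)) (RC (0))) => //; try exact: cos_pi_sixths;
   try (by apply: nc_lt1; rewrite ltr_norml; apply/andP; split; lra).
  move=> v vE u w g; rewrite /g !vE /u /w => {u w g vE v}.
  by rewrite ?RCN ?RCM ?RCV ?RC0 ?RC_nat /=; field.
- apply: (@not_inC_exceptional _ _ 1 0 (RC (- 2^-1)) (RC (2^-1))) => //; try exact: cos_pi_sixths;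
   try (by apply: nc_lt1; rewrite ltr_norml; apply/andP; split; lra).
  move=> v vE u w g; rewrite /g !vE /u /w => {u w g vE v}.
  by rewrite ?RCN ?RCM ?RCV ?RC0 ?RC_nat /=; field.
- apply: (@not_inC_exceptional _ _ 0 (-1) (RC (2^-1)) (RC (3 / 4))) => //; try exact: cos_pi_sixths;
   try (by apply: nc_lt1; rewrite ltr_norml; apply/andP; split; lra).
  move=> v vE u w g; rewrite /g !vE /u /w => {u w g vE v}.
  by rewrite ?RCN ?RCM ?RCV ?RC0 ?RC_nat /=; field.
Qed.

End FourZeros.

(** * Necessity of the list *)

Section Necessity.
Variable R : realType.

(** Three distinct units: 1, n - 1, and one congruent to 7 modulo 120. The bound ensures that the
    truncated Euler factors reach degree 2. *)
Lemma totient_gt2 n : (0 < n)%N -> (120 %| n)%N -> (2 < totient n)%N.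
Proof.
move=> n0 dn; have [g cg g7] := @lift_unit 120 n 7 n0 dn isT.
have n120 : (120 <= n)%N by exact: dvdn_leq.
rewrite totient_count_coprime big_mkord.
have -> : (\sum_(i < n) coprime n i = #|[pred i : 'I_n | coprime n i]|)%N.
  by rewrite -sum1_card [RHS]big_mkcond; apply: eq_bigr => i _; rewrite inE; case: coprime.
have n1 : (1 < n)%N by exact: leq_trans n120.
have nn : (n.-1 < n)%N by rewrite prednK.
apply/card_gt2P; exists (Ordinal n1), (Ordinal nn), (Ordinal (ltn_pmod g n0)).
rewrite !inE/= coprimen1 coprimenP// coprime_modr coprime_sym cg; split => //.
have gm : (g %% n = 7 %[mod 120])%N by rewrite modn_dvdm.
have n1m : (n.-1 = 119 %[mod 120])%N.
  have [k nE] := dvdnP dn; rewrite nE in n0 *; case: k nE n0 => // k _ _.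
  by rewrite mulSn -[(120 + _)%N]/((119 + k * 120).+1)%N /= addnC modnMDl.
split; apply/eqP => /(congr1 val)/= E.
- by move: n1m; rewrite -E.
- by move: gm; rewrite -E n1m.
- by move: gm; rewrite E.
Qed.

Lemma inC_listed (alpha beta : rat) : 0 <= alpha -> alpha < beta -> beta <= 1 ->
  inC (chi (ratr alpha : R) (ratr beta)) ->
  exists a b : nat, [/\ listed a b, alpha = a%:R / 60 & beta = b%:R / 60].
Proof.
move=> a0 ab b1; have b0 : 0 <= beta by exact: le_trans (ltW ab).
have nd (x : rat) : 0 <= x -> x = (`|numq x|%N)%:R / (`|denq x|%N)%:R.
  by move=> x0; rewrite -[LHS]divq_num_den !pmulrn !gez0_abs// numq_ge0.
have dn (x : rat) : (0 < `|denq x|)%N by rewrite absz_gt0 denq_eq0.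
(* The factor 120 makes [totient_gt2] applicable; writing alpha as 2 A / N makes n pi alpha depend
   on n modulo [N], up to multiples of 2 pi. *)
pose N := (120 * (`|denq alpha| * `|denq beta|))%N.
pose A := (60 * (`|numq alpha| * `|denq beta|))%N.
pose B := (60 * (`|numq beta| * `|denq alpha|))%N.
have N0 : (0 < N)%N by rewrite /N !muln_gt0 !dn.
have Nn : N%:R != 0 :> rat by rewrite pnatr_eq0 -lt0n.
have dn0 (x : rat) : (`|denq x|%N)%:R != 0 :> rat by rewrite pnatr_eq0 -lt0n.
have aE : alpha = 2 * A%:R / N%:R.
  by rewrite {1}(nd _ a0) /A /N !natrM; field; rewrite !dn0.
have bE : beta = 2 * B%:R / N%:R.
  by rewrite {1}(nd _ b0) /B /N !natrM; field; rewrite !dn0.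
have toR (n M : nat) : ratr (2 * n%:R / M%:R) = 2 * n%:R / M%:R :> R.
  by rewrite !(rmorphM, fmorphV, rmorph_nat).
have hyp M k l : (0 < M)%N -> (2 < totient M)%N -> alpha = 2 * k%:R / M%:R -> beta = 2 * l%:R / M%:R ->
    inC (chi (ratr alpha : R) (ratr beta)) ->
    forall g, coprime g M -> same_cos (2 * k%:R / M%:R : R) (2 * l%:R / M%:R) g.
  move=> M0 t2 kE lE cyc; apply: all_same_cos => //.
  - by rewrite -!toR -kE -lE ltr_rat.
  - by rewrite -toR -lE -(rmorph1 (@ratr R)) ler_rat.
  - by rewrite -!toR -kE -lE.
move=> cyc; have sN := hyp N A B N0 (totient_gt2 N0 (dvdn_mulr _ (dvdnn _))) aE bE cyc.
have [a aE'] : exists a : nat, (120 * A = a * N)%N.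
  apply/dvdnP; apply: (@dvdn_mul120 R A N (2 * B%:R / N%:R)) => // g /sN h x; case: h => -[e _]; by [left|right].
have [b bE'] : exists b : nat, (120 * B = b * N)%N.
  apply/dvdnP; apply: (@dvdn_mul120 R B N (2 * A%:R / N%:R)) => // g /sN h x; case: h => -[_ e]; by [left|right].
have aux (K k M : nat) : M%:R != 0 :> rat -> (120 * K = k * M)%N -> 2 * K%:R / M%:R = k%:R / 60 :> rat.
  move=> M0; move/(congr1 (fun n => n%:R : rat)); rewrite !natrM => E.
  have -> : k%:R = 120 * K%:R / M%:R :> rat by rewrite E mulfK.
  by field; rewrite M0.
have a60 : alpha = a%:R / 60 by rewrite aE; exact: aux.
have b60 : beta = b%:R / 60 by rewrite bE; exact: aux.
exists a, b; split => //.
have ablt : (a < b)%N by rewrite -(ltr_nat rat); move: ab; rewrite a60 b60; lra.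
have ble : (b <= 60)%N by rewrite -(ler_nat rat); move: b1; rewrite b60; lra.
have half (k : nat) : k%:R / 60 = 2 * k%:R / 120%:R :> rat by field.
(* With denominator 60 known, the argument is run again at the fixed modulus 120, where the
   condition is a finite computation. *)
have s120 := hyp 120%N a b isT isT (etrans a60 (half a)) (etrans b60 (half b)) cyc.
have cE g k : cos (g%:R * pi * (2 * k%:R / 120%:R)) = cosM R 120 (g * k).
  by rewrite /cosM natrM; congr cos; ring.
have c1E k : cos (pi * (2 * k%:R / 120%:R)) = cosM R 120 k by have := cE 1%N k; rewrite mul1n mul1r.
have sf : same_fold a b.
  have two k : (k <= 60)%N -> (2 * k <= 120)%N by lia.
  have ale := ltnW (leq_trans ablt ble).
  have key g : coprime g 120 -> (fold 120 (g * a) == a) && (fold 120 (g * b) == b) ||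
    (fold 120 (g * a) == b) && (fold 120 (g * b) == a).
    move=> /s120; rewrite /same_cos !cE !c1E => -[] [e1 e2]; apply/orP; [left|right];
    by rewrite (cosM_eq _ _ e1) ?two// (cosM_eq _ _ e2) ?two// !eqxx.
  by rewrite /same_fold /= !key.
have /allP/(_ a) := same_fold_list; rewrite mem_iota (leq_ltn_trans (ltnW ablt)) ?ltnS// => /(_ isT).
move/allP/(_ b); rewrite mem_iota ltnS ble ablt sf => /(_ isT)/orP[//|ex]; exfalso.
have six (k l : nat) : l%:R / 60 = k%:R / 6 :> rat -> ratr (l%:R / 60) = k%:R / 6 :> R.
  by move->; rewrite fmorph_div /= !rmorph_nat.
move: ex cyc; rewrite /exceptional a60 b60 !inE => /or4P[] /eqP[-> ->].
- by rewrite (six 0%N) ?(six 2%N)//; exact: not_inC_four.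
- by rewrite (six 4%N) ?(six 6%N)//; exact: not_inC_four.
- by rewrite (six 2%N) ?(six 3%N)//; exact: not_inC_four.
- by rewrite (six 3%N) ?(six 4%N)//; exact: not_inC_four.
Qed.

Lemma listed_rat (a b : nat) : listed a b -> (a%:R / 60, b%:R / 60) \in
  ([:: (0, 1); (0, 1/2); (1/2, 1); (0, 2/3); (1/3, 2/3);
      (1/3, 1); (1/4, 3/4); (1/5, 3/5); (2/5, 4/5); (1/6, 5/6)] : seq (rat * rat)).
Proof. by rewrite /listed !inE => h; do 9?[case/orP: h => h]; case/eqP: h => -> ->. Qed.

End Necessity.

(** * Density of the sines *)

Section SineDensity.
Variable R : realType.
Local Notation mu := (@lebesgue_measure R).
Local Notation I := (@I01 R).
Implicit Types f g h : R -> R.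

Let mI : measurable I. Proof. exact: measurable_itv. Qed.

Lemma Rintegral_dominated_lt (f_ : nat -> R -> R) g : (forall n, measurable_fun I (f_ n)) ->
  mu.-integrable I (EFin \o g) -> (forall n x, I x -> 0 <= f_ n x <= g x) ->
  (forall x, I x -> forall e : R, 0 < e -> exists N, forall n, (N <= n)%N -> f_ n x <= e) ->
  forall e : R, 0 < e -> exists n, \int[mu]_(x in I) f_ n x < e.
Proof.
move=> mf ig fg f0 e e0.
have m1 n : measurable_fun I (fun x => (f_ n x)%:E) by apply/measurable_EFinP.
have p1 x : I x -> (fun n => (f_ n x)%:E) @ \oo --> (0%:E : \bar R).
  move=> Ix; apply/fine_cvgP; split; first exact: nearW.
  apply/cvgrPdist_le => /= d d0; have [N HN] := f0 x Ix d d0.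
  exists N => // n /= /HN; rewrite sub0r normrN ger0_norm//.
  by case/andP: (fg n x Ix).
have b1 n x : I x -> (`|(f_ n x)%:E| <= (EFin \o g) x)%E.
  by move=> Ix /=; have /andP[? ?] := fg n x Ix; rewrite lee_fin ger0_norm.
have c := @dominated_cvg _ _ _ mu _ mI (fun n x => (f_ n x)%:E) (fun=> 0%:E) (EFin \o g) m1 p1 (fun _ _ => isT) ig b1.
rewrite integral0 in c.
have /fine_cvgP[_ /cvgrPdist_lt/(_ e e0)[N _ /(_ N (leqnn N))/=]] := c.
rewrite sub0r normrN => h; exists N; exact: le_lt_trans (ler_norm _) h.
Qed.

(* De Casteljau's recursion: the [n]-th Bernstein polynomial with value [v k] at [k / n]. *)
Fixpoint bern (y : R) n (v : nat -> R) : R :=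
  if n is n'.+1 then y * bern y n' (v \o S) + (1 - y) * bern y n' v else v 0%N.

Lemma bern_le (y : R) n (v w : nat -> R) : 0 <= y <= 1 -> (forall k, (k <= n)%N -> v k <= w k) -> bern y n v <= bern y n w.
Proof.
move=> /andP[y0 y1]; elim: n v w => [|n IH] v w vw /=; first exact: vw.
by apply: lerD; rewrite ler_wpM2l ?subr_ge0//; apply: IH => k kn; apply: vw; rewrite ?ltnS// leqW.
Qed.

Lemma bern_affine (y : R) n (a b : R) (v : nat -> R) : bern y n (fun k => a + b * v k) = a + b * bern y n v.
Proof. by elim: n v => [//|n IH] v /=; rewrite (IH (v \o S)) IH; ring. Qed.

(** Second moment about c of the binomial law with parameters n and y; a success in the recursion
    replaces c by c - 1. *)
Lemma bern_moment (y : R) n (c : R) : bern y n (fun k => (k%:R - c) ^+ 2) = n%:R * (y * (1 - y)) + (n%:R * y - c) ^+ 2.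
Proof.
elim: n c => [|n IH] c /=; first by ring.
rewrite IH; have := IH (c - 1); rewrite (_ : (fun k => _) = ((fun k => (k%:R - c) ^+ 2) \o S)).
  by move=> ->; rewrite -!natr1; ring.
by apply/funext => k /=; rewrite -natr1; congr (_ ^+ 2); ring.
Qed.

(** Chebyshev's inequality: off the eta-neighbourhood of y the bound B is at most K (k - n y)^2, and
    the variance is at most n. *)
Lemma bern_approx (y : R) n (v : nat -> R) (w e B eta : R) : 0 <= y <= 1 -> (0 < n)%N -> 0 < eta -> 0 <= e -> 0 <= B ->
  (forall k, (k <= n)%N -> `|v k - w| <= B) ->
  (forall k, (k <= n)%N -> `|k%:R / n%:R - y| < eta -> `|v k - w| <= e) ->
  `|bern y n v - w| <= e + B / (n%:R * eta ^+ 2).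
Proof.
move=> y01 n0 eta0 e0 B0 vB ve; have [y0 y1] := andP y01.
have np : 0 < n%:R :> R by rewrite ltr0n.
pose K := B / (n%:R * eta) ^+ 2.
have K0 : 0 <= K by rewrite divr_ge0// sqr_ge0.
have bnd k : (k <= n)%N -> `|v k - w| <= e + K * (k%:R - n%:R * y) ^+ 2.
  move=> kn; have [/(ve k kn) h|h] := ltP `|k%:R / n%:R - y| eta.
    by rewrite (le_trans h)// lerDl mulr_ge0// sqr_ge0.
  rewrite (le_trans (vB k kn))// -[leLHS]add0r lerD//.
  have -> : k%:R - n%:R * y = n%:R * (k%:R / n%:R - y) by field; rewrite gt_eqF.
  rewrite /K mulrAC ler_pdivlMr ?exprn_gt0 ?mulr_gt0// ler_wpM2l// !exprMn ler_wpM2l ?sqr_ge0//.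
  by rewrite -[leRHS]real_normK ?num_real// lerXn2r ?nnegrE// ltW.
have tail : K * (n%:R * (y * (1 - y)) + (n%:R * y - n%:R * y) ^+ 2) <= B / (n%:R * eta ^+ 2).
  have -> : B / (n%:R * eta ^+ 2) = K * (n%:R * 1) by rewrite /K; field; rewrite !gt_eqF.
  apply: ler_wpM2l => //; rewrite subrr expr0n addr0; apply: ler_wpM2l; first exact: ltW.
  by apply: mulr_ile1 => //; lra.
rewrite ler_norml; apply/andP; split.
  have := @bern_le y n (fun k => (w - e) + (- K) * (k%:R - n%:R * y) ^+ 2) v y01.
  rewrite bern_affine bern_moment => h; rewrite lerBrDr; apply: le_trans (h _); first by lra.
  by move=> k kn; have := bnd k kn; rewrite ler_norml => /andP[? _]; lra.
have := @bern_le y n v (fun k => (w + e) + K * (k%:R - n%:R * y) ^+ 2) y01.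
rewrite bern_affine bern_moment lerBlDr => h; apply: le_trans (h _) _; last by lra.
by move=> k kn; have := bnd k kn; rewrite ler_norml => /andP[_ ?]; lra.
Qed.

Definition sinspan (f : R -> R) := exists s : seq (R * nat), forall x, f x = \sum_(p <- s) p.1 * sn p.2 x.

Lemma sinspan_sn n : sinspan (sn n).
Proof. by exists [:: (1, n)] => x; rewrite big_seq1 mul1r. Qed.

Lemma sinspanD f g : sinspan f -> sinspan g -> sinspan (fun x => f x + g x).
Proof. by move=> [s fs] [t gt]; exists (s ++ t) => x; rewrite big_cat/= fs gt. Qed.

Lemma sinspanZ c f : sinspan f -> sinspan (fun x => c * f x).
Proof.
move=> [s fs]; exists [seq (c * p.1, p.2) | p <- s] => x.
by rewrite big_map fs mulr_sumr; apply: eq_bigr => p _; rewrite mulrA.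
Qed.

Lemma eq_sinspan f g : f =1 g -> sinspan f -> sinspan g.
Proof. by move=> fg [s fs]; exists s => x; rewrite -fg. Qed.

Lemma sinspan_inL2 f : sinspan f -> inL2 f.
Proof.
move=> [s fs]; have -> : f = (fun x => \sum_(p <- s) p.1 * sn p.2 x) by exact/funext.
by apply: inL2_sum => p; exact/inL2Z/inL2_sn.
Qed.

Lemma sinspan_cos f : sinspan f -> sinspan (fun x => cos (pi * x) * f x).
Proof.
move=> [s]; elim: s f => [|[c j] s IH] f fs.
  by exists [::] => x; rewrite fs !big_nil mulr0.
have := sinspanD _ (IH _ (fun x => erefl)).
move=> /(_ (fun x => cos (pi * x) * (c * sn j x))) h.
apply: (eq_sinspan _ (h _)) => [x|]; first by rewrite fs big_cons/= mulrDr.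
case: j {h fs} => [|j].
  by exists [::] => x; rewrite big_nil /sn !mul0r sin0 !mulr0.
exists [:: (c / 2, j.+2); (c / 2, j)] => x.
rewrite big_cons big_seq1 /sn /=.
have -> : j.+2%:R * pi * x = j.+1%:R * pi * x + pi * x by rewrite -[j.+2%:R]natr1; ring.
have -> : j%:R * pi * x = j.+1%:R * pi * x - pi * x by rewrite -[j.+1%:R]natr1; ring.
by rewrite sinB sinD; field.
Qed.

(** An increasing bijection of [0,1] that is affine in cos (pi x). A polynomial in [yc], multiplied
    by sin (pi x), is a combination of sines. *)
Definition yc (x : R) : R := (1 - cos (pi * x)) / 2.

Lemma sinspan_bern n v : sinspan (fun x => sn 1 x * bern (yc x) n v).
Proof.
elim: n v => [|n IH] v /=.
  by apply: eq_sinspan (sinspanZ (v 0%N) (sinspan_sn 1)) => x; rewrite mulrC.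
have A := sinspanD (sinspanZ 2^-1 (IH (v \o S))) (sinspanZ (- 2^-1) (sinspan_cos (IH (v \o S)))).
have B := sinspanD (sinspanZ 2^-1 (IH v)) (sinspanZ 2^-1 (sinspan_cos (IH v))).
by apply: eq_sinspan (sinspanD A B) => x; rewrite /yc; field.
Qed.

End SineDensity.

(** * Approximating sin times a continuous function *)

Section SineDensityL2.
Variable R : realType.
Local Notation mu := (@lebesgue_measure R).
Local Notation I := (@I01 R).
Implicit Types f g h p : R -> R.

Let mI : measurable I. Proof. exact: measurable_itv. Qed.

Definition l2dist f g : R := ip (fun x => f x - g x) (fun x => f x - g x).

Definition sin_approx g := inL2 g /\ forall e : R, 0 < e -> exists2 p, sinspan p & l2dist g p < e.

Lemma l2dist_triangle f g h : inL2 f -> inL2 g -> inL2 h ->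
  l2dist f h <= 2 * l2dist f g + 2 * l2dist g h.
Proof.
move=> f2 g2 h2; apply: le_trans (ip_le_sum (inL2B f2 g2) (inL2B g2 h2)).
by rewrite le_eqVlt /l2dist; apply/orP; left; apply/eqP; apply: eq_ip => x _; ring.
Qed.

Lemma sin_approx_close g : inL2 g ->
  (forall e : R, 0 < e -> exists2 h, sin_approx h & l2dist g h < e) -> sin_approx g.
Proof.
move=> g2 H; split => // e e0; have e4 : 0 < e / 4 by rewrite divr_gt0.
have [h [h2 hA] gh] := H _ e4; have [p ps hp] := hA _ e4.
exists p => //; apply: le_lt_trans (l2dist_triangle g2 h2 (sinspan_inL2 ps)) _; lra.
Qed.

Lemma yc_lt (s t : R) : 0 <= s <= 1 -> 0 <= t <= 1 -> (yc s < yc t) = (s < t).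
Proof.
move=> s01 t01; have itv (u : R) : 0 <= u <= 1 -> pi * u \in `[0, pi].
  by move=> /andP[u0 u1]; rewrite in_itv/= mulr_ge0 ?pi_ge0//= ler_piMr// pi_ge0.
rewrite /yc ltr_pM2r// ltrD2l ltrN2 ltr_cos ?itv//.
by rewrite ltr_pM2l// pi_gt0.
Qed.

Lemma yc_itv (x : R) : 0 <= yc x <= 1.
Proof. by rewrite /yc; have := cos_geN1 (pi * x); have := cos_le1 (pi * x) => *; apply/andP; split; lra. Qed.

(** Continuity of the inverse of [yc]: eta is the smaller of the gaps to the values at x - d' and x
    + d', by monotonicity. *)
Lemma yc_near (x d : R) : 0 < x < 1 -> 0 < d ->
  exists2 eta : R, 0 < eta & forall t : R, 0 <= t <= 1 -> `|yc t - yc x| < eta -> `|t - x| < d.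
Proof.
move=> /andP[x0 x1] d0; pose d' := Num.min d (Num.min x (1 - x)).
have d'0 : 0 < d' by rewrite !lt_min d0 x0 subr_gt0.
have d'd : d' <= d by rewrite ge_min lexx.
have d'x : d' <= x by rewrite !ge_min lexx orbT.
have d'x1 : d' <= 1 - x by rewrite !ge_min lexx !orbT.
have xI : 0 <= x <= 1 by apply/andP; split; lra.
have aI : 0 <= x - d' <= 1 by apply/andP; split; lra.
have bI : 0 <= x + d' <= 1 by apply/andP; split; lra.
exists (Num.min (yc x - yc (x - d')) (yc (x + d') - yc x)).
  by rewrite lt_min !subr_gt0 !yc_lt//; apply/andP; split; lra.
move=> t tI; rewrite lt_min => /andP[/ltr_distlCBl h1 /ltr_distlDr h2].
have : x - d' < t by rewrite -yc_lt//; lra.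
have : t < x + d' by rewrite -yc_lt//; lra.
by move=> *; rewrite ltr_norml; apply/andP; split; lra.
Qed.

(** The point that [yc] maps to k / n. *)
Definition node n k : R := acos (1 - 2 * (k%:R / n%:R)) / pi.

Lemma node_itv n k : (0 < n)%N -> (k <= n)%N -> 0 <= node n k <= 1 /\ yc (node n k) = k%:R / n%:R.
Proof.
move=> n0 kn; have np : 0 < n%:R :> R by rewrite ltr0n.
have q0 : 0 <= k%:R / n%:R :> R by rewrite divr_ge0.
have q1 : k%:R / n%:R <= 1 :> R by rewrite ler_pdivrMr// mul1r ler_nat.
have J : -1 <= 1 - 2 * (k%:R / n%:R : R) <= 1.
  by rewrite lerBrDr lerBlDr; apply/andP; split; lra.
rewrite /node; split.
  by rewrite divr_ge0 ?acos_ge0 ?pi_ge0//= ler_pdivrMr ?pi_gt0// mul1r acos_lepi.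
rewrite /yc [pi * _]mulrC divfK ?gt_eqF ?pi_gt0// acosK ?in_itv//=; field; exact: lt0r_neq0.
Qed.

(** Bernstein polynomials in [yc] with the values of f at the nodes converge pointwise on (0,1) and
    stay within 4B of f, so dominated convergence applies. *)
Lemma sin_approx_continuous f (B : R) : continuous f -> (forall x, `|f x| <= B) ->
  sin_approx (fun x => sn 1 x * f x).
Proof.
move=> cf fB; have B0 : 0 <= B by exact: le_trans (normr_ge0 _) (fB 0).
have sn1 x : `|sn 1 x : R| <= 1 by rewrite ler_norml sin_le1 sin_geN1.
have F2 : inL2 (fun x => sn 1 x * f x).
  apply: inL2_bddm; apply: (@bddm_continuous _ _ B).
    move=> x; apply: continuousM; [exact: continuous_sn|exact: cf].
  by move=> x; rewrite normrM -[leRHS]mul1r ler_pM.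
split=> // e e0.
pose P n x := bern (yc x) n.+1 (f \o node n.+1).
have PS n : sinspan (fun x => sn 1 x * P n x) by exact: sinspan_bern.
have fw x k n : `|(f \o node n) k - f x| <= 2 * B.
  by rewrite (le_trans (ler_normB _ _))//= mulr2n mulrDl mul1r lerD.
pose F n x := (sn 1 x * f x - sn 1 x * P n x) ^+ 2.
have FE n x : F n x <= (P n x - f x) ^+ 2.
  have -> : F n x = sn 1 x ^+ 2 * (P n x - f x) ^+ 2 by rewrite /F; ring.
  by rewrite ler_piMl ?sqr_ge0// -[leLHS]real_normK ?num_real// exprn_ile1.
have sqle (u v : R) : `|u| <= v -> u ^+ 2 <= v ^+ 2.
  by move=> uv; rewrite -[leLHS]real_normK ?num_real// lerXn2r ?nnegrE// (le_trans _ uv).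
have [||||n hn] := @Rintegral_dominated_lt R F (fun=> (4 * B) ^+ 2) _ _ _ _ e e0.
- by move=> n; apply: measurable_funX; case: (inL2B F2 (sinspan_inL2 (PS n))).
- by apply: bddm_integrable; split => //; exists `|(4 * B) ^+ 2|.
- move=> n x _; rewrite sqr_ge0/= (le_trans (FE n x))// sqle//.
  have B2 : 0 <= 2 * B by rewrite mulr_ge0.
  have := @bern_approx R (yc x) n.+1 (f \o node n.+1) (f x) (2 * B) (2 * B) 1 (yc_itv x) isT ltr01 B2 B2.
  move=> /(_ (fun k _ => fw x k _) (fun k _ _ => fw x k _))/le_trans; apply.
  rewrite expr1n mulr1; have : 2 * B / n.+1%:R <= 2 * B by rewrite ler_pdivrMr// ler_peMr// ler1n.
  by move: (2 * B / _) => q; lra.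
- move=> x; rewrite /I01/= in_itv/= => x01 d d0.
  pose d1 := Num.min 1 d; have d10 : 0 < d1 by rewrite lt_min ltr01.
  have d2 : d1 ^+ 2 <= d.
    apply: (@le_trans _ _ d1); last by rewrite /d1 ge_min lexx orbT.
    by rewrite expr2 ler_piMl ?(ltW d10)// /d1 ge_min lexx.
  have h0 : 0 < d1 / 2 by rewrite divr_gt0.
  have /cvgrPdist_lt/(_ _ h0)/nbhs_ballP[r /= r0 hr] := cf x.
  have [eta eta0 heta] := yc_near x01 r0.
  have e2 : 0 < eta ^+ 2 by rewrite exprn_gt0.
  exists (Num.truncn (2 * B / (d1 / 2 * eta ^+ 2))) => n hn.
  rewrite (le_trans (FE n x))// (le_trans _ d2)// sqle//.
  have B2 : 0 <= 2 * B by rewrite mulr_ge0.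
  have := @bern_approx R (yc x) n.+1 (f \o node n.+1) (f x) (d1 / 2) (2 * B) eta (yc_itv x) isT eta0 (ltW h0) B2.
  move=> /(_ (fun k _ => fw x k _)) H; apply: (le_trans (H _)).
    move=> k kn; have [nI nE] := node_itv (ltn0Sn n) kn; rewrite -nE => /(heta _ nI) near.
    by rewrite distrC ltW//; apply: hr; rewrite /ball/= distrC.
  suff : 2 * B / (n.+1%:R * eta ^+ 2) <= d1 / 2 by move: (2 * B / _) => q; lra.
  rewrite ler_pdivrMr ?mulr_gt0// mulrCA mulrC -ler_pdivrMr ?mulr_gt0//.
  rewrite [B * 2]mulrC; apply/ltW/(lt_le_trans (truncnS_gt _)).
  by rewrite ler_nat ltnS.
exists (fun x => sn 1 x * P n x); first exact: PS.
apply: le_lt_trans hn; rewrite le_eqVlt; apply/orP; left; apply/eqP.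
by apply: eq_Rintegral => x _; rewrite /F expr2.
Qed.

End SineDensityL2.

(** * Truncation and density in L^2 *)

Section SineDensityFinal.
Variable R : realType.
Local Notation mu := (@lebesgue_measure R).
Local Notation I := (@I01 R).
Implicit Types f g h p : R -> R.

Let mI : measurable I. Proof. exact: measurable_itv. Qed.

Definition clamp (B t : R) : R := (`|t + B| - `|t - B|) / 2.

Lemma clampE (B t : R) : 0 <= B -> [\/ t <= - B /\ clamp B t = - B, - B <= t <= B /\ clamp B t = t |
  B <= t /\ clamp B t = B].
Proof.
move=> B0; rewrite /clamp; case: (ger0P (t + B)) => h1; case: (ger0P (t - B)) => h2.
- by constructor 3; split; lra.
- by constructor 2; split; [apply/andP; split|]; lra.
- by exfalso; lra.
- by constructor 1; split; lra.
Qed.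

Lemma clamp_bound (B t : R) : 0 <= B -> `|clamp B t| <= B.
Proof.
by move=> B0; rewrite ler_norml; case: (clampE t B0) => -[h ->]; move: h => ?; apply/andP; split; lra.
Qed.

Lemma clamp_dist (B s t : R) : 0 <= B -> `|s| <= B -> `|s - clamp B t| <= `|s - t|.
Proof.
move=> B0; rewrite ler_norml => /andP[s1 s2]; have n1 := ler_norm (s - t); have n2 := ler_norm (t - s); rewrite distrC in n2.
by rewrite ler_norml; case: (clampE t B0) => -[h ->]; move: h => h; apply/andP; split; lra.
Qed.

Lemma clamp_id (B t : R) : 0 <= B -> `|t| <= B -> clamp B t = t.
Proof.
by move=> B0; rewrite ler_norml => /andP[? ?]; case: (clampE t B0) => -[? ->]; lra.
Qed.

Lemma clamp_sqr_le (B t : R) : 0 <= B -> 0 <= (t - clamp B t) ^+ 2 <= t ^+ 2.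
Proof.
move=> B0; rewrite sqr_ge0/=; case: (clampE t B0) => -[h ->]; move: h => h; nra.
Qed.

Lemma sn1_gt0 x : I x -> 0 < sn 1 x.
Proof.
rewrite /I01/= in_itv/= => /andP[x0 x1]; rewrite /sn mul1r sin_gt0_pi//.
by rewrite mulr_gt0 ?pi_gt0//= gtr_pMr ?pi_gt0.
Qed.

(** Continuous functions approximate f in L^1. Clamping them at B brings them no further from f and
    makes the squared error at most 2B times the L^1 error. *)
Lemma sin_approx_bounded f (B : R) : 0 < B -> measurable_fun I f -> (forall x, I x -> `|f x| <= B) ->
  sin_approx (fun x => sn 1 x * f x).
Proof.
move=> B0 mf fB; have bf : bddm f by split => //; exists B.
have S1 (x : R) : `|sn 1 x| <= 1 by rewrite ler_norml sin_le1 sin_geN1.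
have B0' := ltW B0.
have F2 : inL2 (fun x => sn 1 x * f x).
  apply: inL2_bddm; split.
    by apply: measurable_funM => //; case: (bddm_sn R 1).
  by exists B => x Ix; rewrite normrM -[leRHS]mul1r ler_pM// fB.
apply: sin_approx_close => // e e0.
have e1 : 0 < e / (2 * B) by rewrite divr_gt0// mulr_gt0.
have fin : (mu I < +oo)%E by rewrite [X in (X < _)%E]lebesgue_I01 ltry.
have [g_ [cg ig]] := approximation_continuous_integrable mI fin (bddm_integrable bf).
move=> /fine_cvgP[_ /cvgrPdist_lt/(_ _ e1)[N _ /(_ N (leqnn N))/=]].
rewrite sub0r normrN => /(le_lt_trans (ler_norm _)) hN.
pose phi x := clamp B (g_ N x).
have cphi : continuous phi.
  move=> x; rewrite /phi /clamp; apply: cvgMl; apply: cvgB; apply: cvg_norm.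
    by apply: cvgD; [exact: cg|exact: cvg_cst].
  by apply: cvgB; [exact: cg|exact: cvg_cst].
have phiB x : `|phi x| <= B by exact: clamp_bound.
exists (fun x => sn 1 x * phi x); first exact: (sin_approx_continuous cphi phiB).
have Phi2 := (sin_approx_continuous cphi phiB).1.
have id : mu.-integrable I (EFin \o (fun x => `|f x - g_ N x|)).
  have := @integrableB _ _ _ mu I mI _ _ (bddm_integrable bf) (ig N).
  by move=> /integrable_abse; apply: eq_integrable => // x _ /=.
apply: (@le_lt_trans _ _ (\int[mu]_(x in I) (2 * B * `|f x - g_ N x|))).
  apply: le_Rintegral => //.
  - exact: inL2_mul_integrable (inL2B F2 Phi2) (inL2B F2 Phi2).
  - have := @integrableZl _ _ _ mu I mI (2 * B) _ id.
    by apply: eq_integrable => // x _ /=.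
  move=> x Ix; rewrite -mulrBr.
  have h1 : (sn 1 x * (f x - phi x)) * (sn 1 x * (f x - phi x)) <= `|f x - phi x| * `|f x - phi x|.
    rewrite -!expr2 -[leLHS]real_normK ?num_real// lerXn2r ?nnegrE// normrM ler_piMl//.
  apply: le_trans h1 _; apply: ler_pM => //; last exact: (clamp_dist _ B0' (fB x Ix)).
  by rewrite (le_trans (ler_normB _ _))// mulr2n mulrDl mul1r lerD ?fB.
rewrite RintegralZl// mulrC -ltr_pdivlMr ?mulr_gt0//.
Qed.

(** Clamping g at n sin (pi x), rather than at n, makes its quotient by sin (pi x) bounded, as the
    preceding case requires. The clamped functions tend to g because the sine is positive on
    (0,1). *)
Lemma sine_density g : inL2 g -> sin_approx g.
Proof.
move=> g2; have [mg _] := g2.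
have ms : measurable_fun I (@sn R 1) by case: (bddm_sn R 1).
have mn n : measurable_fun I (fun x => n%:R * sn 1 x) by apply: measurable_funM.
have s0 x : I x -> forall n, 0 <= n%:R * sn 1 x by move=> Ix n; rewrite mulr_ge0// ltW// sn1_gt0.
pose G n x := clamp (n%:R * sn 1 x) (g x).
have mG n : measurable_fun I (G n).
  apply: measurable_funM => //; apply: measurable_funB; apply: measurableT_comp => //.
    exact: measurable_funD.
  exact: measurable_funB.
have G2 n : inL2 (G n).
  apply: inL2_bddm; split => //; exists n%:R => x Ix.
  rewrite (le_trans (clamp_bound _ (s0 _ Ix n)))// ler_piMr//.
  exact: sin_le1.
have GA n : sin_approx (G n).
  have mq : measurable_fun I (fun x => G n x / sn 1 x).
    apply: measurable_funM => //; apply: open_continuous_measurable_fun; first exact: interval_open.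
    move=> x /set_mem Ix; apply: continuousV; first by rewrite gt_eqF// sn1_gt0.
    exact: continuous_sn.
  have bq x : I x -> `|G n x / sn 1 x| <= n.+1%:R.
    move=> Ix; have sx := sn1_gt0 Ix; rewrite normrM normfV (gtr0_norm sx) ler_pdivrMr//.
    by rewrite (le_trans (clamp_bound _ (s0 _ Ix n)))// ler_wpM2r ?(ltW sx)// ler_nat.
  have [q2 qA] := sin_approx_bounded (ltr0Sn R n) mq bq.
  split=> // e e0; have [p ps hp] := qA e e0; exists p => //.
  rewrite (le_lt_trans _ hp)// le_eqVlt /l2dist; apply/orP; left; apply/eqP.
  by apply: eq_ip => x /set_mem Ix; rewrite mulrCA divff ?mulr1// gt_eqF// sn1_gt0.
apply: sin_approx_close => // e e0.
have [||||n hn] := @Rintegral_dominated_lt R (fun n x => (g x - G n x) ^+ 2) (fun x => g x ^+ 2) _ _ _ _ e e0.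
- by move=> n; apply: measurable_funX; apply: measurable_funB.
- exact: inL2_sqr_integrable.
- by move=> n x Ix; apply: clamp_sqr_le; exact: s0.
- move=> x Ix d d0; exists (Num.truncn (`|g x| / sn 1 x)).+1 => n hn.
  rewrite /G clamp_id ?subrr ?expr0n ?s0//; first by rewrite (ltW d0).
  rewrite -ler_pdivrMr ?sn1_gt0//; apply/ltW/(lt_le_trans (truncnS_gt _)).
  by rewrite ler_nat.
exists (G n) => //; apply: le_lt_trans hn; rewrite le_eqVlt; apply/orP; left; exact/eqP.
Qed.

End SineDensityFinal.

(** * Inverting the Dirichlet coefficients *)

Section DirichletApproximation.
Variable R : realType.
Implicit Types f g v mu : nat -> R.

(** The effect of the k-th dilation on sine coefficients. *)
Definition shift k f n : R := if (k %| n)%N then f (n %/ k)%N else 0.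

Lemma shift1 f n : shift 1 f n = f n.
Proof. by rewrite /shift dvd1n divn1. Qed.

Lemma shift_shift k l f n : (0 < k)%N -> (0 < l)%N -> shift k (shift l f) n = shift (k * l) f n.
Proof.
move=> k0 l0; rewrite /shift; have [kn|kn] := boolP (k %| n)%N.
  by rewrite dvdn_divRL// [(l * k)%N]mulnC divnMA.
by rewrite ifF//; apply: contraNF kn; exact: dvdn_trans (dvdn_mulr _ _).
Qed.

Lemma shiftD k f g n : shift k (fun m => f m + g m) n = shift k f n + shift k g n.
Proof. by rewrite /shift; case: ifP => _; rewrite ?addr0. Qed.

Lemma shiftZ k c f n : shift k (fun m => c * f m) n = c * shift k f n.
Proof. by rewrite /shift; case: ifP => _; rewrite ?mulr0. Qed.

Lemma eq_shift k f g n : (0 < k)%N -> (0 < n)%N -> (forall m, (0 < m)%N -> f m = g m) -> shift k f n = shift k g n.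
Proof.
by move=> k0 n0 fg; rewrite /shift; case: ifP => // kn; rewrite fg// divn_gt0// dvdn_leq.
Qed.

Definition orbit_span v f := exists2 s : seq (R * nat), all (fun p => (0 < p.2)%N) s &
  forall n, (0 < n)%N -> f n = \sum_(p <- s) p.1 * shift p.2 v n.

Lemma orbit_id v : orbit_span v v.
Proof. by exists [:: (1, 1%N)] => // n n0; rewrite big_seq1 mul1r shift1. Qed.

Lemma orbit_add v f g : orbit_span v f -> orbit_span v g -> orbit_span v (fun n => f n + g n).
Proof.
move=> [s s0 fs] [t t0 gt]; exists (s ++ t); first by rewrite all_cat s0.
by move=> n n0; rewrite big_cat/= fs// gt.
Qed.

Lemma orbit_scale v c f : orbit_span v f -> orbit_span v (fun n => c * f n).
Proof.
move=> [s s0 fs]; exists [seq (c * p.1, p.2) | p <- s]; first by rewrite all_map.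
by move=> n n0; rewrite big_map fs// mulr_sumr; apply: eq_bigr => p _; rewrite mulrA.
Qed.

Lemma orbit_shift v k f : (0 < k)%N -> orbit_span v f -> orbit_span v (shift k f).
Proof.
move=> k0 [s s0 fs]; exists [seq (p.1, (k * p.2)%N) | p <- s].
  by rewrite all_map; apply: sub_all s0 => p /= p0; rewrite muln_gt0 k0.
move=> n n0; rewrite big_map (eq_shift k0 n0 fs).
elim: s s0 {fs} => [_|p s IH /= /andP[p0 s0]].
  by rewrite big_nil /shift; case: ifP => _; rewrite ?big_nil.
rewrite big_cons/= -IH// -shift_shift// -shiftZ -shiftD.
by apply: eq_shift => // m _; rewrite big_cons.
Qed.

Lemma eq_orbit v f g : (forall n, (0 < n)%N -> f n = g n) -> orbit_span v f -> orbit_span v g.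
Proof. by move=> fg [s s0 fs]; exists s => // n n0; rewrite -fg// fs. Qed.

Lemma orbit_sum v m (F : nat -> nat -> R) : (forall k, orbit_span v (F k)) ->
  orbit_span v (fun n => \sum_(k < m) F k n).
Proof.
move=> H; elim: m => [|m IH].
  by apply: eq_orbit (orbit_scale 0 (orbit_id v)) => n _; rewrite big_ord0 mul0r.
by apply: eq_orbit (orbit_add IH (H m)) => n _; rewrite big_ord_recr.
Qed.

Definition sqsum M f : R := \sum_(1 <= n < M.+1) f n ^+ 2.

Lemma sqsum_le M f g : (forall n, (0 < n)%N -> f n ^+ 2 <= g n ^+ 2) -> sqsum M f <= sqsum M g.
Proof.
by move=> fg; rewrite /sqsum big_nat_cond [leRHS]big_nat_cond; apply: ler_sum => n /andP[/andP[/fg]].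
Qed.

Lemma sqsum_shift M k f : (0 < k)%N -> sqsum M (shift k f) <= sqsum M f.
Proof.
move=> k0; have -> : sqsum M (shift k f) = \sum_(1 <= n < M.+1 | (k %| n)%N) f (n %/ k)%N ^+ 2.
  rewrite /sqsum [RHS]big_mkcond; apply: eq_bigr => n _; rewrite /shift; case: ifP => // _.
  by rewrite expr0n.
rewrite sum_multiples// [leRHS](big_cat_nat (n := (M %/ k).+1))//= ?ltnS ?leq_div//.
rewrite -[leLHS]addr0 lerD//; last by apply: sumr_ge0 => n _; exact: sqr_ge0.
by rewrite le_eqVlt; apply/orP; left; apply/eqP; apply: eq_bigr => n _; rewrite mulKn.
Qed.

Lemma sqr_sum_le m (x : nat -> R) : (\sum_(k < m) x k) ^+ 2 <= m%:R * \sum_(k < m) x k ^+ 2.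
Proof.
elim: m => [|m IH]; first by rewrite !big_ord0 expr0n mul0r.
rewrite !big_ord_recr/=; move: IH; set S := \sum_(k < m) x k; set Q := \sum_(k < m) _ => IH.
have [m0|m0] := posnP m.
  have S0 : S = 0 by rewrite /S m0 big_ord0.
  have Q0 : Q = 0 by rewrite /Q m0 big_ord0.
  by rewrite S0 Q0 m0 !add0r mul1r.
have mp : 0 < m%:R :> R by rewrite ltr0n.
have := sqr_ge0 (S - m%:R * x m); rewrite -natr1 => h.
suff : m%:R * (2 * S * x m) <= m%:R * (Q + m%:R * x m ^+ 2) by rewrite ler_pM2l//; lra.
by lra.
Qed.

Section Sieve.
Variables (lam : nat -> R) (q : nat) (sigma K : R) (v : nat -> R).
Hypotheses (lam1 : lam 1%N = 1) (lamM : forall m n, (0 < m)%N -> (0 < n)%N -> lam (m * n)%N = lam m * lam n)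
  (lam_le1 : forall n, `|lam n| <= 1) (q1 : (1 < q)%N) (sigma1 : `|sigma| <= 1) (K0 : K != 0).

Let mu n : R := lam n / n%:R.

Hypothesis vE : forall n, (0 < n)%N -> v n = K * (mu n + sigma * shift q mu n).

Let q0 : (0 < q)%N. Proof. exact: ltnW. Qed.

Let muM m n : (0 < m)%N -> (0 < n)%N -> mu (m * n)%N = mu m * mu n.
Proof. by move=> m0 n0; rewrite /mu lamM// natrM; field; rewrite !pnatr_eq0 -!lt0n m0 n0. Qed.

(* [mu] with the Euler factors at the primes up to [X] removed. *)
Fixpoint rough X : nat -> R :=
  if X is X'.+1 then
    if prime X then fun n => rough X' n + - mu X * shift X (rough X') n else rough X'
  else mu.

Lemma roughE X n : (0 < n)%N -> rough X n = if all (fun p => (X < p)%N) (primes n) then mu n else 0.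
Proof.
elim: X n => [|X IH] n n0 /=.
  rewrite ifT//; apply/allP => p; rewrite mem_primes => /andP[/prime_gt0 //].
have step : ~~ (prime X.+1 && (X.+1 %| n)%N) -> all (fun p => (X.+1 < p)%N) (primes n) = all (fun p => (X < p)%N) (primes n).
  move=> np; apply: eq_in_all => p; rewrite mem_primes => /and3P[pp _ pn].
  rewrite [RHS]leq_eqVlt; case: eqP => // e; move: np; rewrite e pp pn.
  by rewrite -e.
case: ifPn => [pX|npX]; last by rewrite IH// step// (negbTE npX).
have [Xn|Xn] := boolP (X.+1 %| n)%N; last first.
  by rewrite /shift (negbTE Xn) mulr0 addr0 IH// step// negb_and Xn orbT.
rewrite IH// /shift Xn; have m0 : (0 < n %/ X.+1)%N by rewrite divn_gt0// dvdn_leq.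
rewrite IH// [in RHS]ifF; last first.
  apply/negbTE/allPn; exists X.+1; first by rewrite mem_primes pX n0.
  by rewrite ltnn.
have nE : n = (X.+1 * (n %/ X.+1))%N by rewrite mulnC divnK.
have -> : all (fun p => (X < p)%N) (primes n) = all (fun p => (X < p)%N) (primes (n %/ X.+1)).
  rewrite [in LHS]nE; apply/allP/allP => h p pin.
    by apply: h; rewrite primesM// pin orbT.
  by move: pin; rewrite primesM// primes_prime// inE => /orP[/eqP ->|/h]; [exact: ltnSn|].
case: ifP => _; last by rewrite mulr0 addr0.
by rewrite [in X in X + _]nE muM//; ring.
Qed.

(** Shifts commute, so the sieve acts on both terms of v at once and leaves the factor 1 + sigma T_q
    in place. *)
Lemma orbit_rough X : orbit_span v (fun n => rough X n + sigma * shift q (rough X) n).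
Proof.
elim: X => [|X IH] /=.
  apply: eq_orbit (orbit_scale K^-1 (orbit_id v)) => n n0.
  by rewrite vE// mulrA mulVf// mul1r.
case: ifPn => [pX|//]; have X0 : (0 < X.+1)%N by [].
apply: eq_orbit (orbit_add IH (orbit_scale (- mu X.+1) (orbit_shift X0 IH))) => n n0.
rewrite !shiftD !shiftZ !shift_shift// [(q * _)%N]mulnC; ring.
Qed.

Let err X n := rough X n - (n == 1%N)%:R.

Lemma err_sqr X n : (0 < n)%N -> err X n ^+ 2 <= (if (X < n)%N then n%:R ^- 2 else 0).
Proof.
move=> n0; rewrite /err roughE//; have [->|n1] := eqVneq n 1%N.
  by rewrite /= /mu lam1 divr1 subrr expr0n /=; case: ifP; rewrite ?invr_ge0 ?sqr_ge0.
have n2 : (1 < n)%N by rewrite ltn_neqAle eq_sym n1.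
rewrite subr0; case: ifPn => [|nX].
  case: n n0 n1 n2 => [//|n] _ _ n2 /allP/(_ (pdiv n.+1)); rewrite mem_primes pdiv_prime// pdiv_dvd.
  move=> /(_ isT) Xp; rewrite (leq_trans Xp) ?pdiv_leq// /mu exprMn exprVn ler_piMl//.
  by rewrite -[leLHS]real_normK ?num_real// exprn_ile1.
by rewrite expr0n/=; case: ifP; rewrite ?invr_ge0 ?sqr_ge0.
Qed.

(** Apart from n = 1, where the error is 0, only n > X contribute, with at most 1/n^2 each; the
    induction telescopes against 1/X - 1/M. *)
Lemma sqsum_err M X : (0 < X)%N -> sqsum M (err X) <= X%:R^-1.
Proof.
move=> X0; have Xp : 0 < X%:R :> R by rewrite ltr0n.
apply: (@le_trans _ _ (if (X <= M)%N then X%:R^-1 - M%:R^-1 else 0)); last first.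
  by case: ifP => _; rewrite ?invr_ge0 ?(ltW Xp)// lerBlDr lerDl invr_ge0.
elim: M => [|M IH]; first by rewrite /sqsum big_geq// leqNgt X0.
rewrite /sqsum big_nat_recr//= -/(sqsum M _) (le_trans (lerD IH (err_sqr X (ltn0Sn M))))//.
rewrite ltnS; case: leqP => [XM|MX].
  have M0 : 0 < M%:R :> R by rewrite ltr0n (leq_trans X0).
  rewrite leqW// -[X in _ <= X]addr0 -lerBlDl.
  have -> : X%:R^-1 - M%:R^-1 + M.+1%:R ^- 2 - (X%:R^-1 - M.+1%:R^-1) =
     - (M%:R * M.+1%:R ^+ 2)^-1 :> R.
    have e (x y : R) : 0 < y -> x - y^-1 + (y + 1) ^- 2 - (x - (y + 1)^-1) = - (y * (y + 1) ^+ 2)^-1.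
      by move=> y0; field; rewrite (gt_eqF y0) gt_eqF// addr_gt0.
    by rewrite -natr1 e.
  by rewrite oppr_le0 invr_ge0 mulr_ge0 ?sqr_ge0 ?ltW.
rewrite addr0; case: ifP => // XM; rewrite subr_ge0.
by rewrite lef_pV2 ?posrE ?ltr0n// ler_nat.
Qed.

(* The Fejer weights [1 - k / m] turn [1 + sigma T_q] into [1] up to an average of
   [m] shifts by distinct powers of [q]. *)
Lemma orbit_delta_1 (eps : R) : 0 < eps ->
  exists2 f, orbit_span v f & forall M, sqsum M (fun n => f n - (n == 1%N)%:R) <= eps.
Proof.
(* The 9 comes from three errors of at most 1/m each and the factor 3 in the square of a sum of
   three terms. *)
move=> e0; have [m m0 me] : exists2 m, (0 < m)%N & 9 / m%:R <= eps.
  exists (Num.truncn (9 / eps)).+1 => //.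
  by rewrite ler_pdivrMr// -ler_pdivrMl// mulrC; apply/ltW; exact: truncnS_gt.
have mp : 0 < m%:R :> R by rewrite ltr0n.
have [X X0 Xm] : exists2 X, (0 < X)%N & X = m by exists m.
pose A n := rough X n + sigma * shift q (rough X) n.
pose w k : R := (1 - k%:R / m%:R) * (- sigma) ^+ k.
pose f n := \sum_(k < m) w k * shift (q ^ k) A n.
have qk k : (0 < q ^ k)%N by rewrite expn_gt0 q0.
exists f.
  apply: (@orbit_sum v m (fun k n => w k * shift (q ^ k) A n)) => k.
  by apply/orbit_scale/orbit_shift => //; exact: orbit_rough.
(* At q^(k+1) the contributions sigma w_k and w_{k+1} cancel up to -(1/m)(-sigma)^(k+1). The
   boundary term vanishes at j = m because w_m = 0. *)
have tele j n : (j <= m)%N -> \sum_(k < j) w k * shift (q ^ k) A n =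
    rough X n - m%:R^-1 * (\sum_(k < j) (- sigma) ^+ k.+1 * shift (q ^ k.+1) (rough X) n)
    - w j * shift (q ^ j) (rough X) n.
  elim: j => [|j IH] jm.
    by rewrite !big_ord0 expn0 shift1 /w mul0r subr0 expr0 mulr0 !mul1r subr0 subrr.
  rewrite !big_ord_recr/= IH; last exact: ltnW.
  rewrite /A shiftD shiftZ shift_shift// -expnSr /w exprS -natr1; field; exact: lt0r_neq0.
pose D n := m%:R^-1 * (\sum_(k < m) (- sigma) ^+ k.+1 * shift (q ^ k.+1) (fun n => (n == 1%N)%:R) n).
pose E n := m%:R^-1 * (\sum_(k < m) (- sigma) ^+ k.+1 * shift (q ^ k.+1) (err X) n).
have split n : f n - (n == 1%N)%:R = err X n - D n - E n.
  have wm : w m = 0 by rewrite /w divff ?gt_eqF// subrr mul0r.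
  rewrite /f tele// wm mul0r subr0 (_ : \sum_(k < m) _ =
    \sum_(k < m) (- sigma) ^+ k.+1 * shift (q ^ k.+1) (fun n => (n == 1%N)%:R) n +
    \sum_(k < m) (- sigma) ^+ k.+1 * shift (q ^ k.+1) (err X) n); first by rewrite /err /D /E; ring.
  rewrite -big_split/=; apply: eq_bigr => k _; rewrite -mulrDr -shiftD; congr (_ * shift _ _ _).
  by apply/funext => i; rewrite /err addrC subrK.
have mi : m%:R^-1 ^+ 2 * m%:R = m%:R^-1 :> R by field; rewrite gt_eqF.
have s1 k : ((- sigma) ^+ k) ^+ 2 <= 1.
  by rewrite -[leLHS]real_normK ?num_real// exprn_ile1// normrX normrN exprn_ile1.
have sE M : sqsum M E <= X%:R^-1.
  apply: (@le_trans _ _ (m%:R^-1 * \sum_(k < m) sqsum M (shift (q ^ k.+1) (err X)))).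
    rewrite /sqsum exchange_big/= mulr_sumr; apply: ler_sum => n _; rewrite /E exprMn.
    have := sqr_sum_le m (fun k => (- sigma) ^+ k.+1 * shift (q ^ k.+1) (err X) n).
    move=> /(ler_wpM2l (sqr_ge0 m%:R^-1))/le_trans; apply.
    rewrite mulrA mi ler_wpM2l ?invr_ge0 ?(ltW mp)//; apply: ler_sum => k _.
    by rewrite exprMn ler_piMl ?sqr_ge0.
  rewrite ler_pdivrMl// mulr_natl -[m in _ *+ m]card_ord -sumr_const.
  apply: ler_sum => k _; apply: le_trans (sqsum_shift _ _ (qk _)) _; exact: sqsum_err.
(* The powers q^(k+1) are distinct, so D has modulus at most 1/m on m points: the squares add up to
   at most 1/m. *)
have sD M : sqsum M D <= m%:R^-1.
  have dE k n : (0 < n)%N -> shift (q ^ k) (fun n => (n == 1%N)%:R) n = (n == q ^ k)%N%:R.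
    move=> n0; rewrite /shift; case: ifPn => [kn|kn].
      by rewrite -(eqn_pmul2l (qk k)) [X in (X == _)%:R]mulnC divnK// muln1.
    by case: eqP => // nq; rewrite nq dvdnn in kn.
  have D1 n : (0 < n)%N -> D n ^+ 2 <= m%:R^-1 ^+ 2 * \sum_(k < m) (n == q ^ k.+1)%N%:R.
    move=> n0; rewrite /D exprMn ler_wpM2l ?sqr_ge0//.
    under eq_bigr => k _ do rewrite dE//.
    have [/existsP[k /eqP nk]|nex] := boolP [exists k : 'I_m, n == q ^ k.+1]%N.
      have uniq (j : 'I_m) : j != k -> (n == q ^ j.+1)%N = false.
        by move=> jk; rewrite nk eqn_exp2l// eqSS eq_sym; apply/negbTE.
      rewrite (bigD1 k)//= big1 ?addr0 => [|j /uniq ->]; last by rewrite mulr0.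
      rewrite [leRHS](bigD1 k)//= [X in _ + X]big1 ?addr0 => [|j /uniq -> //].
      by rewrite nk eqxx mulr1.
    rewrite big1 ?expr0n ?sumr_ge0// => k _; case: eqP => [nk|_]; last by rewrite mulr0.
    by move: nex; rewrite negb_exists => /forallP/(_ k); rewrite nk eqxx.
  apply: (@le_trans _ _ (\sum_(1 <= n < M.+1) m%:R^-1 ^+ 2 * \sum_(k < m) (n == q ^ k.+1)%N%:R)).
    rewrite /sqsum big_nat_cond [leRHS]big_nat_cond; apply: ler_sum => n /andP[/andP[n0 _] _]; exact: D1.
  rewrite -mulr_sumr exchange_big/= expr2 -mulrA ler_piMr ?invr_ge0 ?(ltW mp)//.
  rewrite ler_pdivrMl// mulr1 -[m in leRHS]card_ord -sumr_const; apply: ler_sum => k _.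
  have [h|h] := boolP (q ^ k.+1 \in index_iota 1 M.+1)%N.
    rewrite (bigD1_seq _ h (iota_uniq _ _))/= eqxx big1 ?addr0//.
    by move=> i /negbTE ->.
  rewrite big_seq big1// => i iM; case: eqP => // e; by rewrite -e iM in h.
move=> M; rewrite (le_trans _ me)//.
have h : sqsum M (fun n => f n - (n == 1%N)%:R) <= 3 * (sqsum M (err X) + sqsum M D + sqsum M E).
  rewrite /sqsum -!big_split/= mulr_sumr; apply: ler_sum => n _; rewrite split.
  have := sqr_ge0 (err X n + D n); have := sqr_ge0 (err X n + E n); have := sqr_ge0 (D n - E n).
  lra.
rewrite (le_trans h)//; have := sqsum_err M X0; have := sE M; have := sD M.
rewrite Xm; move: (sqsum M _) (sqsum M _) (sqsum M _) => x y z.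
have -> : 9 / m%:R = 3 * (m%:R^-1 + m%:R^-1 + m%:R^-1) :> R by ring.
move: (m%:R^-1) => t; lra.
Qed.

Lemma orbit_delta j (eps : R) : (0 < j)%N -> 0 < eps ->
  exists2 f, orbit_span v f & forall M, sqsum M (fun n => f n - (n == j)%:R) <= eps.
Proof.
move=> j0 e0; have [f fs fE] := orbit_delta_1 e0.
exists (shift j f); first exact: orbit_shift.
move=> M; apply: le_trans (fE M); apply: le_trans (sqsum_shift M _ j0).
apply: sqsum_le => n n0; rewrite le_eqVlt; apply/orP; left; apply/eqP; congr (_ ^+ 2).
rewrite /shift; case: ifPn => [jn|jn]; last first.
  by case: eqP => [nj|_]; rewrite ?subrr//; rewrite nj dvdnn in jn.
have -> : (n == j) = (n %/ j == 1)%N; last by [].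
by rewrite -[RHS](eqn_pmul2r j0) divnK// mul1n.
Qed.

End Sieve.
End DirichletApproximation.

(** * From approximation of coefficients to density of the dilates *)

Section PositiveDirection.
Variable R : realType.
Local Notation I := (@I01 R).
Implicit Types f g h : R -> R.

Lemma sn0 (x : R) : sn 0 x = 0.
Proof. by rewrite /sn !mul0r sin0. Qed.

Lemma regroup (F : nat -> R -> R) (s : seq (R * nat)) : (forall x, F 0%N x = 0) ->
  exists M (b : nat -> R), forall x, \sum_(p <- s) p.1 * F p.2 x = \sum_(k < M) b k * F k.+1 x.
Proof.
move=> F0; elim: s => [|[c [|j]] s [M [b IH]]].
- by exists 0%N, (fun=> 0) => x; rewrite big_nil big_ord0.
- by exists M, b => x; rewrite big_cons /= F0 mulr0 add0r.
exists (M + j.+1)%N, (fun k => (if (k < M)%N then b k else 0) + (if k == j then c else 0)) => x.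
rewrite big_cons /= IH.
under [RHS]eq_bigr => k _ do rewrite mulrDl.
rewrite big_split/= [LHS]addrC; congr (_ + _).
  rewrite big_split_ord/= [X in _ + X]big1 ?addr0; last by move=> k _; rewrite ltnNge leq_addr/= mul0r.
  by apply: eq_bigr => k _; rewrite ltn_ord.
have jM : (j < M + j.+1)%N by rewrite addnS ltnS leq_addl.
rewrite (bigD1 (Ordinal jM))//= eqxx big1 ?addr0// => k; rewrite -val_eqE/= => /negbTE ->.
by rewrite mul0r.
Qed.

(** For a sine polynomial p with coefficients b_k and h_k the pairing of h with the k-th sine,
    completing squares gives |h - p|^2 = |h|^2 - 2 sum h_k^2 + (1/2) sum (b_k - 2 h_k)^2; density
    makes the left side small. *)
Lemma parseval_le h (C : R) : inL2 h -> (forall M, sqsum M (fun n => ip h (sn n)) <= C) -> ip h h <= 2 * C.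
Proof.
move=> h2 hC; apply/ler_addgt0Pr => /= e e0; have [_ /(_ e e0)[p [s ps] hp]] := sine_density h2.
have [M [b bE]] := regroup s sn0.
have pE x : p x = \sum_(k < M) b k * sn k.+1 x by rewrite ps bE.
have b2 (k : 'I_M) : inL2 (fun x => b k * sn k.+1 x) by exact/inL2Z/inL2_sn.
have p2 : inL2 p by apply: sinspan_inL2; exists s.
have ipp g : inL2 g -> ip g p = \sum_(k < M) b k * ip g (sn k.+1).
  move=> g2; rewrite (@eq_ip _ g g p (fun x => \sum_(k < M) b k * sn k.+1 x))//.
  by rewrite ip_sumr//; apply: eq_bigr => k _; rewrite ipZr//; exact: inL2_sn.
have pp : ip p p = \sum_(k < M) b k ^+ 2 / 2.
  rewrite ipp//; apply: eq_bigr => k _; rewrite ipC ipp; last exact: inL2_sn.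
  rewrite (bigD1 k)//= big1 ?addr0 => [|j jk]; last first.
    by rewrite ip_sn// eqSS eq_sym -[(_ == _)%N]/(j == k) (negbTE jk) mul0r mulr0.
  by rewrite ip_sn// eqxx /=; field.
have := hC M; rewrite /sqsum big_add1/= big_mkord => hM.
have D : l2dist h p = ip h h - 2 * \sum_(k < M) b k * ip h (sn k.+1) + \sum_(k < M) b k ^+ 2 / 2.
  by rewrite /l2dist ipBB// ipp// pp.
have pos : 0 <= \sum_(k < M) (b k - 2 * ip h (sn k.+1)) ^+ 2 / 2.
  by apply: sumr_ge0 => k _; rewrite divr_ge0// sqr_ge0.
have E : \sum_(k < M) (b k - 2 * ip h (sn k.+1)) ^+ 2 / 2 =
  \sum_(k < M) b k ^+ 2 / 2 - 2 * (\sum_(k < M) b k * ip h (sn k.+1)) + 2 * \sum_(k < M) ip h (sn k.+1) ^+ 2.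
  by rewrite !mulr_sumr -sumrB -big_split; apply: eq_bigr => k _ /=; field.
lra.
Qed.

Section Orbit.
Variables a b : R.
Hypotheses (a0 : 0 <= a) (ab : a < b) (b1 : b <= 1).

Definition sine_coef n : R := 2 * ip (chi a b) (sn n).

Definition comb (s : seq (R * nat)) (x : R) : R := \sum_(p <- s) p.1 * dil (chi a b) p.2 x.

Let pos (s : seq (R * nat)) := all (fun p => (0 < p.2)%N) s.

Lemma comb_inL2 s : pos s -> inL2 (comb s).
Proof.
rewrite /comb; elim: s => [_|[c k] s IH /= /andP[k0 /IH h]].
  by have := inL20 R; congr inL2; apply/funext => x; rewrite big_nil.
have := inL2D (inL2Z c (inL2_bddm (bddm_dil_chi a0 b1 k0))) h.
by congr inL2; apply/funext => x; rewrite big_cons.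
Qed.

Lemma ip_comb s n : pos s -> (0 < n)%N ->
  2 * ip (comb s) (sn n) = \sum_(p <- s) p.1 * shift p.2 sine_coef n.
Proof.
move=> s0 n0; elim: s s0 => [_|[c k] s IH /= /andP[k0 s0]].
  rewrite big_nil (@eq_ip _ _ (fun=> 0) _ (sn n))// ?ip0l ?mulr0// => x _.
  by rewrite /comb big_nil.
rewrite big_cons /= -IH//.
rewrite (@eq_ip _ _ (fun x => c * dil (chi a b) k x + comb s x) _ (sn n))//; last first.
  by move=> x _; rewrite /comb big_cons.
have d2 := inL2_bddm (bddm_dil_chi a0 b1 k0).
rewrite ipDl; [|exact: inL2Z|exact: comb_inL2|exact: inL2_sn].
rewrite ipZl//; last exact: inL2_sn.
rewrite mulrDr mulrCA; congr (c * _ + _); rewrite ip_dil_chi// /shift; case: ifPn => kn; last by rewrite mulr0.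
by rewrite /sine_coef ip_chi_sn// divn_gt0// dvdn_leq.
Qed.

Hypothesis dense : forall j (e : R), (0 < j)%N -> 0 < e ->
  exists2 f, orbit_span sine_coef f & forall M, sqsum M (fun n => f n - (n == j)%:R) <= e.

Lemma sn_near_comb j (e : R) : (0 < j)%N -> 0 < e -> exists2 s, pos s & l2dist (sn j) (comb s) <= e / 2.
Proof.
move=> j0 e0; have [f [s s0 fs] fe] := dense j0 e0; exists s => //.
have S2 := inL2B (inL2_sn R j) (comb_inL2 s0).
have -> : e / 2 = 2 * (e / 4) by field.
apply: parseval_le => // M; rewrite ler_pdivlMr// mulrC.
apply: le_trans (fe M); rewrite /sqsum mulr_sumr big_nat_cond [leRHS]big_nat_cond.
apply: ler_sum => n /andP[/andP[n0 _] _]; rewrite ipBl; [|exact: inL2_sn|exact: comb_inL2|exact: inL2_sn].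
rewrite fs// -ip_comb// ip_sn// eq_sym le_eqVlt; apply/orP; left; apply/eqP; by field.
Qed.

Lemma sinspan_near_comb (t : seq (R * nat)) (e : R) : 0 < e ->
  exists2 s, pos s & l2dist (fun x => \sum_(p <- t) p.1 * sn p.2 x) (comb s) < e.
Proof.
elim: t e => [|[c [|j]] t IH] e e0.
- exists [::] => //; rewrite /l2dist (@eq_ip _ _ (fun=> 0) _ (fun=> 0)) ?ip0l// => x _;
  by rewrite /comb !big_nil subrr.
- have [s s0 hs] := IH e e0; exists s => //; apply: le_lt_trans hs.
  rewrite le_eqVlt; apply/orP; left; apply/eqP; apply: eq_ip => x _;
  by rewrite big_cons/= sn0 mulr0 add0r.
have e4 : 0 < e / 4 by rewrite divr_gt0.
have [s s0 hs] := IH _ e4.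
have c1 : 0 < c ^+ 2 + 1 by rewrite ltr_wpDl// sqr_ge0.
have e' : 0 < e / (2 * (c ^+ 2 + 1)) by rewrite divr_gt0// mulr_gt0.
have [r r0 hr] := sn_near_comb (ltn0Sn j) e'.
pose cr := [seq (c * p.1, p.2) | p <- r].
have cr0 : pos cr by rewrite /pos /cr all_map.
exists (cr ++ s); first by rewrite /pos all_cat; apply/andP.
have T2 : inL2 (fun x => \sum_(p <- t) p.1 * sn p.2 x).
  by apply: inL2_sum => p; exact/inL2Z/inL2_sn.
have A2 := inL2B (inL2_sn R j.+1) (comb_inL2 r0).
have B2 := inL2B T2 (comb_inL2 s0).
apply: (@le_lt_trans _ _ (2 * (c ^+ 2 * l2dist (sn j.+1) (comb r)) +
   2 * l2dist (fun x => \sum_(p <- t) p.1 * sn p.2 x) (comb s))).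
  have := ip_le_sum (inL2Z c A2) B2.
  rewrite (ipZl c A2 (inL2Z c A2)) (ipZr c A2 A2) [c * (c * _)]mulrA -expr2; apply: le_trans.
  have catE x : comb (cr ++ s) x = c * comb r x + comb s x.
    by rewrite /comb big_cat big_map mulr_sumr; congr (_ + _); apply: eq_bigr => p _; rewrite /= mulrA.
  by rewrite le_eqVlt; apply/orP; left; apply/eqP; apply: eq_ip => x _; rewrite big_cons catE /=; ring.
have h1 : c ^+ 2 * l2dist (sn j.+1) (comb r) <= e / 4.
  apply: le_trans (ler_wpM2l (sqr_ge0 c) hr) _.
  have -> : c ^+ 2 * (e / (2 * (c ^+ 2 + 1)) / 2) = e / 4 * (c ^+ 2 / (c ^+ 2 + 1)).
    by field; rewrite gt_eqF.
  by rewrite ler_piMr ?(ltW e4)// ler_pdivrMr// mul1r lerDl.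
lra.
Qed.

Lemma inC_of_dense : inC (chi a b).
Proof.
split; first exact/inL2_bddm/bddm_chi.
move=> g g2 e e0; have e4 : 0 < e / 4 by rewrite divr_gt0.
have [_ /(_ _ e4)[p [t pt] gp]] := sine_density g2.
have [s s0 ps] := sinspan_near_comb t e4.
have dil0 x : dil (chi a b) 0 x = 0 by rewrite /dil mul0r; exact: (oddext_nat _ 0).
have [n [c cE]] := regroup s dil0.
have S2 := comb_inL2 s0.
exists n, c; have -> : (fun x => g x - \sum_(k < n) c k * dil (chi a b) k.+1 x) = (fun x => g x - comb s x).
  by apply/funext => x; rewrite /comb cE.
rewrite sqint_ip; last exact: inL2B.
have p2 : inL2 p by apply: sinspan_inL2; exists t.
have pE : p = (fun x => \sum_(p <- t) p.1 * sn p.2 x) by exact/funext.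
rewrite lte_fin -[ip _ _]/(l2dist g (comb s)); apply: le_lt_trans (l2dist_triangle g2 p2 S2) _.
rewrite -pE in ps; lra.
Qed.

End Orbit.
End PositiveDirection.

(** * The ten intervals *)

Section TenIntervals.
Variable R : realType.

(** A period of a completely multiplicative function with values in {-1, 0, 1}, checked by
    computation on residues. *)
Definition character_table L (chr : seq int) := [&& nth 0 chr (1 %% L) == 1,
  all (fun i => `|nth 0 chr i| <= 1) (iota 0 L) &
  all (fun i => all (fun j => nth 0 chr (i * j %% L) == nth 0 chr i * nth 0 chr j) (iota 0 L)) (iota 0 L)].

(** [tab] lists 2 cos (k pi / M). The identity required over one period 2M is c_n = kappa (lambda_n
    + sigma q lambda_{n/q}); dividing by n turns it into the hypothesis of the sieve, since q / n =
    1 / (n/q). *)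
Lemma inC_of_table (M A B L q : nat) (tab : seq R) (chr : seq int) (sigma kappa : R) :
  (0 < M)%N -> (A < B)%N -> (B <= M)%N -> (1 < q)%N -> (0 < L)%N -> character_table L chr ->
  (L %| 2 * M)%N -> sigma = 0 \/ (q * L %| 2 * M)%N -> `|sigma| <= 1 -> kappa != 0 ->
  (forall k, (k < 2 * M)%N -> cos (k%:R * (pi / M%:R)) = tab`_k / 2) ->
  (forall n, (n < 2 * M)%N -> tab`_(A * n %% (2 * M)) - tab`_(B * n %% (2 * M)) =
     2 * kappa * ((chr`_(n %% L))%:~R +
       sigma * q%:R * (if (q %| n)%N then (chr`_(n %/ q %% L))%:~R else 0))) ->
  inC (chi (A%:R / M%:R : R) (B%:R / M%:R)).
Proof.
move=> M0 AB BM q1 L0 /and3P[/eqP chr1 /allP chr_le /allP chrM] LM qLM s1 k0 tabE eqn.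
have q0 := ltnW q1; have M20 : (0 < 2 * M)%N by rewrite muln_gt0.
have Mp : 0 < M%:R :> R by rewrite ltr0n.
pose a : R := A%:R / M%:R; pose b : R := B%:R / M%:R.
have a0 : 0 <= a by rewrite /a divr_ge0.
have ab : a < b by rewrite /a /b ltr_pM2r ?invr_gt0// ltr_nat.
have b1 : b <= 1 by rewrite /b ler_pdivrMr// mul1r ler_nat.
pose lam n : R := (chr`_(n %% L))%:~R.
have cosE C n : cos (n%:R * pi * (C%:R / M%:R)) = tab`_(C * n %% (2 * M)) / 2 :> R.
  rewrite -tabE ?ltn_pmod//.
  have -> : n%:R * pi * (C%:R / M%:R) = (C * n)%:R * pi * (2 * 1%:R / (2 * M)%:R) :> R.
    by rewrite !natrM; field; rewrite gt_eqF.
  rewrite (@cos_periodic R (2 * M) 1 (C * n) (C * n %% (2 * M)))// ?modn_mod//.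
  by congr cos; rewrite natrM; field; rewrite gt_eqF.
have cfE n : cf a b n = kappa * (lam n + sigma * q%:R * (if (q %| n)%N then lam (n %/ q)%N else 0)).
  have n2M : (n %% (2 * M) < 2 * M)%N by rewrite ltn_pmod.
  have := eqn _ n2M; rewrite !modnMmr modn_dvdm// => e.
  have half (x : R) : 2 * kappa * x / 2 = kappa * x by field.
  rewrite /cf !cosE -mulrBl e half.
  congr (_ * (_ + _)); case: qLM => [->|qL]; first by rewrite !mul0r.
  congr (_ * _); have qM : (q %| 2 * M)%N by exact: dvdn_trans (dvdn_mulr _ (dvdnn _)) qL.
  have -> : (q %| n %% (2 * M))%N = (q %| n)%N by rewrite /dvdn modn_dvdm.
  case: ifP => // qn; rewrite /lam; congr ((chr`_ _)%:~R).
  case/dvdnP: qL => t tE.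
  have nE : (n %/ q = (n %/ (2 * M) * t) * L + (n %% (2 * M)) %/ q)%N.
    rewrite {1}(divn_eq n (2 * M)) divnDl; last exact: dvdn_mull.
    congr (_ + _)%N; rewrite -muln_divA//; rewrite -[RHS]mulnA; congr (_ * _)%N.
    by rewrite tE mulnCA mulKn.
  by rewrite nE modnMDl.
apply: (inC_of_dense a0 ab b1) => j e j0 e0.
have K0 : 2 * kappa / pi != 0.
  apply: mulf_neq0; last by rewrite invr_eq0 gt_eqF ?pi_gt0.
  by apply: mulf_neq0 => //; rewrite pnatr_eq0.
have memL n : (n %% L)%N \in iota 0 L by rewrite mem_iota/= ltn_pmod.
apply: (@orbit_delta R lam q sigma (2 * kappa / pi) (sine_coef a b)) => //.
- by rewrite /lam chr1.
- move=> m n _ _; rewrite /lam -modnMm -intrM; congr (_%:~R); apply/eqP.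
  by have /allP := chrM _ (memL m); apply.
- by move=> n; rewrite /lam -intr_norm -[1]/(1%:~R) ler_int chr_le.
- move=> n n0; rewrite /sine_coef ip_chi_sn// -/(cf a b n) cfE /shift.
  have pn : pi != 0 :> R by rewrite gt_eqF ?pi_gt0.
  have nn : n%:R != 0 :> R by rewrite pnatr_eq0 -lt0n.
  move: (pi : R) pn => p pn; case: ifPn => qn; last by field; rewrite pn nn.
  have qq : q%:R != 0 :> R by rewrite pnatr_eq0 -lt0n.
  have dd : (n %/ q)%:R != 0 :> R by rewrite pnatr_eq0 -lt0n divn_gt0// dvdn_leq.
  have nE : n%:R = (n %/ q)%:R * q%:R :> R by rewrite -natrM divnK.
  by rewrite nE; field; rewrite ?pn ?qq ?dd.
Qed.

Lemma cos_table (z s : R) (tab : seq R) N : 2 * cos z = s -> tab`_0 = 2 -> tab`_1 = s ->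
  (forall k, (k.+2 < N)%N -> tab`_k.+2 = s * tab`_k.+1 - tab`_k) ->
  forall k, (k < N)%N -> cos (k%:R * z) = tab`_k / 2.
Proof.
move=> zs t0 t1 rec; elim/ltn_ind => -[|[|k]] IH kN.
- by rewrite t0 mul0r cos0 divff ?pnatr_eq0.
- by rewrite t1 mul1r -zs; field.
have k1 := ltnW kN; have k0 := ltnW k1.
by rewrite cos_rec (IH k.+1)// (IH k)// rec// zs; field.
Qed.

Lemma cos_gt0_frac (M : nat) : (2 < M)%N -> 0 < cos (pi / M%:R) :> R.
Proof.
move=> M2; have Mp : 0 < M%:R :> R by rewrite ltr0n (ltn_trans _ M2).
have p0 := pi_gt0 R; apply: cos_gt0_pihalf; apply/andP; split.
  by apply: (@lt_trans _ _ 0); rewrite ?divr_gt0// oppr_lt0 divr_gt0.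
by rewrite ltr_pM2l// ltf_pV2 ?posrE// ltr_nat.
Qed.

Let s4 : R := 2 * cos (pi / 4%:R).
Lemma s4_sqr : s4 * s4 = 2.
Proof.
have := cos_double (pi / 4%:R : R); have -> : 2%:R * (pi / 4%:R) = pi / 2 :> R by field.
by rewrite cos_pihalf /s4; lra.
Qed.

(** The golden ratio; [s5 - 2^-1], which serves as kappa for the denominator 5, is half of sqrt
    5. *)
Let s5 : R := 2 * cos (pi / 5%:R).
Lemma s5_sqr : s5 * s5 = s5 + 1.
Proof.
have p := cos_gt0_frac (isT : 2 < 5)%N.
have : cos (3%:R * (pi / 5%:R)) = - cos (2%:R * (pi / 5%:R)) :> R.
  have -> : 3%:R * (pi / 5%:R) = pi - 2%:R * (pi / 5%:R) :> R by field.
  by rewrite cosB cospi sinpi; ring.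
rewrite cos_triple cos_double /s5; move: (cos _) p => c p h.
have /eqP : (c + 1) * (2 * c * (2 * c) - (2 * c + 1)) = 0.
  have -> : (c + 1) * (2 * c * (2 * c) - (2 * c + 1)) = (4 * c ^+ 3 - 3 * c) - - (2 * c ^+ 2 - 1) by ring.
  by rewrite h subrr.
by rewrite mulf_eq0 => /orP[/eqP|/eqP]; lra.
Qed.

Let s6 : R := 2 * cos (pi / 6%:R).
Lemma s6_sqr : s6 * s6 = 3.
Proof.
have p := cos_gt0_frac (isT : 2 < 6)%N.
have : cos (3%:R * (pi / 6%:R)) = 0 :> R.
  have -> : 3%:R * (pi / 6%:R) = pi / 2 :> R by field.
  exact: cos_pihalf.
rewrite cos_triple /s6; move: (cos _) p => c p h.
have /eqP : c * (2 * c * (2 * c) - 3) = 0.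
  by rewrite -h; ring.
by rewrite mulf_eq0 => /orP[/eqP|/eqP]; lra.
Qed.

Lemma cos_table1 k : (k < 2 * 1)%N -> cos (k%:R * (pi / 1%:R)) = [:: 2; -2]`_k / 2 :> R.
Proof.
apply: (@cos_table _ (-2)) => //; first by rewrite divr1 cospi mulrN1.
Qed.

Lemma cos_table2 k : (k < 2 * 2)%N -> cos (k%:R * (pi / 2%:R)) = [:: 2; 0; -2; 0]`_k / 2 :> R.
Proof.
apply: (@cos_table _ 0) => //; first by rewrite cos_pihalf mulr0.
by do 2!(case=> [_ /=|]; first by ring).
Qed.

Lemma cos_table3 k : (k < 2 * 3)%N -> cos (k%:R * (pi / 3%:R)) = [:: 2; 1; -1; -2; -1; 1]`_k / 2 :> R.
Proof.
apply: (@cos_table _ 1) => //.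
  have -> : pi / 3%:R = pi * (2%:R / 6) :> R by field.
  by rewrite cos_pi_third divff ?pnatr_eq0.
by do 4!(case=> [_ /=|]; first by ring).
Qed.

Lemma cos_table4 k : (k < 2 * 4)%N ->
  cos (k%:R * (pi / 4%:R)) = [:: 2; s4; 0; - s4; -2; - s4; 0; s4]`_k / 2 :> R.
Proof.
apply: (@cos_table _ s4) => //; have h := s4_sqr.
by do 6!(case=> [_ /=|]; first by lra).
Qed.

Lemma cos_table5 k : (k < 2 * 5)%N ->
  cos (k%:R * (pi / 5%:R)) = [:: 2; s5; s5 - 1; 1 - s5; - s5; -2; - s5; 1 - s5; s5 - 1; s5]`_k / 2 :> R.
Proof.
apply: (@cos_table _ s5) => //; have h := s5_sqr.
by do 8!(case=> [_ /=|]; first by lra).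
Qed.

Lemma cos_table6 k : (k < 2 * 6)%N ->
  cos (k%:R * (pi / 6%:R)) = [:: 2; s6; 1; 0; -1; - s6; -2; - s6; -1; 0; 1; s6]`_k / 2 :> R.
Proof.
apply: (@cos_table _ s6) => //; have h := s6_sqr.
by do 10!(case=> [_ /=|]; first by lra).
Qed.

Let s4_neq0 : s4 != 0. Proof. by rewrite /s4 mulf_neq0 ?pnatr_eq0// gt_eqF// cos_gt0_frac. Qed.

Let s6_neq0 : s6 != 0. Proof. by rewrite /s6 mulf_neq0 ?pnatr_eq0// gt_eqF// cos_gt0_frac. Qed.

Let s5_neq0 : s5 - 2^-1 != 0.
Proof. by apply/eqP => /subr0_eq e; have := s5_sqr; rewrite e; lra. Qed.

Let sigma_le1 (x : R) : x \in [:: 0; 1; -1] -> `|x| <= 1.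
Proof. by rewrite !inE => /or3P[] /eqP ->; rewrite ?normr0 ?normrN ?normr1. Qed.

Let inC_0_1 : inC (chi (0%:R / 1%:R : R) (1%:R / 1%:R)).
Proof.
apply: (inC_of_table (L := 2) (q := 2) (chr := [:: 0; 1]) (sigma := 0) (kappa := 2)
  _ _ _ _ _ _ _ _ _ _ cos_table1) => //;
  try solve [by left|by rewrite pnatr_eq0|by apply: sigma_le1; rewrite !inE eqxx ?orbT].
by do 2!(case=> [_|]; first by rewrite /=; field).
Qed.

Let inC_0_12 : inC (chi (0%:R / 2%:R : R) (1%:R / 2%:R)).
Proof.
apply: (inC_of_table (L := 2) (q := 2) (chr := [:: 0; 1]) (sigma := 1) (kappa := 1)
  _ _ _ _ _ _ _ _ _ _ cos_table2) => //;
  try solve [by right|exact: oner_neq0|by apply: sigma_le1; rewrite !inE eqxx ?orbT].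
by do 4!(case=> [_|]; first by rewrite /=; field).
Qed.

Let inC_12_1 : inC (chi (1%:R / 2%:R : R) (2%:R / 2%:R)).
Proof.
apply: (inC_of_table (L := 2) (q := 2) (chr := [:: 0; 1]) (sigma := -1) (kappa := 1)
  _ _ _ _ _ _ _ _ _ _ cos_table2) => //;
  try solve [by right|exact: oner_neq0|by apply: sigma_le1; rewrite !inE eqxx ?orbT].
by do 4!(case=> [_|]; first by rewrite /=; field).
Qed.

Let inC_0_23 : inC (chi (0%:R / 3%:R : R) (2%:R / 3%:R)).
Proof.
apply: (inC_of_table (L := 3) (q := 2) (chr := [:: 0; 1; 1]) (sigma := 0) (kappa := 3 / 2)
  _ _ _ _ _ _ _ _ _ _ cos_table3) => //;
  try solve [by left|by rewrite mulf_neq0 ?invr_eq0 ?pnatr_eq0|by apply: sigma_le1; rewrite !inE eqxx ?orbT].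
by do 6!(case=> [_|]; first by rewrite /=; field).
Qed.

Let inC_13_23 : inC (chi (1%:R / 3%:R : R) (2%:R / 3%:R)).
Proof.
apply: (inC_of_table (L := 2) (q := 3) (chr := [:: 0; 1]) (sigma := -1) (kappa := 1)
  _ _ _ _ _ _ _ _ _ _ cos_table3) => //;
  try solve [by right|exact: oner_neq0|by apply: sigma_le1; rewrite !inE eqxx ?orbT].
by do 6!(case=> [_|]; first by rewrite /=; field).
Qed.

Let inC_13_1 : inC (chi (1%:R / 3%:R : R) (3%:R / 3%:R)).
Proof.
apply: (inC_of_table (L := 3) (q := 2) (chr := [:: 0; 1; 1]) (sigma := -1) (kappa := 3 / 2)
  _ _ _ _ _ _ _ _ _ _ cos_table3) => //;
  try solve [by right|by rewrite mulf_neq0 ?invr_eq0 ?pnatr_eq0|by apply: sigma_le1; rewrite !inE eqxx ?orbT].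
by do 6!(case=> [_|]; first by rewrite /=; field).
Qed.

(** The even quadratic character modulo 8, that of the field generated by sqrt 2, with kappa = sqrt
    2. *)
Let inC_14_34 : inC (chi (1%:R / 4%:R : R) (3%:R / 4%:R)).
Proof.
apply: (inC_of_table (L := 8) (q := 2) (chr := [:: 0; 1; 0; -1; 0; -1; 0; 1]) (sigma := 0) (kappa := s4)
  _ _ _ _ _ _ _ _ _ _ cos_table4) => //;
  try solve [by left|exact: s4_neq0|by apply: sigma_le1; rewrite !inE eqxx ?orbT].
by do 8!(case=> [_|]; first by rewrite /=; field).
Qed.

Let inC_15_35 : inC (chi (1%:R / 5%:R : R) (3%:R / 5%:R)).
Proof.
apply: (inC_of_table (L := 5) (q := 2) (chr := [:: 0; 1; -1; -1; 1]) (sigma := 1) (kappa := s5 - 2^-1)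
  _ _ _ _ _ _ _ _ _ _ cos_table5) => //;
  try solve [by right|exact: s5_neq0|by apply: sigma_le1; rewrite !inE eqxx ?orbT].
by do 10!(case=> [_|]; first by rewrite /=; field).
Qed.

Let inC_25_45 : inC (chi (2%:R / 5%:R : R) (4%:R / 5%:R)).
Proof.
apply: (inC_of_table (L := 5) (q := 2) (chr := [:: 0; 1; -1; -1; 1]) (sigma := 0) (kappa := s5 - 2^-1)
  _ _ _ _ _ _ _ _ _ _ cos_table5) => //;
  try solve [by left|exact: s5_neq0|by apply: sigma_le1; rewrite !inE eqxx ?orbT].
by do 10!(case=> [_|]; first by rewrite /=; field).
Qed.

(** The even quadratic character modulo 12, that of the field generated by sqrt 3, with kappa = sqrt
    3. *)
Let inC_16_56 : inC (chi (1%:R / 6%:R : R) (5%:R / 6%:R)).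
Proof.
apply: (inC_of_table (L := 12) (q := 2) (chr := [:: 0; 1; 0; 0; 0; -1; 0; -1; 0; 0; 0; 1]) (sigma := 0) (kappa := s6)
  _ _ _ _ _ _ _ _ _ _ cos_table6) => //;
  try solve [by left|exact: s6_neq0|by apply: sigma_le1; rewrite !inE eqxx ?orbT].
by do 12!(case=> [_|]; first by rewrite /=; field).
Qed.

Lemma inC_of_mem (alpha beta : rat) : (alpha, beta) \in
    [:: (0, 1); (0, 1/2); (1/2, 1); (0, 2/3); (1/3, 2/3);
        (1/3, 1); (1/4, 3/4); (1/5, 3/5); (2/5, 4/5); (1/6, 5/6)] ->
  inC (chi (ratr alpha : R) (ratr beta)).
Proof.
have key A B M : inC (chi (A%:R / M%:R : R) (B%:R / M%:R)) ->
    alpha == A%:R / M%:R -> beta == B%:R / M%:R -> inC (chi (ratr alpha : R) (ratr beta)).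
  by move=> h /eqP -> /eqP ->; rewrite !fmorph_div !rmorph_nat.
rewrite !inE => h; do 9?[case/orP: h => h]; case/eqP: h => aE bE.
- by apply: (key _ _ _ inC_0_1); rewrite ?aE ?bE.
- by apply: (key _ _ _ inC_0_12); rewrite ?aE ?bE.
- by apply: (key _ _ _ inC_12_1); rewrite ?aE ?bE.
- by apply: (key _ _ _ inC_0_23); rewrite ?aE ?bE.
- by apply: (key _ _ _ inC_13_23); rewrite ?aE ?bE.
- by apply: (key _ _ _ inC_13_1); rewrite ?aE ?bE.
- by apply: (key _ _ _ inC_14_34); rewrite ?aE ?bE.
- by apply: (key _ _ _ inC_15_35); rewrite ?aE ?bE.
- by apply: (key _ _ _ inC_25_45); rewrite ?aE ?bE.
- by apply: (key _ _ _ inC_16_56); rewrite ?aE ?bE.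
Qed.

End TenIntervals.

Unset Implicit Arguments.
Set Strict Implicit.

Theorem theorem1p8 (R : realType) (alpha beta : rat)
  (h0 : 0 <= alpha) (hab : alpha < beta) (h1 : beta <= 1) :
  inC (chi (ratr alpha : R) (ratr beta)) <->
  (alpha, beta) \in [:: (0, 1); (0, 1/2); (1/2, 1); (0, 2/3); (1/3, 2/3);
                        (1/3, 1); (1/4, 3/4); (1/5, 3/5); (2/5, 4/5); (1/6, 5/6)].
Proof.
split; last exact: inC_of_mem.
by move=> /(inC_listed h0 hab h1)[a [b [lab -> ->]]]; exact: listed_rat.
Qed.
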